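(* Let $D$ be an integral domain with $w$-$\dim_v(D)<\infty$. Then the following are equivalent: (1) every overring of $D$ is a $w$-stably strong S-domain; (2) every overring of $D$ is a $w$-strong S-domain; (3) every overring of $D$ is a UM$t$ domain; (4) $D$ is a quasi-Pr\''ufer domain.
   Context: Let $D$ be an integral domain with quotient field $K$. For a nonzero fractional ideal $A$ put $A^{-1}=\{x\in K: xA\subseteq D\}$, $A^v=(A^{-1})^{-1}$, $A^t=\bigcup\{F^v: F\subseteq A$ nonzero finitely generated$\}$, $A^w=\{x\in K: xJ\subseteq A$ for some nonzero finitely generated ideal $J\subseteq D$ with $J^v=D\}$. For a star operation $*$ on $D$, a $*$-prime is a prime ideal $P$ with $P^*=P$; $*_f$ is defined by $A^{*_f}=\bigcup\{F^*: F\subseteq A$ nonzero finitely generated$\}$. A valuation overring $V$ is a $w$-valuation overring if $F^w\subseteq FV$ for all nonzero finitely generated fractional ideals $F$; $w$-$\dim_v(D)=\sup\{\dim V: V$ a $w$-valuation overring of $D\}$. Construction: given a star operation $*$ on $D$ and an indeterminate $X$, let $\Theta=\{Q\in\operatorname{Spec}(D[X]): Q\cap D=(0)$ or $(Q\cap D)^{*_f}\subsetneq D\}$, let $Y$ be another indeterminate, $\mathfrak S=D[X][Y]\setminus\bigcup\{Q[Y]:Q\in\Theta\}$, and define the star operation $*[X]$ on $D[X]$ by $E^{*[X]}=E[Y]_{\mathfrak S}\cap K(X)$ for nonzero fractional ideals $E$ of $D[X]$. Put $w[1]=w[X_1]$ on $D[1]=D[X_1]$ and $w[n]=(w[n-1])[X_n]$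 on $D[n]=D[X_1,\dots,X_n]$. $D$ (with star operation $*$) is a $*$-strong S-domain if for every pair of adjacent $*$-primes $P_1\subsetneq P_2$ of $D$ (no $*$-prime strictly between them), $P_1[X]\subsetneq P_2[X]$ is a pair of adjacent $*[X]$-primes of $D[X]$. $D$ is a $w$-strong S-domain if it is a $*$-strong S-domain for $*=w$, and a $w$-stably strong S-domain if for every $n\ge1$ the ring $D[n]$ is a $w[n]$-strong S-domain (for $n=0$ included implicitly, i.e. $D$ is also $w$-strong S). For an overring $T$, these notions are taken with respect to the $w$-operation of $T$. $D$ is a UM$t$ domain if every upper to zero in $D[X]$ (nonzero prime $Q$ of $D[X]$ with $Q\cap D=(0)$) is a maximal $t$-ideal of $D[X]$ (a $t$-ideal $I=I^t$ maximal among proper $t$-ideals). $D$ is a quasi-Pr\''ufer domain if for every prime $P$ of $D$ and every prime $Q$ of $D[X]$ with $Q\subseteq P[X]$, $Q=(Q\cap D)[X]$. *)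

(* Defs.v *)
From HB Require Import structures.
From mathcomp Require Import all_boot all_order all_algebra.
From mathcomp Require Import fraction.
Set Implicit Arguments. Unset Strict Implicit. Unset Printing Implicit Defensive.
Import GRing.Theory.
Local Open Scope ring_scope.

Definition pset (K : fieldType) := K -> Prop.

Section Framework.
Variable K : fieldType.
Implicit Types (A B D T V P Q : pset K).

Definition subs A B := forall x, A x -> B x.
Definition pseteq A B := subs A B /\ subs B A.
Definition strict_subs A B := subs A B /\ ~ subs B A.
Definition nonzero A := exists x, A x /\ x != 0.

Definition is_subring D :=
  [/\ D 0, D 1, (forall x y, D x -> D y -> D (x - y))
    & (forall x y, D x -> D y -> D (x * y))].

Definition is_frac_field_of D :=
  forall x, exists a b, [/\ D a, D b, b != 0 & x = a / b].

Definition overring D T := is_subring T /\ subs D T.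

Definition ideal_of D I :=
  [/\ subs I D, I 0, (forall x y, I x -> I y -> I (x + y))
    & (forall r x, D r -> I x -> I (r * x))].

Definition prime_of D P :=
  [/\ ideal_of D P, ~ subs D P
    & (forall x y, D x -> D y -> P (x * y) -> P x \/ P y)].

Definition fspan D (s : seq K) : pset K := fun x =>
  exists c : seq K, [/\ size c = size s,
    (forall i, (i < size c)%N -> D c`_i) & x = \sum_(i < size s) c`_i * s`_i].

Definition inv_of D A : pset K := fun x => forall a, A a -> D (x * a).
Definition v_of D A : pset K := inv_of D (inv_of D A).

Definition finite_type_of D (star : pset K -> pset K) A : pset K := fun x =>
  exists s, [/\ subs (fspan D s) A, nonzero (fspan D s) & star (fspan D s) x].

Definition t_of D A : pset K := finite_type_of D (v_of D) A.

Definition w_of D A : pset K := fun x =>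
  exists s, [/\ subs (fspan D s) D, nonzero (fspan D s),
     pseteq (v_of D (fspan D s)) D
   & subs (fun y => exists j, fspan D s j /\ y = x * j) A].

Definition star_prime D (star : pset K -> pset K) P :=
  prime_of D P /\ pseteq (star P) P.

Definition adjacent D (star : pset K -> pset K) P1 P2 :=
  [/\ star_prime D star P1, star_prime D star P2, strict_subs P1 P2
    & forall Q, star_prime D star Q -> strict_subs P1 Q -> ~ strict_subs Q P2].

Definition valuation_overring D V :=
  overring D V /\ forall x, x != 0 -> V x \/ V x^-1.

(* F^w ⊆ FV for every nonzero f.g. fractional ideal F = (s)D; FV = (s)V *)
Definition w_valuation_overring D V :=
  valuation_overring D V /\
  forall s, nonzero (fspan D s) -> subs (w_of D (fspan D s)) (fspan V s).

Definition dim_le V (N : nat) :=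
  forall (k : nat) (P : nat -> pset K),
    (forall i, (i <= k)%N -> prime_of V (P i)) ->
    (forall i, (i < k)%N -> strict_subs (P i) (P i.+1)) -> (k <= N)%N.

Definition w_dimv_finite D :=
  exists N : nat, forall V, w_valuation_overring D V -> dim_le V N.

End Framework.

Definition KX (K : fieldType) : fieldType := {fraction {poly K}}.

Definition cst (K : fieldType) (a : K) : KX K := FracField.tofrac (a%:P).

Definition polyext (K : fieldType) (A : pset K) : pset (KX K) := fun f =>
  exists p : {poly K}, (forall i, (i < size p)%N -> A p`_i) /\
                      f = FracField.tofrac p.

Definition contract (K : fieldType) (D : pset K) (Q : pset (KX K)) : pset K :=
  fun a => D a /\ Q (cst a).

Definition Theta (K : fieldType) (D : pset K) (star : pset K -> pset K)
  (Q : pset (KX K)) :=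
  prime_of (polyext D) Q /\
  (subs (contract D Q) (fun a => a = 0) \/
   strict_subs (finite_type_of D star (contract D Q)) D).

(* E^{*[X]} = E[Y]_S ∩ K(X): f with s f ∈ E[Y] for some s ∈ S, where
   S = D[X][Y] \ U_{Q in Theta} Q[Y] *)
Definition starX (K : fieldType) (D : pset K) (star : pset K -> pset K)
  (E : pset (KX K)) : pset (KX K) := fun f =>
  exists s : {poly KX K},
    [/\ forall i, (i < size s)%N -> polyext D s`_i,
        forall Q, Theta D star Q -> exists2 i, (i < size s)%N & ~ Q s`_i
      & forall i, (i < size s)%N -> E (s`_i * f)].

Record sdom := SDom { sfld : fieldType; sdomain : pset sfld;
                      sop : pset sfld -> pset sfld }.

Definition sstep (d : sdom) : sdom :=
  @SDom (KX (sfld d)) (polyext (@sdomain d)) (starX (@sdomain d) (@sop d)).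

Definition star_strongS (d : sdom) :=
  forall P1 P2 : pset (sfld d), adjacent (@sdomain d) (@sop d) P1 P2 ->
    adjacent (polyext (@sdomain d)) (starX (@sdomain d) (@sop d))
             (polyext P1) (polyext P2).

Definition w_strongS (K : fieldType) (D : pset K) :=
  star_strongS (@SDom K D (w_of D)).

Definition w_stably_strongS (K : fieldType) (D : pset K) :=
  forall n : nat, star_strongS (iter n sstep (@SDom K D (w_of D))).

Definition upper_to_zero (K : fieldType) (D : pset K) (Q : pset (KX K)) :=
  [/\ prime_of (polyext D) Q, nonzero Q & subs (contract D Q) (fun a => a = 0)].

Definition t_ideal (K : fieldType) (D : pset K) (I : pset K) :=
  [/\ ideal_of D I, ~ subs D I & pseteq (t_of D I) I].

Definition maximal_t_ideal (K : fieldType) (D : pset K) (I : pset K) :=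
  t_ideal D I /\ forall J, t_ideal D J -> subs I J -> subs J I.

Definition UMt (K : fieldType) (D : pset K) :=
  forall Q, upper_to_zero D Q -> maximal_t_ideal (polyext D) Q.

Definition quasi_Prufer (K : fieldType) (D : pset K) :=
  forall (P : pset K) (Q : pset (KX K)), prime_of D P -> prime_of (polyext D) Q ->
    subs Q (polyext P) -> pseteq Q (polyext (contract D Q)).

Definition base_dom (R : idomainType) : pset {fraction R} :=
  fun x => exists r : R, x = FracField.tofrac r.

(* Main.v *)
(** [D] is quasi-Prüfer iff no valuation overring [V] of [D] contains an element [u] residually
transcendental over [D] ([residually_transcendental]). Given such [V] and [u], the pullback
[B = D_P + m_V] has divisorial maximal ideal [m_V], and for a prime [n0] of [V] inside [m_V] the
polynomials with [f(u)] in [n0] form a prime of [B[X]] between [n0[X]] and [m_V[X]]. With [n0 = 0]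
this contradicts UMt, with [n0] just below [m_V] it contradicts w-strong S. Such an [n0] exists
since strong S for all overrings makes [w] trivial on [D], so valuation overrings are w-valuation
overrings, of finite dimension. Conversely, over a quasi-Prüfer [D] all the operations [w[n]] are
trivial, and a form of Zariski's main theorem shows that a valuation ring centred on a height-one
prime of a homomorphic image of [D[n]] is residually algebraic over it, which leaves no room for a
prime between [P1[X]] and [P2[X]] when [P1], [P2] are adjacent. *)
Require Import Defs.
From HB Require Import structures.
From mathcomp Require Import all_boot all_order all_algebra.
From mathcomp Require Import fraction.
From mathcomp Require Import boolp.
From mathcomp Require classical_sets.
From mathcomp Require Import ring zify.
Set Implicit Arguments. Unset Strict Implicit. Unset Printing Implicit Defensive.
Import GRing.Theory.
Local Open Scope ring_scope.

Lemma zorn_union (T : Type) (G : (T -> Prop) -> Prop) :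
  (exists A, G A) ->
  (forall F : (T -> Prop) -> Prop, (exists A, F A) -> (forall A, F A -> G A) ->
     (forall A B, F A -> F B ->
        (forall x, A x -> B x) \/ (forall x, B x -> A x)) ->
     G (fun x => exists2 A, F A & A x)) ->
  exists A, G A /\
    forall B, G B -> (forall x, A x -> B x) -> forall x, B x -> A x.
Proof.
move=> [A0 GA0] Gch.
pose P (X : T -> Prop) := G X \/ (forall x, ~ X x).
have [|A [PA maxA]] := @classical_sets.Zorn_bigcup T P.
  move=> F FP Ftot.
  case: (pselect (exists A, F A /\ G A)) => [[A [FA GA]]|noG]; last first.
    right=> x [X FX Xx].
    by have [GX|X0] := FP _ FX; [apply: noG; exists X | exact: (X0 x)].
  left; have -> : classical_sets.bigcup F (fun X => X)
      = (fun x => exists2 A, (F A /\ G A) & A x).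
    apply/funext => x; apply/propext; split=> [[X FX Xx]|[X [FX _] Xx]].
      exists X => //; split=> //.
      by have [//|X0] := FP _ FX; case: (X0 x).
    by exists X.
  apply: Gch; first by exists A.
    by move=> B [].
  by move=> B C [FB _] [FC _]; exact: Ftot.
have max' B : G B -> (forall x, A x -> B x) -> forall x, B x -> A x.
  move=> GB AB; apply: contrapT => nBA.
  by apply: (maxA B); [split | left].
case: PA => [GA|A_0]; first by exists A.
exists A; split=> //.
have eqA : A = A0.
  apply/funext => x; apply/propext; split=> [/A_0 //|].
  by apply: max' => // y /A_0.
by rewrite eqA.
Qed.

(** * Subrings, primes and valuation rings *)

Section Subrings.
Variable L : fieldType.
Implicit Types (A B C D R V M P Q I E : pset L) (x y z : L).

Section Closure.
Variables (A : pset L) (Asr : is_subring A).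

Lemma sr0 : A 0. Proof. by case: Asr. Qed.
Lemma sr1 : A 1. Proof. by case: Asr. Qed.
Lemma srB x y : A x -> A y -> A (x - y). Proof. by case: Asr => _ _ + _; apply. Qed.
Lemma srM x y : A x -> A y -> A (x * y). Proof. by case: Asr => _ _ _; apply. Qed.
Lemma srN x : A x -> A (- x). Proof. by move=> Ax; rewrite -sub0r; apply: srB => //; apply: sr0. Qed.
Lemma srD x y : A x -> A y -> A (x + y).
Proof. by move=> Ax Ay; rewrite -[y]opprK; apply: srB => //; apply: srN. Qed.
Lemma srX n x : A x -> A (x ^+ n).
Proof. by move=> Ax; elim: n => [|n IH]; rewrite ?expr0 ?exprS; [exact: sr1|exact: srM]. Qed.
Lemma sr_sum (T : Type) (r : seq T) (F : T -> L) (p : pred T) :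
  (forall i, p i -> A (F i)) -> A (\sum_(i <- r | p i) F i).
Proof. by move=> AF; elim/big_ind: _ => //; [exact: sr0|exact: srD]. Qed.
End Closure.

Lemma cap_sr A B : is_subring A -> is_subring B -> is_subring (fun x => A x /\ B x).
Proof.
move=> Asr Bsr; split.
- by split; exact: sr0.
- by split; exact: sr1.
- by move=> x y [Ax Bx] [Ay By]; split; exact: srB.
- by move=> x y [Ax Bx] [Ay By]; split; exact: srM.
Qed.

Section IdealClosure.
Variables (R I : pset L) (Rsr : is_subring R) (Iid : ideal_of R I).

Lemma idS x : I x -> R x. Proof. by case: Iid => + _ _ _; apply. Qed.
Lemma id0 : I 0. Proof. by case: Iid. Qed.
Lemma idD x y : I x -> I y -> I (x + y). Proof. by case: Iid => _ _ + _; apply. Qed.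
Lemma idMl r x : R r -> I x -> I (r * x). Proof. by case: Iid => _ _ _; apply. Qed.
Lemma idMr r x : I x -> R r -> I (x * r). Proof. by move=> Ix Rr; rewrite mulrC; apply: idMl. Qed.
Lemma idN x : I x -> I (- x).
Proof. by move=> Ix; rewrite -mulN1r; apply: idMl => //; apply: srN => //; apply: sr1. Qed.
Lemma idB x y : I x -> I y -> I (x - y).
Proof. by move=> Ix Iy; apply: idD => //; apply: idN. Qed.
Lemma id_sum (T : Type) (r : seq T) (F : T -> L) (p : pred T) :
  (forall i, p i -> I (F i)) -> I (\sum_(i <- r | p i) F i).
Proof. by move=> AF; elim/big_ind: _ => //; [exact: id0|exact: idD]. Qed.
End IdealClosure.

Section PrimeClosure.
Variables (R P : pset L) (Rsr : is_subring R) (Ppr : prime_of R P).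
Lemma pr_id : ideal_of R P. Proof. by case: Ppr. Qed.
Lemma prM x y : R x -> R y -> P (x * y) -> P x \/ P y.
Proof. by case: Ppr => _ _; apply. Qed.
Lemma pr1 : ~ P 1.
Proof.
move=> P1; case: Ppr => [Pid nP _]; apply: nP => x Rx.
by rewrite -[x]mulr1; apply: (idMl Pid).
Qed.
Lemma prX n x : R x -> P (x ^+ n) -> P x.
Proof.
move=> Rx; elim: n => [|n IH]; first by rewrite expr0 => /pr1.
by rewrite exprS => /prM [] //; apply: srX.
Qed.
Lemma prMn x y : R x -> R y -> ~ P x -> ~ P y -> ~ P (x * y).
Proof. by move=> Rx Ry nx ny /prM []. Qed.
Lemma prXn n x : R x -> ~ P x -> ~ P (x ^+ n).
Proof. by move=> Rx nx /(prX Rx). Qed.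
End PrimeClosure.

Lemma primeI R P : is_subring R -> ideal_of R P -> ~ P 1 ->
  (forall x y, R x -> R y -> P (x * y) -> P x \/ P y) -> prime_of R P.
Proof. by move=> Rsr Pid P1 Pm; split=> // /(_ 1 (sr1 Rsr)). Qed.

Lemma prime_zero R : is_subring R -> prime_of R (fun x => x = 0).
Proof.
move=> Rsr; apply: primeI => //.
- split=> //.
  + by move=> x ->; exact: sr0.
  + by move=> x y -> ->; rewrite addr0.
  + by move=> r x _ ->; rewrite mulr0.
- by move/eqP; rewrite oner_eq0.
- by move=> x y _ _ /eqP; rewrite mulf_eq0 => /orP [/eqP ->|/eqP ->]; [left|right].
Qed.

Lemma prime_avoiding R I S : is_subring R -> ideal_of R I -> S 1 ->
  (forall x y, S x -> S y -> S (x * y)) -> subs S R ->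
  (forall x, S x -> ~ I x) ->
  exists Q, [/\ prime_of R Q, subs I Q & forall x, S x -> ~ Q x].
Proof.
move=> Rsr Iid S1 SM SR SI.
pose G (Q : pset L) := [/\ ideal_of R Q, subs I Q & forall x, S x -> ~ Q x].
have [| |Q [[Qid IQ SQ] Qmax]] := @zorn_union L G.
- by exists I; split.
- move=> F [A0 FA0] FG Ftot; split.
  + split.
    * by move=> x [A /FG [Aid _ _] Ax]; apply: (idS Aid).
    * by exists A0 => //; have [Aid _ _] := FG _ FA0; apply: (id0 Aid).
    * move=> x y [A FA Ax] [B FB By].
      have [AB|BA] := Ftot _ _ FA FB.
        by exists B => //; have [Bid _ _] := FG _ FB; apply: (idD Bid) => //; apply: AB.
      by exists A => //; have [Aid _ _] := FG _ FA; apply: (idD Aid) => //; apply: BA.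
    * move=> r x Rr [A FA Ax]; exists A => //.
      by have [Aid _ _] := FG _ FA; apply: (idMl Aid).
  + by move=> x Ix; exists A0 => //; have [_ + _] := FG _ FA0; apply.
  + by move=> x Sx [A /FG [_ _ SA] Ax]; apply: (SA x).
exists Q; split=> //.
apply: primeI => //; first exact: SQ.
move=> x y Rx Ry Qxy; apply: contrapT => /not_orP [nQx nQy].
have ext z : R z -> ~ Q z -> exists s q r, [/\ S s, Q q, R r & s = q + z * r].
  move=> Rz nQz; apply: contrapT => noS.
  apply: nQz; pose B u := exists q r, [/\ Q q, R r & u = q + z * r].
  have QB : subs Q B by move=> u Qu; exists u, 0; rewrite mulr0 addr0; split=> //; exact: sr0.
  apply: (Qmax B) => //; last first.
    by exists 0, 1; rewrite mulr1 add0r; split=> //; [exact: id0 Qid|exact: sr1].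
  split.
  - split.
    + move=> _ [q [r [Qq Rr ->]]]; apply: srD => //; first exact: (idS Qid).
      exact: srM.
    + exact: QB (id0 Qid).
    + move=> _ _ [q [r [Qq Rr ->]]] [q' [r' [Qq' Rr' ->]]].
      exists (q + q'), (r + r'); split; [exact: (idD Qid)|exact: srD|by ring].
    + move=> t _ Rt [q [r [Qq Rr ->]]].
      exists (t * q), (t * r); split; [exact: (idMl Qid)|exact: srM|by ring].
  - by move=> u /IQ /QB.
  - by move=> u Su [q [r [Qq Rr Eu]]]; apply: noS; exists u, q, r.
have [s [q [r [Ss Qq Rr Es]]]] := ext x Rx nQx.
have [s' [q' [r' [Ss' Qq' Rr' Es']]]] := ext y Ry nQy.
apply: (SQ (s * s')); first exact: SM.
have -> : s * s' = q * s' + (x * r) * q' + (r * r') * (x * y).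
  by rewrite Es Es'; ring.
apply: (idD Qid); first apply: (idD Qid).
- by apply: (idMr Qid) => //; apply: SR.
- by apply: (idMl Qid) => //; apply: srM.
- by apply: (idMl Qid) => //; apply: srM.
Qed.

Lemma exists_prime_above R I : is_subring R -> ideal_of R I -> ~ I 1 ->
  exists M, prime_of R M /\ subs I M.
Proof.
move=> Rsr Iid I1.
have [||||M [Mpr IM _]] := @prime_avoiding R I (fun y => y = 1) Rsr Iid.
- by [].
- by move=> _ _ -> ->; rewrite mulr1.
- by move=> _ ->; exact: sr1.
- by move=> _ ->.
by exists M.
Qed.

Definition pol A (p : {poly L}) := forall i, A p`_i.

Lemma pol_mono A B p : subs A B -> pol A p -> pol B p.
Proof. by move=> AB Ap i; apply: AB. Qed.

Section PolClosure.
Variables (A : pset L) (Asr : is_subring A).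
Lemma polC c : A c -> pol A c%:P.
Proof. by move=> Ac i; rewrite coefC; case: ifP => // _; exact: sr0. Qed.
Lemma pol0 : pol A 0. Proof. by move=> i; rewrite coef0; exact: sr0. Qed.
Lemma pol1 : pol A 1. Proof. by apply: polC; exact: sr1. Qed.
Lemma polXn n : pol A 'X^n.
Proof. by move=> i; rewrite coefXn; case: eqP => _; [exact: sr1|exact: sr0]. Qed.
Lemma polX : pol A 'X. Proof. exact: (polXn 1). Qed.
Lemma polD p q : pol A p -> pol A q -> pol A (p + q).
Proof. by move=> Ap Aq i; rewrite coefD; apply: srD. Qed.
Lemma polN p : pol A p -> pol A (- p).
Proof. by move=> Ap i; rewrite coefN; apply: srN. Qed.
Lemma polB p q : pol A p -> pol A q -> pol A (p - q).
Proof. by move=> Ap Aq; apply: polD => //; apply: polN. Qed.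
Lemma polM p q : pol A p -> pol A q -> pol A (p * q).
Proof. by move=> Ap Aq i; rewrite coefM; apply: sr_sum => // j _; apply: srM. Qed.
Lemma polZ c p : A c -> pol A p -> pol A (c *: p).
Proof. by move=> Ac Ap i; rewrite coefZ; apply: srM. Qed.
Lemma pol_exp p n : pol A p -> pol A (p ^+ n).
Proof. by move=> Ap; elim: n => [|n IH]; rewrite ?expr0 ?exprS; [exact: pol1|exact: polM]. Qed.
Lemma pol_sum (T : Type) (r : seq T) (F : T -> {poly L}) (p : pred T) :
  (forall i, p i -> pol A (F i)) -> pol A (\sum_(i <- r | p i) F i).
Proof. by move=> AF; elim/big_ind: _ => //; [exact: pol0|exact: polD]. Qed.
Lemma pol_horner p x : pol A p -> A x -> A p.[x].
Proof.
by move=> Ap Ax; rewrite horner_coef; apply: sr_sum => // i _; apply: srM => //; apply: srX.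
Qed.
End PolClosure.

Section PolIdeal.
Variables (R I : pset L) (Rsr : is_subring R) (Iid : ideal_of R I).
Lemma ipol0 : pol I 0. Proof. by move=> i; rewrite coef0; exact: id0 Iid. Qed.
Lemma ipolC c : I c -> pol I c%:P.
Proof. by move=> Ac i; rewrite coefC; case: ifP => // _; exact: id0 Iid. Qed.
Lemma ipolD p q : pol I p -> pol I q -> pol I (p + q).
Proof. by move=> Ap Aq i; rewrite coefD; apply: (idD Iid). Qed.
Lemma ipolM p q : pol R p -> pol I q -> pol I (p * q).
Proof. by move=> Ap Aq i; rewrite coefM; apply: (id_sum Iid) => j _; apply: (idMl Iid). Qed.
Lemma ipolZ c p : R c -> pol I p -> pol I (c *: p).
Proof. by move=> Ac Ap i; rewrite coefZ; apply: (idMl Iid). Qed.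
Lemma ipolZl c p : I c -> pol R p -> pol I (c *: p).
Proof. by move=> Ac Ap i; rewrite coefZ; apply: (idMr Iid). Qed.
Lemma ipol_sum (T : Type) (r : seq T) (F : T -> {poly L}) (p : pred T) :
  (forall i, p i -> pol I (F i)) -> pol I (\sum_(i <- r | p i) F i).
Proof. by move=> AF; elim/big_ind: _ => //; [exact: ipol0|exact: ipolD]. Qed.
Lemma ipol_horner p x : pol I p -> R x -> I p.[x].
Proof.
by move=> Ap Ax; rewrite horner_coef; apply: (id_sum Iid) => i _; apply: (idMr Iid) => //; apply: srX.
Qed.
End PolIdeal.

Definition adj A x : pset L := fun y => exists2 p, pol A p & y = p.[x].

Lemma adj_sub A x : is_subring A -> subs A (adj A x).
Proof. by move=> Asr a Aa; exists a%:P; rewrite ?hornerC //; apply: polC. Qed.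
Lemma adj_gen A x : is_subring A -> adj A x x.
Proof. by move=> Asr; exists 'X; rewrite ?hornerX //; apply: polX. Qed.
Lemma adj_sr A x : is_subring A -> is_subring (adj A x).
Proof.
move=> Asr; split.
- by apply: adj_sub => //; apply: sr0.
- by apply: adj_sub => //; apply: sr1.
- by move=> _ _ [p Ap ->] [q Aq ->]; exists (p - q); rewrite ?hornerE //; apply: polB.
- by move=> _ _ [p Ap ->] [q Aq ->]; exists (p * q); rewrite ?hornerE //; apply: polM.
Qed.
Lemma adj_min A B x : is_subring B -> subs A B -> B x -> subs (adj A x) B.
Proof. by move=> Bsr AB Bx _ [p Ap ->]; apply: pol_horner => //; apply: pol_mono Ap. Qed.

Definition valr V := is_subring V /\ forall x, x != 0 -> V x \/ V x^-1.
(* [0] is set apart because [0^-1 = 0]. *)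
Definition vmax V x := x = 0 \/ ~ V x^-1.

Lemma poly_lead_split (p : {poly L}) k : size p = k.+1 ->
  p = \poly_(i < k) p`_i + lead_coef p *: 'X^k.
Proof.
move=> Ek; apply/polyP=> i; rewrite coefD coefZ coefXn coef_poly lead_coefE Ek /=.
case: ltngtP => [ik|ki|->]; rewrite ?mulr0 ?addr0 ?mulr1 ?add0r //.
by rewrite nth_default // Ek.
Qed.

Section Survive.
Variables (V M : pset L) (Vsr : is_subring V) (Mid : ideal_of V M) (M1 : ~ M 1).

Lemma ideal_survives_aux n x (p q : {poly L}) : (size p + size q < n)%N ->
  x != 0 -> pol M p -> pol M q -> p.[x] = 1 -> q.[x^-1] = 1 -> False.
Proof.
elim: n x p q => // n IH x p q Hn x0.
wlog le_qp : x p q x0 Hn / (size q <= size p)%N => [H|].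
  case/orP: (leq_total (size q) (size p)) => le Mp Mq px qx.
    exact: (H x p q).
  apply: (H x^-1 q p) => //; rewrite ?invr_eq0 // ?invrK //.
  by rewrite addnC.
move=> Mp Mq px qx.
have [sq|sq] := leqP (size q) 1.
  move: qx; rewrite (size1_polyC sq) hornerC => q1; apply: M1.
  by rewrite -q1; exact: Mq.
pose m := (size q).-1; pose k := (size p).-1.
have Em : size q = m.+1 by rewrite /m prednK // ltnW.
have sp : (1 < size p)%N by apply: leq_trans le_qp.
have Ek : size p = k.+1 by rewrite /k prednK // ltnW.
have mk : (m <= k)%N by rewrite -ltnS -Em -Ek.
pose b0 := q`_0; pose a := p`_k.
pose r := \sum_(i < m) q`_i.+1 *: 'X^(k - i.+1).
pose p1 := \poly_(i < k) p`_i.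
pose p' := b0%:P + (1 - b0) *: p1 + a *: r.
have Vb0 : V b0 by apply: (idS Mid); exact: Mq.
have Vb1 : V (1 - b0) by apply: srB => //; exact: sr1.
have Ep : p = p1 + a *: 'X^k by rewrite {1}(poly_lead_split Ek) lead_coefE.
have Er : (1 - b0) * x ^+ k = r.[x].
  rewrite /r horner_sum.
  have := congr1 (fun u => u * x ^+ k) qx.
  rewrite /= mul1r horner_coef Em big_ord_recl /= expr0 mulr1 mulrDl -/b0 => E.
  rewrite mulrBl mul1r -{1}E addrC addKr mulr_suml.
  apply: eq_bigr => i _; rewrite !hornerE -mulrA; congr (_ * _).
  have ik : (i.+1 <= k)%N by apply: leq_trans mk.
  rewrite /bump leq0n add1n -{1}(subnK ik) exprD mulrCA exprVn mulVf ?mulr1 //.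
  by rewrite expf_neq0.
have Mr : pol M r.
  apply: (ipol_sum Mid) => i _; apply: (ipolZl Mid) => //; exact: polXn.
have Mp' : pol M p'.
  apply: (ipolD Mid); first apply: (ipolD Mid).
  - by apply: (ipolC Mid); exact: Mq.
  - apply: (ipolZ Mid) => // i; rewrite coef_poly; case: ifP => // _; exact: id0 Mid.
  - by apply: (ipolZ Mid) => //; apply: (idS Mid); apply: Mp.
apply: (IH x p' q) => //.
- have sp' : (size p' <= k)%N.
    have k0 : (0 < k)%N by rewrite -ltnS -Ek.
    apply: leq_trans (size_polyD _ _) _; rewrite geq_max; apply/andP; split.
      apply: leq_trans (size_polyD _ _) _; rewrite geq_max; apply/andP; split.
        by apply: leq_trans (size_polyC_leq1 _) _.
      by apply: leq_trans (size_scale_leq _ _) _; exact: size_poly.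
    apply: leq_trans (size_scale_leq _ _) _.
    apply: leq_trans (size_sum _ _ _) _; apply/bigmax_leqP => i _.
    apply: leq_trans (size_scale_leq _ _) _; rewrite size_polyXn.
    have ik : (i.+1 <= k)%N by apply: leq_trans mk.
    by lia.
  by move: Hn; rewrite Ek; lia.
- rewrite /p' !hornerE -Er.
  have E := congr1 (horner^~ x) Ep; rewrite /= px !hornerE in E.
  have -> : p1.[x] = 1 - a * x ^+ k by rewrite E addrK.
  by ring.
Qed.

Lemma ideal_survives x : x != 0 -> ~ adj M x 1 \/ ~ adj M x^-1 1.
Proof.
move=> x0; apply: contrapT => /not_orP [/contrapT [p Mp Ep] /contrapT [q Mq Eq]].
by apply: (@ideal_survives_aux _ x p q (ltnSn _)).
Qed.
End Survive.

Lemma chevalley R I : is_subring R -> ideal_of R I -> ~ I 1 ->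
  exists V, [/\ valr V, subs R V & subs I (vmax V)].
Proof.
move=> Rsr Iid I1.
pose G (Z : bool * L -> Prop) := [/\ is_subring (fun x => Z (true, x)),
  ideal_of (fun x => Z (true, x)) (fun x => Z (false, x)), ~ Z (false, 1),
  forall x, R x -> Z (true, x) & forall x, I x -> Z (false, x)].
have [| |Z [GZ Zmax]] := @zorn_union _ G.
- by exists (fun bx => if bx.1 then R bx.2 else I bx.2); split.
- move=> F [A0 FA0] FG Ftot.
  have two (A B : bool * L -> Prop) (x y : bool * L) :
    F A -> F B -> A x -> B y -> exists W : bool * L -> Prop, [/\ F W, W x & W y].
    move=> FA FB Ax By; have [AB|BA] := Ftot _ _ FA FB.
      by exists B; split=> //; apply: AB.
    by exists A; split=> //; apply: BA.
  have [Asr Aid A1 RA IA] := FG _ FA0.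
  split.
  + split.
    * by exists A0 => //; exact: (sr0 Asr).
    * by exists A0 => //; exact: (sr1 Asr).
    * move=> x y [A FA Ax] [B FB By]; have [C [FC Cx Cy]] := two _ _ _ _ FA FB Ax By.
      by exists C => //; have [Csr _ _ _ _] := FG _ FC; apply: (srB Csr).
    * move=> x y [A FA Ax] [B FB By]; have [C [FC Cx Cy]] := two _ _ _ _ FA FB Ax By.
      by exists C => //; have [Csr _ _ _ _] := FG _ FC; apply: (srM Csr).
  + split.
    * by move=> x [A FA Ax]; exists A => //; have [_ Bid _ _ _] := FG _ FA; apply: (idS Bid).
    * by exists A0 => //; exact: (id0 Aid).
    * move=> x y [A FA Ax] [B FB By]; have [C [FC Cx Cy]] := two _ _ _ _ FA FB Ax By.
      by exists C => //; have [_ Cid _ _ _] := FG _ FC; apply: (idD Cid).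
    * move=> x y [A FA Ax] [B FB By]; have [C [FC Cx Cy]] := two _ _ _ _ FA FB Ax By.
      by exists C => //; have [_ Cid _ _ _] := FG _ FC; apply: (idMl Cid).
  + by move=> [A FA]; have [_ _ + _ _] := FG _ FA; apply.
  + by move=> x Rx; exists A0 => //; apply: RA.
  + by move=> x Ix; exists A0 => //; apply: IA.
case: GZ => Vsr Mid M1 RV IM.
set V := fun x => Z (true, x) in Vsr Mid.
set M := fun x => Z (false, x) in Mid.
have ext x : ~ adj M x 1 -> V x.
  move=> nx.
  pose B (bx : bool * L) := if bx.1 then adj V x bx.2 else adj M x bx.2.
  apply: (Zmax B _ _ (true, x)); last exact: (adj_gen x Vsr).
    split=> //.
    - exact: (adj_sr x Vsr).
    - rewrite /B /=; split.
      + by move=> _ [p Mp ->]; exists p => // i; apply: (idS Mid).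
      + by exists 0; [exact: (ipol0 Mid)|rewrite horner0].
      + by move=> _ _ [p Mp ->] [q Mq ->]; exists (p + q); [exact: (ipolD Mid)|rewrite hornerD].
      + by move=> _ _ [p Mp ->] [q Mq ->]; exists (p * q); [exact: (ipolM Mid)|rewrite hornerM].
    - by move=> y Ry; apply: adj_sub => //; apply: RV.
    - by move=> y Iy; exists y%:P; [apply: (ipolC Mid); apply: IM|rewrite hornerC].
  move=> [[] y] Zy; rewrite /B /=; first by apply: adj_sub.
  by exists y%:P; [apply: (ipolC Mid)|rewrite hornerC].
exists V; split=> //.
- split=> // x x0; have [/ext|/ext] := ideal_survives Vsr Mid M1 x0; first by left.
  by right.
- move=> x Ix; case: (eqVneq x 0) => [->|x0]; [by left|right=> Vx].
  by apply: M1; rewrite -(mulVf x0); apply: (idMl Mid) => //; apply: IM.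
Qed.

End Subrings.

Section ValuationRings.
Variable L : fieldType.
Implicit Types (A B C D R V M P Q I E : pset L) (x y z : L).

Section OneValuation.
Variables (V : pset L) (Vv : valr V).
Let Vsr : is_subring V := proj1 Vv.

Lemma valr_total x : x != 0 -> V x \/ V x^-1. Proof. by case: Vv => _; apply. Qed.
Lemma vmax0 : vmax V 0. Proof. by left. Qed.
Lemma vmaxS x : vmax V x -> V x.
Proof.
case=> [->|nVx]; first exact: sr0.
have [->|x0] := eqVneq x 0; first exact: sr0.
by case: (valr_total x0).
Qed.
Lemma nvmax x : V x -> ~ vmax V x -> x != 0 /\ V x^-1.
Proof.
move=> Vx /not_orP [x0 /contrapT Vx'].
by split=> //; apply/eqP.
Qed.
Lemma vmax1 : ~ vmax V 1.
Proof. by case=> [/eqP|]; [rewrite oner_eq0|rewrite invr1; apply; apply: sr1]. Qed.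
Lemma vmax_inv x : ~ V x -> vmax V x^-1.
Proof. by move=> Vx; right; rewrite invrK. Qed.
Lemma vmax_unit x : V x^-1 -> x != 0 -> ~ vmax V x.
Proof. by move=> Vx x0 [/eqP|//]; rewrite (negbTE x0). Qed.

Lemma vmax_ideal : ideal_of V (vmax V).
Proof.
have mulm r x : V r -> vmax V x -> vmax V (r * x).
  move=> Vr mxx; have [->|rx0] := eqVneq (r * x) 0; first exact: vmax0.
  right=> Vrx; move: rx0; rewrite mulf_eq0 negb_or => /andP [r0 x0].
  case: mxx => [/eqP|]; first by rewrite (negbTE x0).
  apply; have -> : x^-1 = r * (r * x)^-1 by field; rewrite ?r0 ?x0.
  exact: srM.
split; [exact: vmaxS|exact: vmax0| |exact: mulm].
have addm x y : x != 0 -> y != 0 -> V (x / y) -> vmax V y -> vmax V (x + y).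
  move=> x0 y0 Vxy my; have -> : x + y = (x / y + 1) * y by field.
  by apply: mulm => //; apply: srD => //; apply: sr1.
move=> x y vmax' my.
have [->|x0] := eqVneq x 0; first by rewrite add0r.
have [->|y0] := eqVneq y 0; first by rewrite addr0.
have [|Vxy|Vxy] := @valr_total (x / y); first by rewrite mulf_neq0 ?invr_eq0.
  exact: addm.
by rewrite addrC; apply: addm => //; move: Vxy; rewrite invf_div.
Qed.

Lemma vmax_prime : prime_of V (vmax V).
Proof.
apply: primeI => //; [exact: vmax_ideal|exact: vmax1|].
move=> x y Vx Vy mxy; apply: contrapT => /not_orP [/(nvmax Vx) [x0 Vx'] /(nvmax Vy) [y0 Vy']].
by move: mxy; apply: vmax_unit; rewrite ?mulf_neq0 // invfM; apply: srM.
Qed.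

Lemma valr_min_seq (s : seq L) : (exists2 x, x \in s & x != 0) ->
  exists c, [/\ c \in s, c != 0 & forall x, x \in s -> V (x / c)].
Proof.
elim: s => [[] //|a s IH hyp].
have V1 x : x != 0 -> V (x / x) by move=> x0; rewrite divff //; apply: sr1.
case: (pselect (exists2 x, x \in s & x != 0)) => [/IH [c [cs c0 Hc]]|no].
  have [a0|a0] := eqVneq a 0.
    exists c; split=> // [|x]; first by rewrite inE cs orbT.
    by rewrite inE => /orP [/eqP ->|/Hc //]; rewrite a0 mul0r; apply: sr0.
  have [|Vac|Vca] := @valr_total (a / c); first by rewrite mulf_neq0 ?invr_eq0.
    exists c; split=> // [|x]; first by rewrite inE cs orbT.
    by rewrite inE => /orP [/eqP ->|/Hc //].
  rewrite invf_div in Vca.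
  exists a; split=> // [|x]; first by rewrite inE eqxx.
  rewrite inE => /orP [/eqP ->|/Hc Vxc]; first exact: V1.
  have -> : x / a = (x / c) * (c / a) by field; rewrite ?a0 ?c0.
  exact: srM.
have s0 x : x \in s -> x = 0.
  by move=> xs; apply/eqP; apply: contrapT => /negP x0; apply: no; exists x.
have [a0|a0] := eqVneq a 0.
  case: hyp => x; rewrite inE => /orP [/eqP ->|/s0 ->]; rewrite ?a0 eqxx //.
exists a; split=> // [|x]; first by rewrite inE eqxx.
rewrite inE => /orP [/eqP ->|/s0 ->]; first exact: V1.
by rewrite mul0r; apply: sr0.
Qed.

Lemma valr_min (p : {poly L}) : p != 0 ->
  exists j, p`_j != 0 /\ forall i, V (p`_i / p`_j).
Proof.
move=> p0; have [|c [cp c0 Hc]] := @valr_min_seq p.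
  exists (lead_coef p); last by rewrite lead_coef_eq0.
  by rewrite lead_coefE mem_nth // prednK // size_poly_gt0.
have Ec := nth_index 0 cp; exists (index c p); rewrite Ec; split=> // i.
have [ip|ip] := ltnP i (size p); first by apply: Hc; apply: mem_nth.
by rewrite nth_default // mul0r; apply: sr0.
Qed.

Lemma valr_monic (p : {poly L}) x :
  p \is monic -> (1 < size p)%N -> pol V p -> V p.[x] -> V x.
Proof.
move=> pm sp Vp Vpx; apply: contrapT => nVx.
have mxy := vmax_inv nVx; set y := x^-1 in mxy.
have x0 : x != 0 by apply/eqP => x0; apply: nVx; rewrite x0; apply: sr0.
pose n := (size p).-1.
have En : size p = n.+1 by rewrite /n prednK // ltnW.
have n0 : (0 < n)%N by rewrite -ltnS -En.
apply: vmax1.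
have -> : 1 = p.[x] * y ^+ n - \sum_(i < n) p`_i * y ^+ (n - i).
  have lc : p`_n = 1 by move: pm; rewrite monicE lead_coefE => /eqP.
  rewrite horner_coef En big_ord_recr /= lc mul1r mulrDl -exprMn divff // expr1n.
  rewrite addrAC mulr_suml -sumrB big1 ?add0r // => i _.
  rewrite -mulrA -mulrBr.
  have -> : y ^+ n = y ^+ i * y ^+ (n - i) by rewrite -exprD subnKC // ltnW.
  by rewrite mulrA -exprMn divff // expr1n mul1r subrr mulr0.
have mn k : (0 < k)%N -> vmax V (y ^+ k).
  case: k => // k _; rewrite exprSr; apply: (idMl vmax_ideal) => //.
  by apply: srX => //; apply: vmaxS.
apply: (idB Vsr vmax_ideal); first by apply: (idMl vmax_ideal) => //; apply: mn.
apply: (id_sum vmax_ideal) => i _; apply: (idMl vmax_ideal); first exact: Vp.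
by apply: mn; rewrite subn_gt0.
Qed.
End OneValuation.

(* Integrality through valuation rings, which makes transitivity immediate. *)
Definition intg R z := forall V, valr V -> subs R V -> V z.

Lemma intg_sub R : subs R (intg R). Proof. by move=> x Rx V _; apply. Qed.
Lemma intg_sr R : is_subring (intg R).
Proof.
split.
- by move=> V [Vsr _] _; apply: sr0.
- by move=> V [Vsr _] _; apply: sr1.
- by move=> x y ix iy V Vv RV; case: (Vv) => Vsr _; apply: srB => //; [apply: ix|apply: iy].
- by move=> x y ix iy V Vv RV; case: (Vv) => Vsr _; apply: srM => //; [apply: ix|apply: iy].
Qed.
Lemma intg_trans R A z : subs A (intg R) -> intg A z -> intg R z.
Proof. by move=> AR iz V Vv RV; apply: iz => // a /AR; apply. Qed.
Lemma intg_mono R A : subs R A -> subs (intg R) (intg A).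
Proof. by move=> RA z iz V Vv AV; apply: iz => // x /RA /AV. Qed.

Lemma poly_intg R z (p : {poly L}) : p \is monic -> pol R p -> p.[z] = 0 -> intg R z.
Proof.
move=> pm Rp pz V Vv RV; apply: (valr_monic Vv pm) => //.
- by apply: (@root_size_gt1 _ z); [apply: monic_neq0|apply/eqP].
- exact: pol_mono Rp.
- by rewrite pz; apply: sr0; case: Vv.
Qed.

Lemma intg_poly R z : is_subring R -> intg R z ->
  exists p, [/\ p \is monic, pol R p & p.[z] = 0].
Proof.
move=> Rsr iz.
have [->|z0] := eqVneq z 0.
  by exists 'X; rewrite monicX hornerX; split=> //; apply: polX.
have Asr := adj_sr z^-1 Rsr.
have [p Rp Ez] : adj R z^-1 z.
  apply: contrapT => nz.
  pose I y := exists2 r, adj R z^-1 r & y = z^-1 * r.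
  have [|I1|V [Vv AV IV]] := @chevalley _ (adj R z^-1) I Asr.
  - split.
    + by move=> _ [r Ar ->]; apply: srM => //; apply: adj_gen.
    + by exists 0; rewrite ?mulr0 //; apply: sr0.
    + by move=> _ _ [r Ar ->] [s As ->]; exists (r + s); rewrite ?mulrDr //; apply: srD.
    + by move=> t _ At [r Ar ->]; exists (t * r); [apply: srM|rewrite mulrCA].
  - case: I1 => r Ar E; apply: nz.
    suff Er : r = z by rewrite Er in Ar.
    by apply: (mulfI (x := z^-1)); rewrite ?invr_eq0 // -E mulVf.
  - have : vmax V z^-1.
      by apply: IV; exists 1; [exact: (sr1 Asr)|rewrite mulr1].
    case=> [/eqP|]; first by rewrite invr_eq0 (negbTE z0).
    by rewrite invrK; apply; apply: iz => // x Rx; apply: AV; apply: adj_sub.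
pose n := size p.
exists ('X^(n.+1) - \sum_(i < n) p`_i *: 'X^(n - i)); split.
- rewrite monicE lead_coefDl ?lead_coefXn // size_polyN size_polyXn ltnS.
  apply: leq_trans (size_sum _ _ _) _; apply/bigmax_leqP => i _.
  apply: leq_trans (size_scale_leq _ _) _; rewrite size_polyXn ltnS.
  exact: leq_subr.
- apply: polB => //; first exact: polXn.
  by apply: pol_sum => // i _; apply: polZ => //; apply: polXn.
- rewrite !hornerE horner_sum exprSr {2}Ez horner_coef mulr_sumr -/n -sumrB.
  apply: big1 => i _; rewrite hornerZ hornerXn mulrCA -mulrBr.
  have -> : z ^+ n = z ^+ (n - i) * z ^+ i by rewrite -exprD subnK // ltnW.
  rewrite -mulrA -exprMn divff // expr1n.
  by rewrite mulr1 subrr mulr0.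
Qed.

Definition fracs A x := exists a b, [/\ A a, A b, b != 0 & x = a / b].

Lemma fracs_sub A : is_subring A -> subs A (fracs A).
Proof. by move=> Asr a Aa; exists a, 1; rewrite divr1 oner_neq0; split=> //; apply: sr1. Qed.
Lemma fracs_sr A : is_subring A -> is_subring (fracs A).
Proof.
move=> Asr; split.
- exact: fracs_sub (sr0 Asr).
- exact: fracs_sub (sr1 Asr).
- move=> _ _ [a [b [Aa Ab b0 ->]]] [c [d [Ac Ad d0 ->]]].
  exists (a * d - c * b), (b * d); rewrite mulf_neq0 //; split=> //.
  + by apply: srB => //; apply: srM.
  + exact: srM.
  + by field; rewrite ?b0 ?d0.
- move=> _ _ [a [b [Aa Ab b0 ->]]] [c [d [Ac Ad d0 ->]]].
  exists (a * c), (b * d); rewrite mulf_neq0 //; split=> //.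
  + exact: srM.
  + exact: srM.
  + by field; rewrite ?b0 ?d0.
Qed.
Lemma fracs_inv A x : is_subring A -> fracs A x -> fracs A x^-1.
Proof.
move=> Asr [a [b [Aa Ab b0 ->]]]; have [->|a0] := eqVneq a 0.
  by rewrite mul0r invr0; apply: fracs_sub => //; apply: sr0.
by exists b, a; rewrite invf_div.
Qed.
Lemma fracs_div A x y : is_subring A -> fracs A x -> fracs A y -> fracs A (x / y).
Proof. by move=> Asr Fx Fy; apply: (srM (fracs_sr Asr)) => //; apply: fracs_inv. Qed.
Lemma fracs_mono A B : subs A B -> subs (fracs A) (fracs B).
Proof. by move=> AB x [a [b [/AB Ba /AB Bb b0 ->]]]; exists a, b. Qed.
Lemma clear_denoms A (p : {poly L}) : is_subring A -> pol (fracs A) p ->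
  exists d, [/\ A d, d != 0 & pol A (d *: p)].
Proof.
move=> Asr Fp.
have [d [Ad d0 Hd]] : exists d, [/\ A d, d != 0 & forall i, (i < size p)%N -> A (d * p`_i)].
  elim: (size p) => [|n [d [Ad d0 Hd]]]; first by exists 1; split=> //; [apply: sr1|apply: oner_neq0].
  have [a [b [Aa Ab b0 E]]] := Fp n.
  exists (d * b); rewrite mulf_neq0 //; split=> //; first exact: srM.
  move=> i; rewrite ltnS leq_eqVlt => /orP [/eqP ->|/Hd Adi].
    by rewrite E -mulrA [b * _]mulrC divfK //; apply: srM.
  by rewrite mulrAC; apply: srM.
exists d; split=> // i; rewrite coefZ; have [/Hd //|si] := ltnP i (size p).
by rewrite nth_default // mulr0; apply: sr0.
Qed.

Definition alg A z := exists p : {poly L}, [/\ pol A p, p != 0 & p.[z] = 0].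

Lemma algP A z : is_subring A -> alg A z <-> intg (fracs A) z.
Proof.
move=> Asr; split=> [[p [Ap p0 pz]]|iz].
  have lc0 : lead_coef p != 0 by rewrite lead_coef_eq0.
  apply: (@poly_intg _ _ ((lead_coef p)^-1 *: p)).
  - by rewrite monicE lead_coefZ mulVf.
  - move=> i; rewrite coefZ mulrC; exists p`_i, (lead_coef p); split=> //; exact: Ap.
  - by rewrite hornerZ pz mulr0.
have [p [pm Fp pz]] := intg_poly (fracs_sr Asr) iz.
have [d [Ad d0 Adp]] := clear_denoms Asr Fp.
exists (d *: p); split=> //; last by rewrite hornerZ pz mulr0.
by rewrite scaler_eq0 negb_or d0 monic_neq0.
Qed.

Lemma alg_sub A : is_subring A -> subs A (alg A).
Proof. by move=> Asr a Aa; apply/algP => //; apply: intg_sub; apply: fracs_sub. Qed.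
Lemma intg_alg A z : is_subring A -> intg A z -> alg A z.
Proof. by move=> Asr iz; apply/algP => //; apply: intg_mono iz; apply: fracs_sub. Qed.
Lemma alg_sr A : is_subring A -> is_subring (alg A).
Proof.
move=> Asr; have H := intg_sr (fracs A).
split.
- by apply/algP => //; apply: (sr0 H).
- by apply/algP => //; apply: (sr1 H).
- by move=> x y /(algP _ Asr) ix /(algP _ Asr) iy; apply/algP => //; apply: (srB H).
- by move=> x y /(algP _ Asr) ix /(algP _ Asr) iy; apply/algP => //; apply: (srM H).
Qed.
Lemma strip_X A (p : {poly L}) : pol A p -> p != 0 ->
  exists k q, [/\ pol A q, q`_0 != 0 & p = q * 'X^k].
Proof.
move=> Ap p0; have [k [q]] := multiplicity_XsubC p 0.
rewrite p0 /= subr0 => q0 E; exists k, q; split=> //.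
- by move=> i; have := Ap (i + k)%N; rewrite E coefMXn ltnNge leq_addl /= addnK.
- by move: q0; rewrite rootE horner_coef0.
Qed.

Lemma horner_split (p : {poly L}) : exists q : {poly L},
  (forall A, pol A p -> (A 0) -> pol A q) /\ forall x, p.[x] = p`_0 + x * q.[x].
Proof.
exists (\poly_(i < size p) p`_i.+1); split.
  by move=> A Ap A0 i; rewrite coef_poly; case: ifP.
move=> x; rewrite horner_poly mulr_sumr horner_coef.
case E: (size p) => [|n].
  by rewrite !big_ord0 nth_default ?E // addr0.
rewrite big_ord_recl /= expr0 mulr1; congr (_ + _).
rewrite [in RHS]big_ord_recr /= [p`_n.+1]nth_default ?E // mul0r mulr0 addr0.
by apply: eq_bigr => i _; rewrite /bump add1n exprS; ring.
Qed.

Lemma alg_inv A z : is_subring A -> alg A z -> alg A z^-1.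
Proof.
move=> Asr az; apply/algP => // V Vv FV; have [Vsr _] := Vv.
apply: contrapT => nV.
have mz : vmax V z by right.
have [p [Ap p0 pz]] := az.
have [k [q [Aq q0 E]]] := strip_X Ap p0.
have [z0|z0] := eqVneq z 0; first by apply: nV; rewrite z0 invr0; apply: sr0.
have qz : q.[z] = 0.
  move: pz; rewrite E !hornerE => /eqP; rewrite mulf_eq0 => /orP [/eqP //|].
  by rewrite expf_eq0 (negbTE z0) andbF.
have [r [Hr Er]] := horner_split q.
have Vr : pol V r.
  apply: (pol_mono (A := A)); last by apply: Hr => //; apply: sr0.
  by move=> x Ax; apply: FV; apply: fracs_sub.
have Eq0 : q`_0 = - (z * r.[z]) by apply/eqP; rewrite -addr_eq0 -Er qz.
have : vmax V q`_0.
  rewrite Eq0; apply: (idN Vsr (vmax_ideal Vv)); apply: (idMr (vmax_ideal Vv)) => //.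
  by apply: pol_horner => //; apply: vmaxS.
apply: vmax_unit => //; apply: FV; apply: fracs_inv => //; apply: fracs_sub => //.
Qed.

Lemma alg_div A x y : is_subring A -> alg A x -> alg A y -> alg A (x / y).
Proof. by move=> Asr ax ay; apply: (srM (alg_sr Asr)) => //; apply: alg_inv. Qed.

Lemma alg_fracs A : is_subring A -> subs (fracs (alg A)) (alg A).
Proof. by move=> Asr _ [a [b [Aa Ab _ ->]]]; apply: alg_div. Qed.

Lemma alg_trans A B z : is_subring A -> is_subring B ->
  subs B (alg A) -> alg B z -> alg A z.
Proof.
move=> Asr Bsr BA /(algP _ Bsr) iz; apply/algP => // V Vv FV.
apply: iz => // x Fx.
have /(algP _ Asr) : alg A x by apply: alg_fracs => //; apply: fracs_mono Fx.
by apply.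
Qed.

(* [E] localized at [m_V /\ E], plus [m_V]. *)
Definition pullback V E y := V y /\ exists t e, [/\ E t, E e, ~ vmax V t & vmax V (t * y - e)].
Definition resalg V E z := exists p, [/\ pol E p, exists i, ~ vmax V p`_i & vmax V p.[z]].

Section Residual.
Variables (V E : pset L) (Vv : valr V) (Esr : is_subring E) (EV : subs E V).
Let Vsr : is_subring V := proj1 Vv.
Let mid := vmax_ideal Vv.

Lemma pullback_subV : subs (pullback V E) V. Proof. by move=> x []. Qed.
Lemma pullback_vmax : subs (vmax V) (pullback V E).
Proof.
move=> x mxx; split; first exact: vmaxS.
by exists 1, 0; rewrite mul1r subr0; split=> //; [apply: sr1|apply: sr0|apply: vmax1].
Qed.
Lemma pullback_sub : subs E (pullback V E).
Proof.
move=> x Ex; split; first exact: EV.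
by exists 1, x; rewrite mul1r subrr; split=> //; [apply: sr1|apply: vmax1|apply: vmax0].
Qed.
Lemma pullback_sr : is_subring (pullback V E).
Proof.
split.
- exact: pullback_sub (sr0 Esr).
- exact: pullback_sub (sr1 Esr).
- move=> x y [Vx [t [e [Et Ee tm mte]]]] [Vy [t' [e' [Et' Ee' tm' mte']]]].
  split; first exact: srB.
  exists (t * t'), (t' * e - t * e'); split.
  + exact: srM.
  + by apply: srB => //; apply: srM.
  + by apply: (prMn (vmax_prime Vv)) => //; apply: EV.
  + have -> : t * t' * (x - y) - (t' * e - t * e') = t' * (t * x - e) - t * (t' * y - e') by ring.
    by apply: (idB Vsr mid); apply: (idMl mid) => //; apply: EV.
- move=> x y [Vx [t [e [Et Ee tm mte]]]] [Vy [t' [e' [Et' Ee' tm' mte']]]].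
  split; first exact: srM.
  exists (t * t'), (e * e'); split.
  + exact: srM.
  + exact: srM.
  + by apply: (prMn (vmax_prime Vv)) => //; apply: EV.
  + have -> : t * t' * (x * y) - e * e' = (t' * y) * (t * x - e) + e * (t' * y - e') by ring.
    apply: (idD mid); apply: (idMl mid) => //; last exact: EV.
    by apply: srM => //; apply: EV.
Qed.
Lemma pullback_inv t : E t -> ~ vmax V t -> pullback V E t^-1.
Proof.
move=> Et nt; have [t0 Vt] := nvmax (EV Et) nt.
split=> //; exists t, 1; split=> //; first exact: sr1.
by rewrite divff // subrr; apply: vmax0.
Qed.

Lemma resalg_lead z : V z -> resalg V E z ->
  exists p, [/\ pol E p, ~ vmax V (lead_coef p) & vmax V p.[z]].
Proof.
move=> Vz [p]; have [n] := ubnP (size p); elim: n p => // n IH p Hn [Ep [i ni] mp].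
have p0 : p != 0 by apply/eqP => p0; apply: ni; rewrite p0 coef0; apply: vmax0.
have sp : (0 < size p)%N by rewrite size_poly_gt0.
case: (pselect (vmax V (lead_coef p))) => [ml|nl]; last by exists p.
pose k := (size p).-1; have Ek : size p = k.+1 by rewrite /k prednK.
have Ep' : pol E (\poly_(i < k) p`_i).
  by move=> j; rewrite coef_poly; case: ifP => // _; apply: sr0.
have Epp := poly_lead_split Ek.
apply: (IH (\poly_(i < k) p`_i)).
  by apply: leq_ltn_trans (size_poly _ _) _; move: Hn; rewrite Ek.
split=> //.
  exists i; rewrite coef_poly; case: ifP => // /negbT; rewrite -leqNgt => ki _.
  move: ki; rewrite leq_eqVlt => /orP [/eqP Ei|ki].
    by apply: ni; rewrite -Ei; move: ml; rewrite lead_coefE.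
  by apply: ni; rewrite nth_default ?Ek //; apply: vmax0.
have -> : (\poly_(i < k) p`_i).[z] = p.[z] - lead_coef p * z ^+ k.
  by rewrite {2}Epp !hornerE addrK.
apply: (idB Vsr mid) => //; apply: (idMr mid) => //; exact: srX.
Qed.

Lemma resalgP z : V z -> resalg V E z <-> intg (pullback V E) z.
Proof.
move=> Vz; split=> [/(resalg_lead Vz) [p [Ep nl mp]] V' V'v TV'|iz].
  set c := lead_coef p in nl.
  have Ec : E c by apply: Ep.
  have [c0 Vc] := nvmax (EV Ec) nl.
  apply: (@valr_monic _ V'v (c^-1 *: p)).
  - by rewrite monicE lead_coefZ mulVf.
  - rewrite size_scale ?invr_eq0 // ltnNge; apply/negP => sp.
    by apply: nl; move: mp; rewrite /c (size1_polyC sp) hornerC lead_coefC.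
  - move=> i; rewrite coefZ; apply: TV'; apply: (srM pullback_sr); first exact: pullback_inv.
    exact: pullback_sub.
  - rewrite hornerZ; apply: TV'; apply: pullback_vmax; exact: (idMl mid).
have [p [pm Tp pz]] := intg_poly pullback_sr iz.
have [t [q [Et nt Eq Hq]]] : exists t (q : nat -> L), [/\ E t, ~ vmax V t,
    forall i, E (q i) & forall i, (i < size p)%N -> vmax V (t * p`_i - q i)].
  elim: (size p) => [|n [t [q [Et nt Eq Hq]]]].
    exists 1, (fun=> 0); split=> // [||_]; [exact: sr1|exact: vmax1|exact: sr0].
  have [Vp [t' [e' [Et' Ee' tm' mte']]]] := Tp n.
  exists (t * t'), (fun i => if i == n then t * e' else t' * q i); split.
  - exact: srM.
  - by apply: (prMn (vmax_prime Vv)) => //; apply: EV.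
  - by move=> i; case: ifP => _; apply: srM.
  - move=> i; rewrite ltnS leq_eqVlt => /orP [/eqP ->|lin].
      rewrite eqxx; have -> : t * t' * p`_n - t * e' = t * (t' * p`_n - e') by ring.
      by apply: (idMl mid) => //; apply: EV.
    rewrite ltn_eqF //.
    have -> : t * t' * p`_i - t' * q i = t' * (t * p`_i - q i) by ring.
    by apply: (idMl mid); [apply: EV|apply: Hq].
exists (\poly_(i < size p) q i); split.
- by move=> i; rewrite coef_poly; case: ifP => // _; apply: sr0.
- have sp : (0 < size p)%N by rewrite size_poly_gt0 monic_neq0.
  exists (size p).-1; rewrite coef_poly prednK // leqnn => mq; apply: nt.
  have := Hq (size p).-1; rewrite prednK // leqnn => /(_ isT).
  move: pm; rewrite monicE lead_coefE => /eqP ->; rewrite mulr1 => mtq.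
  by rewrite -[t](subrK (q (size p).-1)); apply: (idD mid).
- have -> : (\poly_(i < size p) q i).[z] = - (t *: p - \poly_(i < size p) q i).[z].
    by rewrite hornerD hornerN hornerZ pz mulr0 add0r opprK.
  apply: (idN Vsr mid); apply: (ipol_horner Vsr mid) => // i.
  rewrite coefB coefZ coef_poly; case: ifP => [/Hq //|/negbT].
  by rewrite -leqNgt => si; rewrite nth_default // mulr0 subr0; apply: vmax0.
Qed.
End Residual.

Lemma resalg_mono V E E' z : subs E E' -> resalg V E z -> resalg V E' z.
Proof. by move=> EE [p [Ep Hi mp]]; exists p; split=> //; apply: pol_mono Ep. Qed.
Lemma resalg_self V E z : valr V -> is_subring E -> E z -> resalg V E z.
Proof.
move=> Vv Esr Ez; exists ('X - z%:P); split.
- by apply: polB => //; [apply: polX|apply: polC].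
- by exists 1%N; rewrite coefB coefX coefC subr0; apply: vmax1.
- by rewrite !hornerE subrr; apply: vmax0.
Qed.

Lemma prime_dominated R Q : is_subring R -> prime_of R Q ->
  exists V, [/\ valr V, subs R V & forall x, R x -> (vmax V x <-> Q x)].
Proof.
move=> Rsr Qpr; have Qid := pr_id Qpr; have Q1 := pr1 Qpr.
pose loc (A : pset L) x := exists a s, [/\ A a, R s, ~ Q s & x = a / s].
have nz s : ~ Q s -> s != 0 by move=> Qs; apply/eqP => s0; apply: Qs; rewrite s0; apply: (id0 Qid).
have [||  |V [Vv lV Vm]] := @chevalley _ (loc R) (loc Q).
- split.
  + by exists 0, 1; rewrite mul0r; split=> //; [apply: sr0|apply: sr1].
  + by exists 1, 1; rewrite divr1; split=> //; apply: sr1.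
  + move=> _ _ [a [s [Ra Rs Qs ->]]] [b [t [Rb Rt Qt ->]]].
    exists (a * t - b * s), (s * t); split; [by apply: srB => //; apply: srM|exact: srM|exact: (prMn Qpr)|].
    by field; rewrite ?nz.
  + move=> _ _ [a [s [Ra Rs Qs ->]]] [b [t [Rb Rt Qt ->]]].
    exists (a * b), (s * t); split; [exact: srM|exact: srM|exact: (prMn Qpr)|].
    by field; rewrite ?nz.
- split.
  + by move=> _ [a [s [Qa Rs Qs ->]]]; exists a, s; split=> //; apply: (idS Qid).
  + by exists 0, 1; rewrite mul0r; split=> //; [apply: (id0 Qid)|apply: sr1].
  + move=> _ _ [a [s [Ra Rs Qs ->]]] [b [t [Rb Rt Qt ->]]].
    exists (a * t + b * s), (s * t); split; [by apply: (idD Qid); apply: (idMr Qid)|exact: srM|exact: (prMn Qpr)|].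
    by field; rewrite ?nz.
  + move=> _ _ [a [s [Ra Rs Qs ->]]] [b [t [Rb Rt Qt ->]]].
    exists (a * b), (s * t); split; [exact: (idMl Qid)|exact: srM|exact: (prMn Qpr)|].
    by field; rewrite ?nz.
- move=> [a [s [Qa Rs Qs E]]].
  have Ea : a = s by rewrite -[a](divfK (nz _ Qs)) -E mul1r.
  by apply: Qs; rewrite -Ea.
exists V; split=> // [x Rx|x Rx].
  by apply: lV; exists x, 1; rewrite divr1; split=> //; apply: sr1.
split=> [mxx|Qx]; last first.
  by apply: Vm; exists x, 1; rewrite divr1; split=> //; apply: sr1.
apply: contrapT => nQ; move: mxx; apply: vmax_unit; last exact: nz.
by apply: lV; exists 1, x; rewrite div1r; split=> //; apply: sr1.
Qed.

End ValuationRings.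

(** * Going down through minimal polynomials *)

Section GoingDown.
Variable L : fieldType.
Implicit Types (A B C D R V M P Q I E F : pset L) (x y z : L).

Lemma div_monic A (p q : {poly L}) : is_subring A -> q \is monic ->
  pol A p -> pol A q ->
  exists e r, [/\ pol A e, pol A r, p = e * q + r & (size r < size q)%N].
Proof.
move=> Asr qm + Aq; have [n] := ubnP (size p).
elim: n p => // n IH p Hn Ap.
have [lt|le] := ltnP (size p) (size q).
  by exists 0, p; rewrite mul0r add0r; split=> //; apply: pol0.
have sq : (0 < size q)%N by rewrite size_poly_gt0 monic_neq0.
have sp : (0 < size p)%N by apply: leq_trans le.
pose k := (size p - size q)%N.
pose m := lead_coef p *: 'X^k.
have Am : pol A m by apply: polZ => //; [apply: Ap|apply: polXn].
have [||e [r [Ae Ar E lt]]] := IH (p - m * q).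
- apply: leq_trans (_ : size p <= n)%N => //.
  rewrite -[X in (_ < X)%N](prednK sp) ltnS; apply/leq_sizeP => j.
  rewrite leq_eqVlt => /orP [/eqP <-|lj].
    rewrite coefB /m -scalerAl coefZ coefXnM ltnNge.
    have -> : (k <= (size p).-1)%N by rewrite /k; lia.
    have -> : ((size p).-1 - k = (size q).-1)%N by rewrite /k; lia.
    rewrite /= -lead_coefE; move: qm; rewrite monicE lead_coefE => /eqP ->.
    by rewrite mulr1 lead_coefE subrr.
  have jp : (size p <= j)%N by rewrite -(prednK sp).
  rewrite coefB /m -scalerAl coefZ coefXnM (nth_default _ jp).
  case: ifP => _; rewrite ?mulr0 ?subrr // nth_default ?mulr0 ?subrr //.
  by move: le jp; rewrite /k; clear; case: (size p) => [|a]; case: (size q) => [|b]; lia.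
- by apply: polB => //; apply: polM.
exists (e + m), r; split=> //; first exact: polD.
by rewrite mulrDl addrAC -E subrK.
Qed.

Lemma pol_prime R P (p q : {poly L}) : is_subring R -> prime_of R P ->
  pol R p -> pol R q -> pol P (p * q) -> pol P p \/ pol P q.
Proof.
move=> Rsr Ppr Rp Rq Ppq; have Pid := pr_id Ppr.
apply: contrapT => /not_orP [np nq].
have mini (f : {poly L}) : ~ pol P f ->
    exists i, ~ P f`_i /\ forall j, (j < i)%N -> P f`_j.
  move=> nf; apply: contrapT => no; apply: nf.
  move=> i; have [n] := ubnP i; elim: n i => // n IH i Hi.
  apply: contrapT => ni; apply: no; exists i; split=> // j ji.
  by apply: IH; apply: leq_trans ji _.
have [i [npi Hi]] := mini p np; have [j [nqj Hj]] := mini q nq.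
have := Ppq (i + j)%N; rewrite coefM.
have lti : (i < (i + j).+1)%N by rewrite ltnS leq_addr.
rewrite (bigD1 (Ordinal lti)) //= addKn.
set S := \sum_(_ | _) _ => PS.
have PS' : P S.
  rewrite /S; apply: (id_sum Pid) => k /eqP nk.
  have [ki|ik|Ek] := ltngtP (k : nat) i.
  - by apply: (idMr Pid) => //; apply: Hi.
  - apply: (idMl Pid) => //; apply: Hj; have := ltn_ord k; lia.
  - by case: nk; apply: val_inj.
apply: (prMn Ppr (Rp i) (Rq j)) => //.
by rewrite -[_ * _](addrK S); apply: (idB Rsr Pid).
Qed.

Lemma monic_factor V (p q : {poly L}) : valr V -> p \is monic -> q \is monic ->
  pol V (p * q) -> pol V p.
Proof.
move=> Vv pm qm Vpq; have [Vsr _] := Vv.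
have norm (f : {poly L}) : f \is monic ->
    exists c : L, [/\ c != 0, V c^-1, pol V (c^-1 *: f) & ~ pol (vmax V) (c^-1 *: f)].
  move=> fm; have [j [c0 Hj]] := valr_min Vv (monic_neq0 fm).
  exists f`_j; split=> //.
  - have := Hj (size f).-1; rewrite -lead_coefE.
    by move: fm; rewrite monicE => /eqP ->; rewrite mul1r.
  - by move=> i; rewrite coefZ mulrC.
  - by move=> /(_ j); rewrite coefZ mulVf //; apply: vmax1.
have [c [c0 Vc Vp np]] := norm p pm; have [d [d0 Vd Vq nq]] := norm q qm.
case: (pselect (V c)) => [Vc'|nVc].
  by rewrite -[p](scalerK (a := c^-1)) ?invr_eq0 // invrK; apply: polZ.
have : pol (vmax V) ((c^-1 *: p) * (d^-1 *: q)).
  rewrite -scalerAl -scalerAr scalerA; apply: (ipolZl (vmax_ideal Vv)) => //.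
  by apply: (idMr (vmax_ideal Vv)) => //; apply: vmax_inv.
by case/(pol_prime Vsr (vmax_prime Vv) Vp Vq).
Qed.

Lemma exists_min_size (H : {poly L} -> Prop) : (exists p, H p) ->
  exists p, H p /\ forall q, H q -> (size p <= size q)%N.
Proof.
move=> [p]; have [n] := ubnP (size p); elim: n p => // n IH p Hn Hp.
case: (pselect (exists2 q, H q & (size q < size p)%N)) => [[q Hq lt]|no].
  by apply: (IH q) => //; apply: leq_trans lt _.
exists p; split=> // q Hq; rewrite leqNgt; apply/negP => lt; apply: no; by exists q.
Qed.

Section MinPoly.
Variables (E : pset L) (Esr : is_subring E) (Einv : forall x, E x -> E x^-1).

Lemma monicize p : pol E p -> p != 0 ->
  exists2 q, [/\ q \is monic, pol E q & size q = size p] & forall z, p.[z] = 0 -> q.[z] = 0.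
Proof.
move=> Ep p0; have lc0 : lead_coef p != 0 by rewrite lead_coef_eq0.
exists ((lead_coef p)^-1 *: p); last by move=> z pz; rewrite hornerZ pz mulr0.
split; first by rewrite monicE lead_coefZ mulVf.
- by apply: polZ => //; apply: Einv; apply: Ep.
- by rewrite size_scale // invr_eq0.
Qed.

Lemma minpoly_intg R s (mu : {poly L}) : is_subring R -> subs R E -> intg R s ->
  mu \is monic -> pol E mu -> mu.[s] = 0 ->
  (forall nu, pol E nu -> nu.[s] = 0 -> (size nu < size mu)%N -> nu = 0) ->
  forall i, intg R mu`_i.
Proof.
move=> Rsr RE si mum Emu mus mumin i V Vv RV; have [Vsr _] := Vv.
have [G [Gm RG Gs]] := intg_poly Rsr si.
have [e [r [Ee Er EG lt]]] := div_monic Esr mum (pol_mono RE RG) Emu.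
have r0 : r = 0.
  by apply: mumin => //; move: Gs; rewrite EG !hornerE mus mulr0 add0r.
rewrite r0 addr0 in EG.
have em : e \is monic by move: Gm; rewrite EG monicMr.
apply: (monic_factor Vv mum em); rewrite mulrC -EG.
exact: pol_mono RG.
Qed.
End MinPoly.

Section Transcendental.
Variables (C : pset L) (x : L) (Csr : is_subring C).
Hypothesis xtr : forall p, pol C p -> p.[x] = 0 -> p = 0.
Let F := fracs C.
Let Fsr : is_subring F := fracs_sr Csr.

Lemma tr_fracs p : pol F p -> p.[x] = 0 -> p = 0.
Proof.
move=> Fp px; have [d [Cd d0 Cdp]] := clear_denoms Csr Fp.
have dx : (d *: p).[x] = 0 by rewrite hornerZ px mulr0.
by move/eqP: (xtr Cdp dx); rewrite scaler_eq0 (negbTE d0) => /eqP.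
Qed.
Lemma tr_inj p q : pol F p -> pol F q -> p.[x] = q.[x] -> p = q.
Proof.
move=> Fp Fq E; apply/eqP; rewrite -subr_eq0; apply/eqP; apply: tr_fracs.
  exact: polB.
by rewrite !hornerE E subrr.
Qed.

Lemma bezout_fracs (d n : {poly L}) : pol F d -> pol F n -> d != 0 ->
  (forall e r, [/\ pol F e, pol F r, e != 0 & (size e < size d)%N] -> e * n != r * d) ->
  exists a b, [/\ pol F a, pol F b & a * d + b * n = 1].
Proof.
move=> Fd Fn d0 Hmin.
pose K (f : {poly L}) := f != 0 /\ exists a b, [/\ pol F a, pol F b & f = a * d + b * n].
have [|rho [[rho0 [a [b [Fa Fb Er]]]] rmin]] := @exists_min_size K.
  exists d; split=> //; exists 1, 0; rewrite mul1r mul0r addr0; split=> //; [exact: pol1|exact: pol0].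
have Frho : pol F rho by rewrite Er; apply: polD => //; apply: polM.
pose c := (lead_coef rho)^-1.
have Fc : F c by apply: fracs_inv => //; apply: Frho.
have c0 : c != 0 by rewrite invr_eq0 lead_coef_eq0.
pose r' := c *: rho.
have rm : r' \is monic by rewrite monicE lead_coefZ mulVf // lead_coef_eq0.
have Fr' : pol F r' by apply: polZ.
have sr' : size r' = size rho by rewrite size_scale.
have Er' : r' = (c *: a) * d + (c *: b) * n by rewrite -!scalerAl -scalerDr -Er.
have dvd f : (exists u v, [/\ pol F u, pol F v & f = u * d + v * n]) ->
    exists2 e, pol F e & f = e * r'.
  move=> [u [v [Fu Fv Ef]]].
  have Ff : pol F f by rewrite Ef; apply: polD => //; apply: polM.
  have [e [r [Fe Fr E lt]]] := div_monic Fsr rm Ff Fr'.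
  exists e => //; rewrite E; suff -> : r = 0 by rewrite addr0.
  apply/eqP; apply: contrapT => /negP r0; move: lt; rewrite sr' ltnNge rmin //.
  split=> //; exists (u - e * (c *: a)), (v - e * (c *: b)); split.
  - by apply: polB => //; apply: polM => //; apply: polZ.
  - by apply: polB => //; apply: polM => //; apply: polZ.
  - have -> : r = f - e * r' by rewrite E addrAC subrr add0r.
    rewrite Ef Er'; move: (c *: a) (c *: b) => a' b'; ring.
have [|e Fe Ed] := dvd d.
  by exists 1, 0; rewrite mul1r mul0r addr0; split=> //; [exact: pol1|exact: pol0].
have [|e' Fe' En] := dvd n.
  by exists 0, 1; rewrite mul1r mul0r add0r; split=> //; [exact: pol0|exact: pol1].
have e0 : e != 0 by apply/eqP => e0; move: d0; rewrite Ed e0 mul0r eqxx.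
have [s1|s1] := leqP (size r') 1.
  exists (c *: a), (c *: b); split; [exact: polZ|exact: polZ|].
  rewrite -Er' (size1_polyC s1); congr (_%:P).
  move: rm; rewrite monicE {1}(size1_polyC s1) lead_coefC => /eqP //.
have lt : (size e < size d)%N.
  by rewrite Ed size_Mmonic // ; move: s1; case: (size r') => // [[|k]] // _; rewrite addnS /= addnS /= ltnS leq_addr.
by have := Hmin e e' (And4 Fe Fe' e0 lt); rewrite En Ed mulrCA eqxx.
Qed.

Lemma adj_fracs_closed w m : fracs (adj C x) w -> C m -> m != 0 ->
  intg (adj C x) (m * w) -> adj F x w.
Proof.
move=> [_ [_ [[n Cn ->] [d Cd ->] dx0 Ew]]] Cm m0 iw.
pose H (f : {poly L}) := [/\ f != 0, pol F f & adj F x (f.[x] * w)].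
have CF : subs C F by apply: fracs_sub.
have [|d0 [[d00 Fd0 [n0 Fn0 En0]] dmin]] := @exists_min_size H.
  exists d; split.
  - by apply/eqP => d0; move: dx0; rewrite d0 horner0 eqxx.
  - exact: pol_mono Cd.
  - by exists n; [exact: pol_mono Cn|rewrite Ew mulrC divfK].
have Fxsr := adj_sr x Fsr.
have mv : F m^-1 by apply: fracs_inv => //; apply: CF.
have Uw U : valr U -> subs (adj F x) U -> U w.
  move=> Uv FU; have [Usr _] := Uv.
  rewrite -[w](mulKf m0); apply: srM => //; first by apply: FU; apply: adj_sub.
  apply: iw => // y Cxy; apply: FU; case: Cxy => p Cp ->; exists p => //.
  exact: pol_mono Cp.
have [s1|s1] := leqP (size d0) 1.
  have Ed := size1_polyC s1; have c0 : d0`_0 != 0 by rewrite -polyC_eq0 -Ed.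
  move: En0; rewrite Ed hornerC => En0.
  exists ((d0`_0)^-1 *: n0).
    by apply: polZ => //; apply: fracs_inv => //; apply: Fd0.
  by rewrite hornerZ -En0 mulKf.
pose J y := exists2 p, pol F p & y = d0.[x] * p.[x].
have Fdx : adj F x d0.[x] by exists d0.
have [||U [Uv FU JU]] := @chevalley _ (adj F x) J Fxsr.
- split.
  + by move=> _ [p Fp ->]; apply: srM => //; exists p.
  + by exists 0; [exact: pol0|rewrite horner0 mulr0].
  + by move=> _ _ [p Fp ->] [q Fq ->]; exists (p + q); [exact: polD|rewrite hornerD mulrDr].
  + by move=> _ _ [q Fq ->] [p Fp ->]; exists (q * p); [exact: polM|rewrite hornerM; ring].
- move=> [p Fp E1].
  have E : d0 * p = 1.
    by apply: tr_inj; [exact: polM|exact: pol1|rewrite hornerM hornerC].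
  have /eqP := congr1 (fun f : {poly L} => size f) E; rewrite size_poly1 size_mul //.
    have : (0 < size p)%N.
      by rewrite size_poly_gt0; apply/eqP => p0; move/eqP: E; rewrite p0 mulr0 eq_sym oner_eq0.
    by move: s1; case: (size d0) => [|[|k]] //; case: (size p) => // l _ _; rewrite !addSn addnS.
  by apply/eqP => p0; move/eqP: E; rewrite p0 mulr0 eq_sym oner_eq0.
have [|a [b [Fa Fb E1]]] := bezout_fracs Fd0 Fn0 d00.
  move=> e r [Fe Fr e0 lt]; apply/eqP => E.
  have dx : d0.[x] != 0.
    by apply/eqP => d0x; move: d00; rewrite (tr_fracs Fd0 d0x) eqxx.
  have He : H e.
    split=> //; exists r => //; apply: (mulfI dx).
    by rewrite mulrCA En0 -!hornerM E mulrC.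
  by have := dmin _ He; rewrite leqNgt lt.
have mid := vmax_ideal Uv; have [Usr _] := Uv.
have md : vmax U d0.[x] by apply: JU; exists 1; [exact: pol1|rewrite hornerC mulr1].
case: (vmax1 Uv); have -> : 1 = (a * d0 + b * n0).[x] by rewrite E1 hornerC.
rewrite hornerD !hornerM -En0; apply: (idD mid); apply: (idMl mid) => //.
- by apply: FU; exists a.
- by apply: FU; exists b.
- by apply: (idMr mid) => //; apply: Uw.
Qed.

(* A denominator dividing both the constant [m] and the monic [h] is a unit. *)
Lemma hartogs V w m h : valr V -> subs C V -> V x -> fracs (adj C x) w ->
  C m -> m != 0 -> intg (adj C x) (m * w) ->
  h \is monic -> pol C h -> intg (adj C x) (h.[x] * w) -> V w.
Proof.
move=> Vv CV Vx Fw Cm m0 imw hm Ch ihw; have [Vsr _] := Vv.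
have [g Fg Ew] := adj_fracs_closed Fw Cm m0 imw.
have [g0|g0] := eqVneq g 0; first by rewrite Ew g0 horner0; apply: sr0.
have [j [c0 Hj]] := valr_min Vv g0; set c := g`_j in c0 Hj.
pose g' := c^-1 *: g.
pose A y := V y /\ F y.
have CF : subs C F by apply: fracs_sub.
have Asr : is_subring A by apply: cap_sr.
have CA : subs C A by move=> y Cy; split; [exact: CV|exact: CF].
have Ag' : pol A g'.
  move=> i; rewrite coefZ mulrC; split; first exact: Hj.
  by apply: srM => //; apply: fracs_inv => //; apply: Fg.
have Eg : w = c * g'.[x] by rewrite Ew hornerZ mulVKf.
case: (pselect (V c)) => [Vc|nVc].
  rewrite Eg; apply: srM => //; apply: pol_horner => //.
  by apply: pol_mono Ag' => y [].
pose R := adj A x.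
have Rsr : is_subring R by apply: adj_sr.
pose Q y := exists p, [/\ pol A p, pol (vmax V) p & y = p.[x]].
have polA_V p : pol A p -> pol V p by apply: pol_mono => y [].
have polA_F p : pol A p -> pol F p by apply: pol_mono => y [].
have QP p : pol A p -> Q p.[x] -> pol (vmax V) p.
  by move=> Ap [q [Aq mq E]]; rewrite (tr_inj (polA_F _ Ap) (polA_F _ Aq) E).
have mid := vmax_ideal Vv.
have Qpr : prime_of R Q.
  apply: primeI => //.
  - split.
    + by move=> _ [p [Ap mp ->]]; exists p.
    + by exists 0; rewrite horner0; split=> //; [exact: pol0|exact: (ipol0 mid)].
    + move=> _ _ [p [Ap mp ->]] [q [Aq mq ->]]; exists (p + q).
      by rewrite hornerD; split=> //; [exact: polD|exact: (ipolD mid)].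
    + move=> _ _ [p Ap ->] [q [Aq mq ->]]; exists (p * q).
      by rewrite hornerM; split=> //; [exact: polM|apply: (ipolM mid) => //; exact: polA_V].
  - rewrite -(hornerC 1 x) => /QP - /(_ (pol1 Asr)) /(_ 0%N); rewrite coef1; exact: vmax1.
  - move=> _ _ [p Ap ->] [q Aq ->]; rewrite -hornerM => /(QP _ (polM Asr Ap Aq)).
    by case/(pol_prime Vsr (vmax_prime Vv) (polA_V _ Ap) (polA_V _ Aq)) => mf; [left; exists p|right; exists q].
have [U [Uv RU Um]] := prime_dominated Rsr Qpr; have [Usr _] := Uv.
have unit p : pol A p -> ~ pol (vmax V) p -> U (p.[x])^-1.
  move=> Ap np; have Rp : R p.[x] by exists p.
  by apply: (proj2 (nvmax (RU _ Rp) _)) => /(Um _ Rp) /(QP _ Ap).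
have Ah : pol A h by apply: pol_mono Ch.
have hx : U (h.[x])^-1.
  apply: unit => // /(_ (size h).-1); rewrite -lead_coefE.
  by move: hm; rewrite monicE => /eqP ->; apply: vmax1.
have h0 : h.[x] != 0.
  apply/eqP => hx0; have := tr_fracs (polA_F _ Ah) hx0 => h0.
  by move: hm; rewrite h0 monicE lead_coef0 eq_sym oner_eq0.
have Uw : U w.
  rewrite -[w](mulKf h0); apply: srM => //; apply: ihw => // _ [p Cp ->].
  by apply: RU; exists p => //; apply: pol_mono Cp.
have ng' : ~ pol (vmax V) g' by move=> /(_ j); rewrite coefZ mulVf //; apply: vmax1.
have Ug := unit _ Ag' ng'.
have gx0 : g'.[x] != 0.
  apply/eqP => gx0; apply: ng'; rewrite (tr_fracs (polA_F _ Ag') gx0); exact: (ipol0 mid).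
have Uc : U c by rewrite -[c](mulfK gx0) -Eg; apply: srM.
have mc : vmax V c^-1 by apply: vmax_inv.
have Ac : A c^-1 by split; [exact: vmaxS|apply: fracs_inv => //; apply: Fg].
have : vmax U c^-1.
  apply/(Um _ (adj_sub x Asr Ac)); exists (c^-1)%:P; rewrite hornerC; split=> //.
    exact: polC.
  exact: (ipolC mid).
by move=> mUc; exfalso; move: mUc; apply: vmax_unit; rewrite ?invrK ?invr_eq0.
Qed.

Definition scale_var (g : L) (p : {poly L}) := \poly_(i < size p) (p`_i * g ^+ i).
Lemma horner_scale_var g p s : (scale_var g p).[s] = p.[g * s].
Proof.
rewrite horner_poly horner_coef; apply: eq_bigr => i _.
by rewrite exprMn mulrA.
Qed.

Lemma going_down V s b m h : valr V -> subs C V -> V x -> V s ->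
  intg (adj C x) s -> intg (adj C x) b -> C m -> m != 0 ->
  h \is monic -> pol C h -> vmax V h.[x] -> m * s = h.[x] * b -> vmax V s.
Proof.
move=> Vv CV Vx Vs si bi Cm m0 hm Ch mh Esb.
have [Vsr _] := Vv; have mid := vmax_ideal Vv.
have Csr' : is_subring (adj C x) := adj_sr x Csr.
pose E := fracs (adj C x).
have Esr : is_subring E by apply: fracs_sr.
have Einv y : E y -> E y^-1 by apply: fracs_inv.
have CxE : subs (adj C x) E by apply: fracs_sub.
have h0 : h.[x] != 0.
  apply/eqP => hx; have h0 := xtr Ch hx.
  by move: hm; rewrite h0 monicE lead_coef0 eq_sym oner_eq0.
have Ehx : E h.[x] by apply: CxE; exists h.
have Em : E m by apply: CxE; apply: adj_sub.
pose g := m / h.[x].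
have g0 : g != 0 by rewrite mulf_neq0 ?invr_eq0.
have Eg : E g by apply: fracs_div.
have Eb : b = g * s by rewrite /g mulrAC Esb mulrC mulKf.
pose H (f : {poly L}) := [/\ f != 0, pol E f & f.[s] = 0].
have [|mu0 [[mu00 Emu0 mus0] mumin0]] := @exists_min_size H.
  have [G [Gm RG Gs]] := intg_poly Csr' si.
  by exists G; split=> //; [exact: monic_neq0|exact: pol_mono RG].
have [mu [mum Emu smu] mus'] := monicize Esr Einv Emu0 mu00.
have mus := mus' _ mus0.
have mumin nu : pol E nu -> nu.[s] = 0 -> (size nu < size mu)%N -> nu = 0.
  move=> Enu nus lt; apply/eqP; apply: contrapT => /negP nu0.
  by have := mumin0 nu (And3 nu0 Enu nus); rewrite leqNgt -smu lt.
have muint := minpoly_intg Esr Csr' CxE si mum Emu mus mumin.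
pose k := (size mu).-1.
have smu' : size mu = k.+1 by rewrite /k prednK // size_poly_gt0 monic_neq0.
have muk : mu`_k = 1 by move: mum; rewrite monicE lead_coefE => /eqP.
pose nu := \poly_(i < k.+1) (mu`_i * g ^+ (k - i)).
have Ek i : (i < k.+1)%N -> nu`_i = mu`_i * g ^+ (k - i) by move=> ik; rewrite coef_poly ik.
have nuk : nu`_k = 1 by rewrite Ek // muk subnn expr0 mulr1.
have snu : size nu = k.+1.
  apply/eqP; rewrite eqn_leq size_poly ltnNge; apply/negP => /leq_sizeP /(_ k (leqnn k)).
  by move/eqP; rewrite nuk oner_eq0.
have num : nu \is monic by rewrite monicE lead_coefE snu /= nuk.
have Enu : pol E nu.
  by move=> i; rewrite coef_poly; case: ifP => _; [apply: srM => //; apply: srX|apply: sr0].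
have nub : nu.[b] = 0.
  have : g ^+ k * mu.[s] = 0 by rewrite mus mulr0.
  rewrite horner_poly horner_coef smu' mulr_sumr => E0; rewrite -[RHS]E0.
  apply: eq_bigr => i _; rewrite Eb (exprMn i g s).
  have -> : g ^+ k = g ^+ (k - i) * g ^+ i by rewrite -exprD subnK // -ltnS ltn_ord.
  by move: (g ^+ (k - i)) (g ^+ i) (s ^+ i) => u v t; ring.
have numin f : pol E f -> f.[b] = 0 -> (size f < size nu)%N -> f = 0.
  move=> Ef fb lt; have := mumin (scale_var g f) _ _ _.
  rewrite horner_scale_var -Eb => H0; apply/polyP => i; rewrite coef0.
  have [ltf|] := ltnP i (size f); last by move=> ?; rewrite nth_default.
  have /(congr1 (fun q : {poly L} => q`_i)) : scale_var g f = 0.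
    apply: H0 => //.
    - by move=> j; rewrite coef_poly; case: ifP => _; [apply: srM => //; apply: srX|apply: sr0].
    - by apply: leq_ltn_trans (size_poly _ _) _; rewrite smu' -snu.
  rewrite coef_poly ltf coef0 => /eqP; rewrite mulf_eq0 expf_eq0 (negbTE g0) andbF orbF.
  by move/eqP.
have nuint := minpoly_intg Esr Csr' CxE bi num Enu nub numin.
have k0 : (0 < k)%N.
  by rewrite -ltnS -smu'; apply: (@root_size_gt1 _ s); [exact: monic_neq0|exact/eqP].
have mmu i : (i < k)%N -> vmax V mu`_i.
  move=> ik; pose w := mu`_i / h.[x] ^+ (k - i).
  have Ew : mu`_i = h.[x] ^+ (k - i) * w by rewrite mulrC divfK // expf_neq0.
  have Vw : V w.
    apply: (@hartogs V w (m ^+ (k - i)) (h ^+ (k - i))) => //.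
    - by apply: (fracs_div Csr'); [exact: Emu|exact: (srX Esr)].
    - exact: (srX Csr).
    - by rewrite expf_neq0.
    - have <- : nu`_i = m ^+ (k - i) * w.
        by rewrite Ek ?(leq_trans ik) // /g expr_div_n /w mulrCA mulrA.
      exact: nuint.
    - exact: monic_exp.
    - exact: pol_exp.
    - by rewrite horner_exp -Ew; apply: muint.
  rewrite Ew; apply: (idMr mid) => //.
  have -> : (k - i)%N = (k - i).-1.+1 by rewrite prednK // subn_gt0.
  rewrite exprSr; apply: (idMl mid) => //; apply: srX => //; exact: vmaxS.
apply: (prX Vsr (vmax_prime Vv) (n := k)) => //.
have -> : s ^+ k = - \sum_(i < k) mu`_i * s ^+ i.
  apply/eqP; rewrite -addr_eq0 addrC; apply/eqP.
  by move: mus; rewrite horner_coef smu' big_ord_recr /= muk mul1r.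
apply: (idN Vsr mid); apply: (id_sum mid) => i _; apply: (idMr mid); first exact: mmu.
exact: srX.
Qed.

End Transcendental.
End GoingDown.

(** * Height-one primes and Zariski's main theorem *)

Section Isolated.
Variable L : fieldType.
Implicit Types (A B C D R V M P Q I E F : pset L) (x y z : L).

Definition adjs A (xs : seq L) : pset L := foldr (fun x B => adj B x) A xs.

Lemma adjs_sr A xs : is_subring A -> is_subring (adjs A xs).
Proof. by move=> Asr; elim: xs => //= x xs IH; apply: adj_sr. Qed.
Lemma adjs_sub A xs : is_subring A -> subs A (adjs A xs).
Proof.
move=> Asr; elim: xs => [|x xs IH] a Aa //=.
by apply: adj_sub; [exact: adjs_sr|exact: IH].
Qed.
Lemma adjs_mem A xs x : is_subring A -> x \in xs -> adjs A xs x.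
Proof.
move=> Asr; elim: xs => [|y xs IH] //=; rewrite inE => /orP [/eqP ->|/IH H].
  by apply: adj_gen; apply: adjs_sr.
by apply: adj_sub => //; apply: adjs_sr.
Qed.
Lemma adjs_min A B xs : is_subring B -> subs A B -> (forall x, x \in xs -> B x) ->
  subs (adjs A xs) B.
Proof.
move=> Bsr AB; elim: xs => [|x xs IH] //= H.
apply: adj_min => //; last by apply: H; rewrite inE eqxx.
by apply: IH => y ys; apply: H; rewrite inE ys orbT.
Qed.

(* [m_V /\ B] has height at most one. *)
Definition height1 V B := forall q, prime_of B q -> nonzero q -> subs q (vmax V) ->
  forall y, B y -> vmax V y -> q y.

Lemma height1_power V B J h : valr V -> is_subring B -> subs B V -> height1 V B ->
  ideal_of B J -> nonzero J -> subs J (vmax V) -> B h -> vmax V h ->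
  exists k s, [/\ B s, ~ vmax V s & J (s * h ^+ k)].
Proof.
move=> Vv Bsr BV ht Jid [j [Jj j0]] JV Bh mh; have [Vsr _] := Vv.
apply: contrapT => no.
pose S y := exists k s, [/\ B s, ~ vmax V s & y = s * h ^+ k].
have [||||q [qpr Jq Sq]] := @prime_avoiding _ B J S Bsr Jid.
- exists 0%N, 1; rewrite expr0 mulr1; split=> //; [exact: sr1|exact: vmax1].
- move=> _ _ [k [s [Bs ns ->]]] [l [t [Bt nt ->]]]; exists (k + l)%N, (s * t).
  split; [exact: srM|by apply: (prMn (vmax_prime Vv)) => //; apply: BV|].
  by rewrite exprD; ring.
- by move=> _ [k [s [Bs ns ->]]]; apply: srM => //; apply: srX.
- by move=> y [k [s [Bs ns ->]]] Jy; apply: no; exists k, s.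
apply: (Sq h); first by exists 1%N, 1; rewrite mul1r expr1; split=> //; [exact: sr1|exact: vmax1].
apply: ht => //; first by exists j; split=> //; apply: Jq.
move=> y qy; apply: contrapT => nmy.
apply: (Sq y) => //; exists 0%N, y; rewrite expr0 mulr1; split=> //.
exact: (idS (pr_id qpr)).
Qed.

Section HeightTransfer.
Variables (V B1 B2 : pset L) (Vv : valr V) (B1sr : is_subring B1) (B2sr : is_subring B2).
Hypotheses (B12 : subs B1 B2) (B2V : subs B2 V).
Hypothesis den : forall y, B2 y -> exists t, [/\ B1 t, ~ vmax V t & B1 (t * y)].

Lemma height1_sub : height1 V B2 -> height1 V B1.
Proof.
move=> ht q qpr [z [qz z0]] qV; have qid := pr_id qpr.
have nq t : ~ vmax V t -> ~ q t by move=> nt /qV.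
have mpr := vmax_prime Vv.
pose Q y := B2 y /\ exists t, [/\ B1 t, ~ vmax V t & q (t * y)].
have qQ : subs q Q.
  move=> y qy; split; first by apply: B12; apply: (idS qid).
  by exists 1; rewrite mul1r; split=> //; [exact: sr1|exact: vmax1].
move=> y B1y my.
have : Q y.
  apply: ht => //.
  - apply: primeI => //.
    + split.
      * by move=> u [].
      * exact: qQ (id0 qid).
      * move=> u v [Bu [t [Bt nt qt]]] [Bv [t' [Bt' nt' qt']]].
        split; first exact: srD.
        exists (t * t'); split; [exact: srM|by apply: (prMn mpr) => //; apply: B2V; apply: B12|].
        have -> : t * t' * (u + v) = t' * (t * u) + t * (t' * v) by ring.
        by apply: (idD qid); apply: (idMl qid).
      * move=> r u Br [Bu [t [Bt nt qt]]]; split; first exact: srM.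
        have [t' [Bt' nt' Btr]] := den Br.
        exists (t' * t); split; [exact: srM|by apply: (prMn mpr) => //; apply: B2V; apply: B12|].
        have -> : t' * t * (r * u) = (t' * r) * (t * u) by ring.
        exact: (idMl qid).
    + by move=> [_ [t [Bt nt]]]; rewrite mulr1; apply: nq.
    + move=> u v Bu Bv [_ [t [Bt nt qt]]].
      have [t1 [Bt1 nt1 B1u]] := den Bu; have [t2 [Bt2 nt2 B1v]] := den Bv.
      have : q ((t1 * u) * (t2 * v)).
        have : q (t * ((t1 * u) * (t2 * v))).
          have -> : t * ((t1 * u) * (t2 * v)) = (t1 * t2) * (t * (u * v)) by ring.
          by apply: (idMl qid) => //; apply: srM.
        case/(prM qpr Bt) => //; first exact: srM.
        by move/(nq _ nt).
      by case/(prM qpr B1u B1v) => qq; [left|right]; split=> //; [exists t1|exists t2].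
  - by exists z; split=> //; apply: qQ.
  - move=> u [Bu [t [Bt nt /qV]]].
    case/(prM mpr); [by apply: B2V; apply: B12|exact: B2V| |] => //.
  - exact: B12.
move=> [_ [t [Bt nt]]].
case/(prM qpr Bt B1y) => //.
by move/(nq _ nt).
Qed.

Lemma height1_ext : height1 V B1 -> height1 V B2.
Proof.
move=> ht q qpr [z [qz z0]] qV y By my; have qid := pr_id qpr.
have mpr := vmax_prime Vv; have mid := vmax_ideal Vv.
pose Q u := B1 u /\ q u.
have Qty t : B1 t -> B1 (t * y) -> Q (t * y).
  move=> Bt Bty; apply: ht => //; last first.
  - by apply: (idMl mid) => //; apply: B2V; apply: B12.
  - by move=> u [_ /qV].
  - have [t' [Bt' nt' Bz]] := den (idS qid qz).
    exists (t' * z); split; last first.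
      by rewrite mulf_neq0 //; apply/eqP => t0; apply: nt'; rewrite t0; apply: vmax0.
    by split=> //; apply: (idMl qid) => //; apply: B12.
  - apply: primeI => //.
    + split.
      * by move=> u [].
      * by split; [exact: sr0|exact: (id0 qid)].
      * by move=> u v [Bu qu] [Bv qv]; split; [exact: srD|exact: (idD qid)].
      * by move=> r u Br [Bu qu]; split; [exact: srM|by apply: (idMl qid) => //; apply: B12].
    + by move=> [_ /(pr1 qpr)].
    + move=> u v Bu Bv [_]; case/(prM qpr (B12 Bu) (B12 Bv)) => quv; by [left|right].
have [t [Bt nt Bty]] := den By.
have [_] := Qty t Bt Bty.
by case/(prM qpr (B12 Bt) By) => // /qV.
Qed.
End HeightTransfer.

Lemma monic_conductor C B x t (h : {poly L}) : is_subring C -> is_subring B ->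
  subs C B -> B x -> (forall y, B y -> intg C y -> C y) ->
  h \is monic -> pol C h -> B t -> intg (adj C x) t ->
  adj C x (h.[x] * t) -> adj C x t.
Proof.
move=> Csr Bsr CB Bx Ccl hm Ch Bt it [r Cr Er].
have [q [r' [Cq Cr' E lt]]] := div_monic Csr hm Cr Ch.
pose t' := t - q.[x].
have Et' : h.[x] * t' = r'.[x] by rewrite /t' mulrBr Er E !hornerE; ring.
suff Ct' : C t'.
  exists (t'%:P + q); first by apply: polD => //; apply: polC.
  by rewrite !hornerE /t' subrK.
apply: Ccl.
  by apply: srB => //; apply: pol_horner => //; apply: pol_mono Cq.
move=> V Vv CV; have [Vsr _] := Vv.
apply: contrapT => nVt.
have t0 : t' != 0 by apply/eqP => t0; apply: nVt; rewrite t0; apply: sr0.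
have my := vmax_inv nVt.
have Vx : V x.
  have lt' : (size (t'^-1 *: r') < size h)%N by apply: leq_ltn_trans (size_scale_leq _ _) _.
  apply: (valr_monic Vv (p := h - t'^-1 *: r')).
  - by rewrite monicE lead_coefDl ?size_polyN // -monicE.
  - rewrite size_polyDl ?size_polyN // ltnNge; apply/negP => s1.
    have r0 : r' = 0.
      apply/eqP; rewrite -size_poly_eq0 -leqn0 -ltnS.
      exact: leq_trans lt s1.
    move/eqP: Et'; rewrite r0 horner0 mulf_eq0 (negbTE t0) orbF => /eqP hx0.
    have := monic_neq0 hm; move: hx0; rewrite (size1_polyC s1) hornerC => ->.
    by rewrite polyC0 eqxx.
  - apply: polB => //; first exact: pol_mono Ch.
    by apply: polZ => //; [exact: vmaxS|exact: pol_mono Cr'].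
  - rewrite !hornerE -Et' mulrC mulfK // subrr; exact: sr0.
apply: nVt; apply: srB => //.
  by apply: it => //; apply: adj_min.
by apply: pol_horner => //; apply: pol_mono Cq.
Qed.

Lemma lead_intg C (p : {poly L}) z : is_subring C -> pol C p -> p.[z] = 0 ->
  intg C (lead_coef p * z).
Proof.
move=> Csr Cp pz.
have [->|p0] := eqVneq p 0; first by rewrite lead_coef0 mul0r; apply: intg_sub; apply: sr0.
set c := lead_coef p; have c0 : c != 0 by rewrite lead_coef_eq0.
pose k := (size p).-1.
have sp : size p = k.+1 by rewrite /k prednK // size_poly_gt0.
have k0 : (0 < k)%N by rewrite -ltnS -sp; apply: (@root_size_gt1 _ z) => //; apply/eqP.
apply: (@poly_intg _ _ _ ('X^k + \sum_(i < k) (p`_i * c ^+ (k - i.+1)) *: 'X^i)).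
- rewrite monicE lead_coefDl ?lead_coefXn // size_polyXn ltnS.
  apply: leq_trans (size_sum _ _ _) _; apply/bigmax_leqP => i _.
  by apply: leq_trans (size_scale_leq _ _) _; rewrite size_polyXn.
- apply: polD => //; first exact: polXn.
  apply: pol_sum => // i _; apply: polZ => //; last exact: polXn.
  by apply: srM => //; apply: srX => //; apply: Cp.
- rewrite hornerD hornerXn horner_sum.
  have : c ^+ k.-1 * p.[z] = 0 by rewrite pz mulr0.
  rewrite horner_coef sp big_ord_recr /= mulrDr mulr_sumr addrC => E0.
  rewrite -[RHS]E0; congr (_ + _).
    have -> : p`_k = c by rewrite /c lead_coefE.
    rewrite mulrA -exprSr prednK // exprMn //.
  apply: eq_bigr => i _; rewrite hornerZ hornerXn exprMn.
  have -> : c ^+ k.-1 = c ^+ (k - i.+1) * c ^+ i.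
    by rewrite -exprD; congr (_ ^+ _); have := ltn_ord i; lia.
  by move: (c ^+ (k - i.+1)) (c ^+ i) (z ^+ i) => u v w; ring.
Qed.

Lemma relation_unit V C B x (p : {poly L}) : valr V -> is_subring C -> is_subring B ->
  subs C B -> subs B V -> B x -> (forall y, B y -> intg C y -> C y) ->
  pol C p -> p.[x] = 0 -> (exists i, ~ vmax V p`_i) ->
  exists s, [/\ C s, ~ vmax V s & C (s * x)].
Proof.
move=> Vv Csr Bsr CB BV Bx Ccl; have [Vsr _] := Vv; have mid := vmax_ideal Vv.
have [n] := ubnP (size p); elim: n p => // n IH p Hn Cp px [i ni].
set c := lead_coef p.
have Ccx : C (c * x).
  apply: Ccl; first by apply: srM => //; apply: CB; apply: Cp.
  exact: lead_intg.
have p0 : p != 0 by apply/eqP => p0; apply: ni; rewrite p0 coef0; apply: vmax0.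
pose k := (size p).-1.
have sp : size p = k.+1 by rewrite /k prednK // size_poly_gt0.
have k0 : (0 < k)%N by rewrite -ltnS -sp; apply: (@root_size_gt1 _ x) => //; apply/eqP.
case: (pselect (vmax V c)) => [mc|nc]; last by exists c; split=> //; apply: Cp.
have mcx : vmax V (c * x) by apply: (idMr mid) => //; apply: BV.
pose p1 := \poly_(j < k) p`_j.
have Ep : p = p1 + c *: 'X^k := poly_lead_split sp.
have Cp1 : pol C p1 by move=> j; rewrite coef_poly; case: ifP => // _; apply: sr0.
apply: (IH (p1 + (c * x) *: 'X^(k.-1))).
- apply: leq_ltn_trans (_ : _ <= k)%N _; last by rewrite -ltnS -sp.
  apply: leq_trans (size_polyD _ _) _; rewrite geq_max size_poly /=.
  by apply: leq_trans (size_scale_leq _ _) _; rewrite size_polyXn prednK.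
- by apply: polD => //; apply: polZ => //; apply: polXn.
- move: px; rewrite {1}Ep !hornerE => <-; congr (_ + _).
  by rewrite -mulrA -exprS prednK.
- exists i; rewrite coefD coefZ coefXn coef_poly => mi; apply: ni.
  have [ik|] := ltnP i k; last first.
    rewrite leq_eqVlt => /orP [/eqP <-|ki]; first by move: mc; rewrite /c lead_coefE.
    by rewrite nth_default ?sp //; apply: vmax0.
  move: mi; rewrite ik => mi.
  rewrite -[p`_i](addrK (c * x * (i == k.-1)%:R)); apply: (idB Vsr mid) => //.
  by apply: (idMr mid) => //; case: (i == _); [exact: sr1|exact: sr0].
Qed.

Lemma conductor_step R b d : is_subring R -> intg R b -> R d -> d != 0 -> R (d * b) ->
  exists e, [/\ R e, e != 0 & forall y, adj R b y -> R (e * y)].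
Proof.
move=> Rsr ib Rd d0 Rdb; have [p [pm Rp pb]] := intg_poly Rsr ib.
pose k := size p; exists (d ^+ k); split.
- exact: srX.
- by rewrite expf_neq0.
- move=> _ [f Rf ->].
  have [q [r [Rq Rr E lt]]] := div_monic Rsr pm Rf Rp.
  rewrite E !hornerE pb mulr0 add0r horner_coef mulr_sumr.
  apply: sr_sum => // i _.
  have ik : (i <= k)%N by apply: ltnW; apply: ltn_trans lt.
  have -> : d ^+ k = d ^+ (k - i) * d ^+ i by rewrite -exprD subnK.
  have -> : d ^+ (k - i) * d ^+ i * (r`_i * b ^+ i) = r`_i * (d ^+ (k - i) * (d * b) ^+ i).
    by rewrite exprMn; move: (d ^+ (k - i)) (d ^+ i) (b ^+ i) => u v w; ring.
  by apply: srM => //; apply: srM => //; apply: srX.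
Qed.

Lemma conductor_exists R bs : is_subring R -> (forall b, b \in bs -> intg R b) ->
  (forall b, b \in bs -> exists d, [/\ R d, d != 0 & R (d * b)]) ->
  exists e, [/\ R e, e != 0 & forall y, adjs R bs y -> R (e * y)].
Proof.
move=> Rsr; elim: bs => [|b bs IH] Hi Hd.
  by exists 1; rewrite oner_neq0; split=> // [|y Ry]; [exact: sr1|rewrite mul1r].
have [||e [Re e0 He]] := IH.
- by move=> c cb; apply: Hi; rewrite inE cb orbT.
- by move=> c cb; apply: Hd; rewrite inE cb orbT.
have [d [Rd d0 Rdb]] := Hd b (mem_head _ _).
have Ssr := adjs_sr bs Rsr; have RS := @adjs_sub R bs Rsr.
have ib : intg (adjs R bs) b by apply: intg_mono (Hi b _) => //; rewrite inE eqxx.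
have [e' [Re' e'0 He']] := conductor_step Ssr ib (RS _ Rd) d0 (RS _ Rdb).
exists (e * e'); split.
- exact: He.
- by rewrite mulf_neq0.
- by move=> y /= /He' /He; rewrite mulrA.
Qed.

Lemma clear_powers C1 s x (g : {poly L}) m : is_subring C1 -> C1 s -> C1 (s * x) ->
  pol C1 g -> (size g <= m)%N -> C1 (s ^+ m * g.[x]).
Proof.
move=> Csr Cs Csx Cg le; rewrite horner_coef mulr_sumr; apply: sr_sum => // i _.
have im : (i <= m)%N by apply: leq_trans (ltnW (ltn_ord i)) le.
have -> : s ^+ m = s ^+ (m - i) * s ^+ i by rewrite -exprD subnK.
have -> : s ^+ (m - i) * s ^+ i * (g`_i * x ^+ i) = g`_i * (s ^+ (m - i) * (s * x) ^+ i).
  by rewrite exprMn; move: (s ^+ (m - i)) (s ^+ i) (x ^+ i) => u v w; ring.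
by apply: srM => //; apply: srM => //; apply: srX.
Qed.

(* Peskine's argument, by induction on the generators, with conductors. *)
Lemma isolated_algebraic xs A bs V : is_subring A -> valr V ->
  subs (adjs A (bs ++ xs)) V ->
  (forall b, b \in bs -> intg (adjs A xs) b) ->
  (forall x, x \in xs -> exists h : {poly L}, [/\ h \is monic, pol A h & vmax V h.[x]]) ->
  (exists a, [/\ A a, a != 0 & vmax V a]) ->
  height1 V (adjs A (bs ++ xs)) -> subs (adjs A (bs ++ xs)) (alg A).
Proof.
move=> Asr Vv; have [Vsr _] := Vv; have mid := vmax_ideal Vv; have mpr := vmax_prime Vv.
elim: xs bs => [|x xs IH] bs.
  rewrite cats0 => BV bi _ _ _; apply: adjs_min.
  - exact: alg_sr.
  - exact: alg_sub.
  - by move=> b /bi; apply: intg_alg.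
move=> BV bi Hh [a [Aa a0 ma]] ht.
set B := adjs A (bs ++ x :: xs) in BV ht *.
have Bsr : is_subring B by apply: adjs_sr.
have AB : subs A B by apply: adjs_sub.
have Bmem y : y \in bs ++ x :: xs -> B y by apply: adjs_mem.
have Bx : B x by apply: Bmem; rewrite mem_cat inE eqxx orbT.
have [h [hm Ah mh]] := Hh x (mem_head _ _).
pose C0 := adjs A xs.
have C0sr : is_subring C0 by apply: adjs_sr.
have C0B : subs C0 B.
  by apply: adjs_min => // y yx; apply: Bmem; rewrite mem_cat inE yx !orbT.
pose C y := B y /\ intg C0 y.
have Csr : is_subring C by apply: cap_sr => //; exact: intg_sr.
have CB : subs C B by move=> y [].
have C0C : subs C0 C by move=> y Cy; split; [exact: C0B|exact: intg_sub].
have AC : subs A C by move=> y Ay; apply: C0C; apply: adjs_sub.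
have Ccl y : B y -> intg C y -> C y.
  by move=> By iy; split=> //; apply: intg_trans iy => z [].
have CV : subs C V by move=> y /CB /BV.
have Ch : pol C h by apply: pol_mono Ah.
have Bhx : B h.[x] by apply: pol_horner => //; apply: pol_mono Ah.
pose Cx := adj C x.
have Cxsr : is_subring Cx by apply: adj_sr.
have CxB : subs Cx B by apply: adj_min.
have biC b : b \in bs -> intg Cx b.
  move=> /bi; apply: intg_mono => y; rewrite /= => -[p Cp ->]; exists p => //.
  by apply: pol_mono Cp.
have BiC : subs B (intg Cx).
  apply: adjs_min; first exact: intg_sr.
    by move=> y /AC Cy; apply: intg_sub; apply: adj_sub.
  move=> y; rewrite mem_cat inE => /orP [/biC //|/orP [/eqP ->|yx]].
    by apply: intg_sub; apply: adj_gen.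
  by apply: intg_sub; apply: adj_sub => //; apply: C0C; apply: adjs_mem.
case: (pselect (forall p, pol C p -> p.[x] = 0 -> p = 0)) => [xtr|nxtr].
  pose J y := exists2 b, B b & y = h.[x] * b.
  have [|||||k [s [Bs ns [b Bb E]]]] := @height1_power V B J a Vv Bsr BV ht.
  - split.
    + by move=> _ [b Bb ->]; apply: srM.
    + by exists 0; [exact: sr0|rewrite mulr0].
    + by move=> _ _ [b Bb ->] [c Bc ->]; exists (b + c); [exact: srD|rewrite mulrDr].
    + by move=> r _ Br [b Bb ->]; exists (r * b); [exact: srM|rewrite mulrCA].
  - exists h.[x]; split; first by exists 1; [exact: sr1|rewrite mulr1].
    apply/eqP => hx0; have h0 := xtr _ Ch hx0.
    by move: hm; rewrite h0 monicE lead_coef0 eq_sym oner_eq0.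
  - by move=> _ [b Bb ->]; apply: (idMr mid) => //; apply: BV.
  - exact: AB.
  - exact: ma.
  case: ns.
  apply: (@going_down _ C x Csr xtr V s b (a ^+ k) h) => //.
  - exact: BV.
  - exact: BV.
  - exact: BiC.
  - exact: BiC.
  - by apply: (srX Csr); apply: AC.
  - by rewrite expf_neq0.
  - by rewrite mulrC.
have [p0 [Cp0 px0 p00]] : exists p, [/\ pol C p, p.[x] = 0 & p != 0].
  apply: contrapT => no; apply: nxtr => p Cp px; apply/eqP; apply: contrapT => /negP p0.
  by apply: no; exists p.
have xalg : alg C x by exists p0.
have Balg : subs B (alg C).
  move=> y /BiC /(intg_alg Cxsr); apply: alg_trans => //; apply: adj_min => //.
  - exact: alg_sr.
  - exact: alg_sub.
have [e [Ce e0 He]] : exists e, [/\ Cx e, e != 0 & forall y, adjs Cx bs y -> Cx (e * y)].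
  apply: conductor_exists => // b bb.
  have Bb : B b by apply: Bmem; rewrite mem_cat bb.
  have [p [Cp pn0 pb]] := Balg _ Bb.
  exists (lead_coef p); rewrite lead_coef_eq0; split=> //; apply: adj_sub => //.
    exact: Cp.
  apply: Ccl; last exact: lead_intg.
  by apply: srM => //; apply: CB; apply: Cp.
have BCx : subs B (adjs Cx bs).
  have sr' := adjs_sr bs Cxsr; have sub' := @adjs_sub Cx bs Cxsr.
  apply: adjs_min => //; first by move=> y /AC Cy; apply: sub'; apply: adj_sub.
  move=> y; rewrite mem_cat inE => /orP [yb|/orP [/eqP ->|yx]].
  - exact: adjs_mem.
  - by apply: sub'; apply: adj_gen.
  - by apply: sub'; apply: adj_sub => //; apply: C0C; apply: adjs_mem.
pose J t := Cx t /\ forall y, B y -> Cx (t * y).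
have Jid : ideal_of B J.
  split.
  - by move=> y [/CxB].
  - by split; [exact: (sr0 Cxsr)|move=> y _; rewrite mul0r; exact: (sr0 Cxsr)].
  - move=> u v [Cu Hu] [Cv Hv]; split; first exact: (srD Cxsr).
    by move=> y By; rewrite mulrDl; apply: (srD Cxsr); [exact: Hu|exact: Hv].
  - move=> r u Br [Cu Hu]; split; first by rewrite mulrC; apply: Hu.
    by move=> y By; rewrite [r * u]mulrC -mulrA; apply: Hu; apply: srM.
have Je : J e by split=> // y /BCx /He.
have [f [[Cf Hf] nf]] : exists f, J f /\ ~ vmax V f.
  apply: contrapT => no.
  have JV : subs J (vmax V) by move=> y Jy; apply: contrapT => ny; apply: no; exists y.
  have [|k [s [Bs ns [_ Hs]]]] := height1_power Vv Bsr BV ht Jid _ JV Bhx mh.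
    by exists e.
  apply: ns; apply: JV.
  have Hsy y : B y -> Cx (s * y).
    move=> By; apply: (@monic_conductor C B x _ (h ^+ k)) => //.
    - exact: monic_exp.
    - exact: pol_exp.
    - exact: srM.
    - by apply: BiC; apply: srM.
    - by rewrite horner_exp mulrA [_ ^+ k * s]mulrC; apply: Hs.
  by split=> //; have := Hsy 1 (sr1 Bsr); rewrite mulr1.
have [pf Cpf Ef] := Cf.
have [s [Cs ns Csx]] : exists s, [/\ C s, ~ vmax V s & C (s * x)].
  case: (pselect (exists p, [/\ pol C p, p.[x] = 0 & ~ pol (vmax V) p])) => [[p [Cp px np]]|norel].
    apply: (@relation_unit V C B x p) => //.
    apply: contrapT => no; apply: np => i; apply: contrapT => ni; apply: no; by exists i.
  exfalso.
  pose N y := exists p, [/\ pol C p, pol (vmax V) p & y = p.[x]].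
  have CVp p : pol C p -> pol V p by apply: pol_mono.
  have NP p : pol C p -> N p.[x] -> pol (vmax V) p.
    move=> Cp [q [Cq mq E]]; rewrite -[p](subrK q); apply: (ipolD mid) => //.
    apply: contrapT => npq; apply: norel; exists (p - q); split=> //.
      exact: polB.
    by rewrite !hornerE E subrr.
  have Nm y : N y -> vmax V y.
    by move=> [p [Cp mp ->]]; apply: (ipol_horner Vsr mid) => //; apply: BV.
  have npf : ~ pol (vmax V) pf by move=> mpf; apply: nf; apply: Nm; exists pf.
  pose q y := B y /\ N (f * y).
  have qpr : prime_of B q.
    apply: primeI => //.
    - split.
      + by move=> y [].
      + by split; [exact: sr0|exists 0; rewrite mulr0 horner0; split=> //; [exact: pol0|exact: (ipol0 mid)]].
      + move=> u v [Bu [p [Cp mp Ep]]] [Bv [p' [Cp' mp' Ep']]]; split; first exact: srD.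
        exists (p + p'); rewrite mulrDr Ep Ep' hornerD; split=> //; [exact: polD|exact: (ipolD mid)].
      + move=> r u Br [Bu [p [Cp mp Ep]]]; split; first exact: srM.
        have [g Cg Eg] := Hf _ Br; have [g' Cg' Eg'] := Hf _ (srM Bsr Br Bu).
        exists g'; split=> //.
        have : pol (vmax V) (pf * g').
          have -> : pf * g' = g * p + (pf * g' - g * p) by ring.
          apply: (ipolD mid); first by apply: (ipolM mid) => //; apply: CVp.
          apply: contrapT => npq; apply: norel; exists (pf * g' - g * p); split=> //.
            by apply: polB => //; apply: polM.
          by rewrite !hornerE -Ef -Eg -Eg' -Ep; ring.
        by case/(pol_prime Vsr mpr (CVp _ Cpf) (CVp _ Cg')).
    - by move=> [_]; rewrite mulr1 => /Nm.
    - move=> u v Bu Bv [_ [p [Cp mp Ep]]].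
      have [g Cg Eg] := Hf _ Bu; have [g' Cg' Eg'] := Hf _ Bv.
      have : pol (vmax V) (g * g').
        have -> : g * g' = pf * p + (g * g' - pf * p) by ring.
        apply: (ipolD mid); first by apply: (ipolM mid) => //; apply: CVp.
        apply: contrapT => npq; apply: norel; exists (g * g' - pf * p); split=> //.
          by apply: polB => //; apply: polM.
        by rewrite !hornerE -Ef -Eg -Eg' -Ep; ring.
      by case/(pol_prime Vsr mpr (CVp _ Cg) (CVp _ Cg')) => mg; [left|right]; split=> //; [exists g|exists g'].
  have qm : subs q (vmax V).
    by move=> y [By /Nm]; case/(prM mpr); [apply: BV; exact: CxB|exact: BV| |].
  have qnz : nonzero q.
    exists a; split=> //; split; first exact: AB.
    exists (a *: pf); rewrite hornerZ -Ef mulrC; split=> //.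
      by apply: polZ => //; apply: AC.
    by apply: (ipolZl mid) => //; apply: CVp.
  have [_ Nfh] := ht q qpr qnz qm _ Bhx mh.
  have : pol (vmax V) (pf * h).
    by apply: NP; [exact: polM|rewrite hornerM -Ef].
  case/(pol_prime Vsr mpr (CVp _ Cpf) (CVp _ Ch)) => // /(_ (size h).-1).
  by rewrite -lead_coefE; move: hm; rewrite monicE => /eqP ->; apply: vmax1.
have [cs [Ccs Hcs]] : exists cs : seq L, (forall c, c \in cs -> C c) /\
    forall b, b \in bs -> exists2 g : {poly L}, f * b = g.[x] & forall i, g`_i \in cs \/ g`_i = 0.
  have : forall b, b \in bs -> B b by move=> b bb; apply: Bmem; rewrite mem_cat bb.
  elim: (bs) => [|b l IHl] Hl; first by exists [::].
  have [|cs [Ccs Hcs]] := IHl; first by move=> c cl; apply: Hl; rewrite inE cl orbT.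
  have [g Cg Eg] := Hf _ (Hl b (mem_head _ _)).
  exists (polyseq g ++ cs); split.
    move=> c; rewrite mem_cat => /orP [cg|/Ccs //].
    by rewrite -(nth_index 0 cg); apply: Cg.
  move=> c; rewrite inE => /orP [/eqP ->|/Hcs [g' Eg' Hg']].
    exists g => // i; have [ig|ig] := ltnP i (size g).
      by left; rewrite mem_cat mem_nth.
    by right; rewrite nth_default.
  exists g' => // i; have [ig|ig] := Hg' i; last by right.
  by left; rewrite mem_cat ig orbT.
pose bs' := s :: s * x :: polyseq pf ++ cs.
have Cbs' b : b \in bs' -> C b.
  rewrite !inE mem_cat => /orP [/eqP -> //|/orP [/eqP -> //|/orP [cg|/Ccs //]]].
  by rewrite -(nth_index 0 cg); apply: Cpf.
pose C1 := adjs A (bs' ++ xs).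
have C1sr : is_subring C1 by apply: adjs_sr.
have C1C : subs C1 C.
  apply: adjs_min => // y; rewrite mem_cat => /orP [/Cbs' //|yx].
  by apply: C0C; apply: adjs_mem.
have C1V : subs C1 V by move=> y /C1C /CV.
have C1mem b : b \in bs' -> C1 b by move=> bb; apply: adjs_mem => //; rewrite mem_cat bb.
have C1s : C1 s by apply: C1mem; rewrite inE eqxx.
have C1sx : C1 (s * x) by apply: C1mem; rewrite !inE eqxx orbT.
have C1pol (g : {poly L}) : (forall i, g`_i \in bs' \/ g`_i = 0) -> pol C1 g.
  by move=> Hg i; have [/C1mem //|->] := Hg i; apply: sr0.
have C1pf : pol C1 pf.
  apply: C1pol => i; have [ig|ig] := ltnP i (size pf).
    by left; rewrite !inE mem_cat mem_nth ?orbT.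
  by right; rewrite nth_default.
pose m := size pf; pose w := s ^+ m * f; pose d := s * w.
have C1w : C1 w by rewrite /w Ef; apply: clear_powers.
have C1d : C1 d by apply: srM.
have nw : ~ vmax V w.
  apply: (prMn mpr); [exact: (srX Vsr) (CV _ Cs)|by apply: BV; apply: CxB| |exact: nf].
  by apply: (prXn Vsr mpr) => //; apply: CV.
have nd : ~ vmax V d by apply: (prMn mpr) => //; [exact: CV|exact: C1V].
have den y : B y -> exists k, C1 (d ^+ k * y).
  move: y; pose W y := exists k, C1 (d ^+ k * y).
  have lift k l y : C1 (d ^+ k * y) -> C1 (d ^+ (k + l) * y).
    by move=> H; rewrite addnC exprD -mulrA; apply: srM => //; apply: srX.
  have C1W : subs C1 W by move=> y Cy; exists 0%N; rewrite expr0 mul1r.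
  have Wsr : is_subring W.
    split.
    - exact: C1W (sr0 C1sr).
    - exact: C1W (sr1 C1sr).
    - move=> y z [k Hk] [l Hl]; exists (k + l)%N; rewrite mulrBr; apply: srB => //.
        exact: lift.
      by rewrite addnC; apply: lift.
    - move=> y z [k Hk] [l Hl]; exists (k + l)%N; rewrite exprD.
      have -> : d ^+ k * d ^+ l * (y * z) = (d ^+ k * y) * (d ^+ l * z) by ring.
      exact: srM.
  apply: (adjs_min Wsr); first by move=> y Ay; apply: C1W; apply: adjs_sub.
  move=> y; rewrite mem_cat inE => /orP [yb|/orP [/eqP ->|yx]].
  - have [g Eg Hg] := Hcs y yb.
    have C1g : pol C1 g.
      apply: C1pol => i; have [ig|ig] := Hg i; last by right.
      by left; rewrite !inE mem_cat ig !orbT.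
    exists (size g).+1.
    have -> : d ^+ (size g).+1 * y = w ^+ size g * s ^+ m.+1 * (s ^+ size g * g.[x]).
      rewrite -Eg /d exprMn !exprS /w.
      by move: ((s ^+ m * f) ^+ size g) (s ^+ size g) (s ^+ m) => u v t; ring.
    apply: srM => //; last exact: clear_powers.
    by apply: srM => //; apply: srX.
  - exists 1%N; rewrite expr1 /d mulrAC; exact: srM.
  - by apply: C1W; apply: adjs_mem => //; rewrite mem_cat yx orbT.
have ht1 : height1 V C1.
  apply: (@height1_sub V C1 B) => //; first by move=> y /C1C /CB.
  move=> y /den [k Hk]; exists (d ^+ k); split=> //; first exact: srX.
  by apply: (prXn Vsr mpr) => //; apply: C1V.
have C1alg : subs C1 (alg A).
  apply: IH => //.
  - by move=> b /Cbs' [].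
  - by move=> y yx; apply: Hh; rewrite inE yx orbT.
  - by exists a.
move=> y /den [k Hk].
have dk0 : d ^+ k != 0.
  by rewrite expf_neq0 //; apply/eqP => d0; apply: nd; rewrite d0; apply: vmax0.
rewrite -[y](mulKf dk0) mulrC; apply: alg_div => //; apply: C1alg => //.
exact: srX.
Qed.

End Isolated.

Section ResidualClosure.
Variables (L : fieldType) (V : pset L) (Vv : valr V).
Implicit Types (E F B : pset L) (x y z : L).
Let Vsr : is_subring V := proj1 Vv.
Let mid := vmax_ideal Vv.
Let mpr := vmax_prime Vv.

Lemma resalg_sr E : is_subring E -> subs E V -> is_subring (fun z => V z /\ resalg V E z).
Proof.
move=> Esr EV; have H := intg_sr (pullback V E); split.
- by split; [exact: sr0|apply: resalg_self => //; exact: sr0].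
- by split; [exact: sr1|apply: resalg_self => //; exact: sr1].
- move=> x y [Vx /(resalgP Vv Esr EV Vx) ix] [Vy /(resalgP Vv Esr EV Vy) iy].
  have Vxy := srB Vsr Vx Vy; split=> //; apply/(resalgP Vv Esr EV Vxy); exact: (srB H).
- move=> x y [Vx /(resalgP Vv Esr EV Vx) ix] [Vy /(resalgP Vv Esr EV Vy) iy].
  have Vxy := srM Vsr Vx Vy; split=> //; apply/(resalgP Vv Esr EV Vxy); exact: (srM H).
Qed.

Lemma resalg_inv E z : is_subring E -> V z -> ~ vmax V z -> resalg V E z -> resalg V E z^-1.
Proof.
move=> Esr Vz nz [p [Ep [i ni] mp]]; have [z0 Vz'] := nvmax Vz nz.
pose n := size p; have lin : (i < n)%N.
  by rewrite ltnNge; apply/negP => ni'; apply: ni; rewrite nth_default //; apply: vmax0.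
exists (\poly_(j < n) p`_(n - j.+1)); split.
- by move=> j; rewrite coef_poly; case: ifP => // _; apply: sr0.
- exists (n - i.+1)%N; rewrite coef_poly.
  have -> : (n - i.+1 < n)%N by move: lin; clear; lia.
  by have -> : (n - (n - i.+1).+1)%N = i by move: lin; clear; lia.
- have -> : (\poly_(j < n) p`_(n - j.+1)).[z^-1] = z * z^-1 ^+ n * p.[z].
    rewrite horner_poly horner_coef mulr_sumr -/n.
    rewrite (reindex_inj rev_ord_inj) /=; apply: eq_bigr => j _.
    have jn := ltn_ord j.
    have -> : (n - (n - j.+1).+1)%N = j by move: jn; clear; lia.
    have -> : z^-1 ^+ n = z^-1 ^+ (n - j.+1) * z^-1 ^+ j * z^-1.
      by rewrite -exprD -exprSr; congr (_ ^+ _); move: jn; clear; lia.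
    have E1 : z^-1 ^+ j * z ^+ j = 1 by rewrite -exprMn mulVf // expr1n.
    transitivity (p`_j * z^-1 ^+ (n - j.+1) * (z * z^-1) * (z^-1 ^+ j * z ^+ j)).
      by rewrite E1 divff // !mulr1.
    by move: (z^-1 ^+ (n - j.+1)) (z^-1 ^+ j) (z ^+ j) => u v w; ring.
  by apply: (idMl mid) => //; apply: srM => //; apply: srX.
Qed.

Lemma resalg_trans E E' z : is_subring E -> is_subring E' -> subs E E' -> subs E' V ->
  (forall y, E' y -> resalg V E y) -> V z -> resalg V E' z -> resalg V E z.
Proof.
move=> Esr E'sr EE' E'V HE Vz; have EV : subs E V by move=> y /EE' /E'V.
move/(resalgP Vv E'sr E'V Vz) => iz; apply/(resalgP Vv Esr EV Vz) => V' V'v TV'.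
have [V'sr _] := V'v.
have raV y : V y -> resalg V E y -> V' y by move=> Vy /(resalgP Vv Esr EV Vy); apply.
apply: iz => // y [Vy [t [e [Et Ee nt mty]]]].
have [t0 Vt] := nvmax (E'V _ Et) nt.
have -> : y = t^-1 * (e + (t * y - e)) by rewrite addrC subrK mulKf.
apply: srM => //; first by apply: raV => //; apply: resalg_inv => //; [exact: E'V|exact: HE].
apply: srD => //; first by apply: raV; [exact: E'V|exact: HE].
by apply: TV'; apply: pullback_vmax.
Qed.

Lemma resalg_primitive E (p : {poly L}) z : p != 0 -> pol E p ->
  is_subring E -> V z ->
  exists j, [/\ p`_j != 0,
    pol (fun y => V y /\ fracs E y) ((p`_j)^-1 *: p) &
    vmax V ((p`_j)^-1 *: p).[z] -> resalg V (fun y => V y /\ fracs E y) z].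
Proof.
move=> p0 Ep Esr Vz; have [j [c0 Hj]] := valr_min Vv p0.
have H : pol (fun y => V y /\ fracs E y) ((p`_j)^-1 *: p).
  move=> i; rewrite coefZ mulrC; split; first exact: Hj.
  by exists p`_i, p`_j.
exists j; split=> // m; exists ((p`_j)^-1 *: p); split=> //.
by exists j; rewrite coefZ mulVf //; apply: vmax1.
Qed.

Lemma cap_fracs_sr E : is_subring E -> is_subring (fun y => V y /\ fracs E y).
Proof. by move=> Esr; apply: cap_sr => //; exact: fracs_sr. Qed.

Definition resalg_fracs E := forall z, V z -> fracs E z -> resalg V E z.

Lemma resalg_fracs_trans E z : is_subring E -> subs E V -> resalg_fracs E -> V z ->
  resalg V (fun y => V y /\ fracs E y) z -> resalg V E z.
Proof.
move=> Esr EV Eg Vz; apply: resalg_trans => //.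
- exact: cap_fracs_sr.
- by move=> y Ey; split; [exact: EV|exact: fracs_sub].
- by move=> y [].
- by move=> y [Vy Fy]; apply: Eg.
Qed.

Lemma resalg_of_alg E z : is_subring E -> subs E V -> resalg_fracs E -> V z -> alg E z -> resalg V E z.
Proof.
move=> Esr EV Eg Vz [p [Ep p0 pz]].
have [j [c0 _ H]] := resalg_primitive p0 Ep Esr Vz.
by apply: resalg_fracs_trans => //; apply: H; rewrite hornerZ pz mulr0; apply: vmax0.
Qed.

Lemma resalg_fracs_adj E y : is_subring E -> subs E V -> resalg_fracs E -> V y -> ~ resalg V E y ->
  resalg_fracs (adj E y).
Proof.
move=> Esr EV Eg Vy ny z Vz [_ [_ [[f Ef ->] [g Eg' ->] g0 Ez]]].
have Asr := adj_sr y Esr; have AV : subs (adj E y) V by apply: adj_min.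
have [f0|f0] := eqVneq f 0.
  by apply: resalg_self => //; rewrite Ez f0 horner0 mul0r; exact: sr0.
have gn0 : g != 0 by apply/eqP => gn0; rewrite gn0 horner0 eqxx in g0.
have [j [c0 Hf mf]] := resalg_primitive f0 Ef Esr Vy.
have [k [d0 Hg mg]] := resalg_primitive gn0 Eg' Esr Vy.
set c := f`_j in c0 Hf mf; set d := g`_k in d0 Hg mg.
set f' := c^-1 *: f in Hf mf; set g' := d^-1 *: g in Hg mg.
have nf : ~ vmax V f'.[y] by move=> /mf /(resalg_fracs_trans Esr EV Eg Vy).
have ng : ~ vmax V g'.[y] by move=> /mg /(resalg_fracs_trans Esr EV Eg Vy).
have Wsr := cap_fracs_sr Esr.
have polV p : pol (fun y => V y /\ fracs E y) p -> pol V p by apply: pol_mono => t [].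
have Vf : V f'.[y] by apply: pol_horner => //; apply: polV.
have Vg : V g'.[y] by apply: pol_horner => //; apply: polV.
have [f'0 Vf'] := nvmax Vf nf; have [g'0 Vg'] := nvmax Vg ng.
have Ez' : z = (c / d) * (f'.[y] / g'.[y]).
  rewrite Ez /f' /g' !hornerZ; field.
  by rewrite c0 d0 g0.
have Vcd : V (c / d).
  have -> : c / d = z * (g'.[y] / f'.[y]) by rewrite Ez'; field; rewrite d0 f'0 g'0.
  by apply: srM => //; apply: srM.
have Rsr := resalg_sr Asr AV; set R := fun _ => _ in Rsr.
have WR t : V t -> fracs E t -> R t.
  move=> Vt Ft; split=> //; apply: (@resalg_mono _ _ E); first exact: adj_sub.
  exact: Eg.
have Ry : R y by split=> //; apply: resalg_self => //; exact: adj_gen.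
have polR p : pol (fun y => V y /\ fracs E y) p -> R p.[y].
  by move=> Wp; apply: pol_horner => //; apply: pol_mono Wp => t [Vt Ft]; apply: WR.
suff [] : R z by [].
rewrite Ez'; apply: (srM Rsr).
  by apply: WR => //; exists c, d; split=> //; [exact: Ef|exact: Eg'].
apply: (srM Rsr); first exact: polR.
by have [_ rg] := polR _ Hg; split=> //; apply: resalg_inv.
Qed.

Lemma resalg_fracs_adj_vmax E a : is_subring E -> subs E V ->
  (forall e, E e -> vmax V e -> e = 0) -> vmax V a -> a != 0 -> resalg_fracs (adj E a).
Proof.
move=> Esr EV E0 ma a0 z Vz [_ [_ [[f Ef ->] [g Eg ->] g0 Ez]]].
have Va := vmaxS Vv ma.
have Asr := adj_sr a Esr; have AV : subs (adj E a) V by apply: adj_min.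
have [f0|f0] := eqVneq f 0.
  by apply: resalg_self => //; rewrite Ez f0 horner0 mul0r; exact: sr0.
have gn0 : g != 0 by apply/eqP => gn0; rewrite gn0 horner0 eqxx in g0.
have [i [f1 [Ef1 f10 Ef']]] := strip_X Ef f0.
have [j [g1 [Eg1 g10 Eg']]] := strip_X Eg gn0.
have [rf [Hrf Erf]] := horner_split f1; have [rg [Hrg Erg]] := horner_split g1.
have unit (q : {poly L}) : pol E q -> q`_0 != 0 -> ~ vmax V q.[a].
  move=> Eq q0; have [r [Hr ->]] := horner_split q => mq.
  move/eqP: q0; apply; apply: E0; first exact: Eq.
  rewrite -[q`_0](addrK (a * r.[a])); apply: (idB Vsr mid) => //.
  apply: (idMr mid) => //; apply: pol_horner => //; apply: pol_mono (Hr E Eq (sr0 Esr)).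
  exact: EV.
have nf := unit _ Ef1 f10; have ng := unit _ Eg1 g10.
have polV q : pol E q -> V q.[a] by move=> Eq; apply: pol_horner => //; apply: pol_mono Eq.
have E1 : z * g1.[a] * a ^+ j = f1.[a] * a ^+ i.
  have : z * g.[a] = f.[a] by rewrite Ez divfK.
  by rewrite Ef' Eg' !hornerM !hornerXn mulrA.
have man k : (0 < k)%N -> vmax V (a ^+ k).
  case: k => // k _; rewrite exprSr; apply: (idMl mid) => //; exact: srX.
have mz : vmax V z -> resalg V (adj E a) z.
  move=> m; exists 'X; rewrite hornerX; split=> //; first exact: polX.
  by exists 1%N; rewrite coefX; apply: vmax1.
have [lij|lji|Eij] := ltngtP i j.
- case: nf; have -> : f1.[a] = z * g1.[a] * a ^+ (j - i).
    apply: (mulIf (expf_neq0 i a0)); rewrite -E1 -[RHS]mulrA -exprD subnK //; exact: ltnW.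
  apply: (idMl mid); first by apply: srM => //; exact: polV.
  by apply: man; rewrite subn_gt0.
- apply: mz.
  have : vmax V (z * g1.[a]).
    have -> : z * g1.[a] = f1.[a] * a ^+ (i - j).
      apply: (mulIf (expf_neq0 j a0)); rewrite E1 -[RHS]mulrA -exprD subnK //; exact: ltnW.
    apply: (idMl mid); first exact: polV.
    by apply: man; rewrite subn_gt0.
  by case/(prM mpr Vz (polV _ Eg1)).
- rewrite Eij in E1; have {}E1 := mulIf (expf_neq0 j a0) E1.
  exists ((g1`_0) *: 'X - (f1`_0)%:P); split.
  + apply: polB => //; first by apply: polZ => //; [apply: adj_sub => //; exact: Eg1|exact: polX].
    by apply: polC => //; apply: adj_sub => //; exact: Ef1.
  + exists 1%N; rewrite coefB coefZ coefX coefC mulr1 subr0 => mg.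
    by move/eqP: g10; apply; apply: E0.
  + rewrite !hornerE.
    have -> : g1`_0 * z - f1`_0 = a * (rf.[a] - rg.[a] * z).
      have -> : g1`_0 = g1.[a] - a * rg.[a] by rewrite Erg addrK.
      have -> : f1`_0 = f1.[a] - a * rf.[a] by rewrite Erf addrK.
      by rewrite -E1; ring.
    apply: (idMr mid) => //; apply: srB => //; [|apply: srM => //].
      by apply: polV; apply: Hrf => //; exact: sr0.
    by apply: polV; apply: Hrg => //; exact: sr0.
Qed.

Lemma resalg_fracs_greedy E0 B (xs : seq L) : is_subring E0 -> is_subring B -> subs E0 B -> subs B V ->
  resalg_fracs E0 -> (forall x, x \in xs -> B x) ->
  exists E, [/\ is_subring E, subs E0 E, subs E B, resalg_fracs E &
    forall x, x \in xs -> resalg V E x].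
Proof.
move=> E0sr Bsr E0B BV E0g; elim: xs => [|x xs IH] Hx; first by exists E0; split.
have [|E [Esr E0E EB Eg Er]] := IH; first by move=> y yx; apply: Hx; rewrite inE yx orbT.
have Bx : B x by apply: Hx; rewrite mem_head.
case: (pselect (resalg V E x)) => [rx|nx].
  by exists E; split=> // y; rewrite inE => /orP [/eqP -> //|/Er].
have EA := @adj_sub _ E x Esr.
exists (adj E x); split.
- exact: adj_sr.
- by move=> y /E0E /EA.
- exact: adj_min.
- by apply: resalg_fracs_adj => //; [move=> y /EB /BV|exact: BV].
- move=> y; rewrite inE => /orP [/eqP -> |/Er]; last exact: resalg_mono.
  by apply: resalg_self => //; [exact: adj_sr|exact: adj_gen].
Qed.

Lemma height1_residually_algebraic D xs u : is_subring D -> resalg_fracs D ->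
  subs (adjs D xs) V -> height1 V (adjs D xs) ->
  (exists b, [/\ adjs D xs b, b != 0 & vmax V b]) ->
  V u -> fracs (adjs D xs) u -> resalg V (adjs D xs) u.
Proof.
move=> Dsr Dg BV ht [b [Bb b0 mb]] Vu Fu.
set B := adjs D xs in BV ht Bb Fu *.
have Bsr : is_subring B by apply: adjs_sr.
have DB : subs D B by apply: adjs_sub.
have [E0 [E0sr DE0 E0B E0g [a [E0a a0 ma]]]] : exists E0, [/\ is_subring E0, subs D E0,
    subs E0 B, resalg_fracs E0 & exists a, [/\ E0 a, a != 0 & vmax V a]].
  case: (pselect (exists a, [/\ D a, a != 0 & vmax V a])) => [Da|no]; first by exists D; split.
  exists (adj D b); split.
  - exact: adj_sr.
  - exact: adj_sub.
  - exact: adj_min.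
  - apply: resalg_fracs_adj_vmax => //; first by move=> y /DB /BV.
    move=> e De me; apply/eqP; apply: contrapT => /negP e0; apply: no; by exists e.
  - by exists b; split=> //; apply: adj_gen.
have [|E [Esr E0E EB Eg Er]] := resalg_fracs_greedy E0sr Bsr E0B BV E0g (xs := xs).
  by move=> x; apply: adjs_mem.
have EV : subs E V by move=> y /EB /BV.
pose A y := exists e t, [/\ E e, E t, ~ vmax V t & y = e / t].
have nz t : ~ vmax V t -> t != 0 by move=> nt; apply/eqP => t0; apply: nt; rewrite t0; apply: vmax0.
have EA : subs E A.
  by move=> e Ee; exists e, 1; rewrite divr1; split=> //; [exact: sr1|exact: vmax1].
have Asr : is_subring A.
  split.
  - exact: EA (sr0 Esr).
  - exact: EA (sr1 Esr).
  - move=> _ _ [e [t [Ee Et nt ->]]] [e' [t' [Ee' Et' nt' ->]]].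
    exists (e * t' - e' * t), (t * t'); split.
    + by apply: srB => //; apply: srM.
    + exact: srM.
    + by apply: (prMn mpr) => //; apply: EV.
    + by field; rewrite ?nz.
  - move=> _ _ [e [t [Ee Et nt ->]]] [e' [t' [Ee' Et' nt' ->]]].
    exists (e * e'), (t * t'); split.
    + exact: srM.
    + exact: srM.
    + by apply: (prMn mpr) => //; apply: EV.
    + by field; rewrite ?nz.
have AV : subs A V.
  move=> _ [e [t [Ee Et nt ->]]]; have [_ Vt] := nvmax (EV _ Et) nt.
  by apply: srM => //; apply: EV.
pose B2 := adjs A xs.
have B2sr : is_subring B2 by apply: adjs_sr.
have BxB x : x \in xs -> B x by apply: adjs_mem.
have B2V : subs B2 V by apply: adjs_min => // x /BxB /BV.
have BB2 : subs B B2.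
  apply: adjs_min => //; last by move=> x; apply: adjs_mem.
  by move=> y /DE0 /E0E /EA; apply: adjs_sub.
have den y : B2 y -> exists t, [/\ E t, ~ vmax V t & B (t * y)].
  move: y; pose W y := exists t, [/\ E t, ~ vmax V t & B (t * y)].
  have BW : subs B W by move=> y By; exists 1; rewrite mul1r; split=> //; [exact: sr1|exact: vmax1].
  apply: (@adjs_min _ A W).
  - split.
    + exact: BW (sr0 Bsr).
    + exact: BW (sr1 Bsr).
    + move=> y z [t [Et nt Bt]] [t' [Et' nt' Bt']]; exists (t * t'); split.
      * exact: srM.
      * by apply: (prMn mpr) => //; apply: EV.
      * have -> : t * t' * (y - z) = t' * (t * y) - t * (t' * z) by ring.
        by apply: srB => //; apply: srM => //; apply: EB.
    + move=> y z [t [Et nt Bt]] [t' [Et' nt' Bt']]; exists (t * t'); split.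
      * exact: srM.
      * by apply: (prMn mpr) => //; apply: EV.
      * have -> : t * t' * (y * z) = (t * y) * (t' * z) by ring.
        exact: srM.
  - move=> _ [e [t [Ee Et nt ->]]]; exists t; split=> //.
    by rewrite mulrC divfK ?nz //; apply: EB.
  - by move=> x /BxB /BW.
have ht2 : height1 V B2.
  apply: (@height1_ext _ V B B2) => // y /den [t [Et nt Bt]].
  by exists t; split=> //; apply: EB.
have B2alg : subs B2 (alg A).
  apply: (@isolated_algebraic _ xs A [::] V) => //.
  - move=> x xx; have Vx := BV _ (BxB _ xx).
    have [p [Ep np mp]] := resalg_lead Vv Esr Vx (Er _ xx).
    have c0 := nz _ np; have [_ Vc] := nvmax (EV _ (Ep _)) np.
    exists ((lead_coef p)^-1 *: p); split.
    + by rewrite monicE lead_coefZ mulVf.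
    + move=> i; rewrite coefZ mulrC; exists p`_i, (lead_coef p); split=> //; exact: Ep.
    + by rewrite hornerZ; apply: (idMl mid).
  - by exists a; split=> //; apply: EA; apply: E0E.
have Aalg : subs A (alg E).
  move=> _ [e [t [Ee Et nt ->]]]; apply: alg_div => //; exact: alg_sub.
have ualg : alg E u.
  apply: (alg_fracs Esr); apply: fracs_mono Fu => y /BB2 /B2alg.
  exact: alg_trans.
by apply: (resalg_mono EB); apply: resalg_of_alg.
Qed.

End ResidualClosure.

(** * Residue fields of primes *)

Section Homs.
Variables (K L : fieldType).
Implicit Types (R D : pset K) (phi : K -> L).

Definition hom_on R phi := [/\ phi 1 = 1,
  forall x y, R x -> R y -> phi (x - y) = phi x - phi y &
  forall x y, R x -> R y -> phi (x * y) = phi x * phi y].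
Definition hom_img R phi : pset L := fun y => exists2 x, R x & y = phi x.
Definition pmap phi (f : {poly K}) : {poly L} := \poly_(i < size f) phi f`_i.

Section OneHom.
Variables (R : pset K) (phi : K -> L) (Rsr : is_subring R) (hphi : hom_on R phi).

Lemma hom1 : phi 1 = 1. Proof. by case: hphi. Qed.
Lemma homB x y : R x -> R y -> phi (x - y) = phi x - phi y. Proof. by case: hphi => _ + _; apply. Qed.
Lemma homM x y : R x -> R y -> phi (x * y) = phi x * phi y. Proof. by case: hphi => _ _; apply. Qed.
Lemma hom0 : phi 0 = 0.
Proof. by have := homB (sr0 Rsr) (sr0 Rsr); rewrite !subrr. Qed.
Lemma homN x : R x -> phi (- x) = - phi x.
Proof. by move=> Rx; rewrite -sub0r homB ?hom0 ?sub0r //; exact: sr0. Qed.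
Lemma homD x y : R x -> R y -> phi (x + y) = phi x + phi y.
Proof. by move=> Rx Ry; rewrite -{1}[y]opprK homB ?homN ?opprK //; exact: srN. Qed.
Lemma hom_sum n (F : 'I_n -> K) : (forall i, R (F i)) ->
  phi (\sum_(i < n) F i) = \sum_(i < n) phi (F i).
Proof.
elim: n F => [|n IH] F RF; first by rewrite !big_ord0 hom0.
by rewrite !big_ord_recr /= homD ?IH //; apply: sr_sum.
Qed.
Lemma hom_img_sr : is_subring (hom_img R phi).
Proof.
split.
- by exists 0; [exact: sr0|rewrite hom0].
- by exists 1; [exact: sr1|rewrite hom1].
- by move=> _ _ [x Rx ->] [y Ry ->]; exists (x - y); [exact: srB|rewrite homB].
- by move=> _ _ [x Rx ->] [y Ry ->]; exists (x * y); [exact: srM|rewrite homM].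
Qed.

Lemma coef_pmap f i : (pmap phi f)`_i = phi f`_i.
Proof.
rewrite coef_poly; case: ltnP => // le; by rewrite nth_default // hom0.
Qed.
Lemma pmapB f g : pol R f -> pol R g -> pmap phi (f - g) = pmap phi f - pmap phi g.
Proof. by move=> Rf Rg; apply/polyP => i; rewrite coefB !coef_pmap coefB homB. Qed.
Lemma pmapD f g : pol R f -> pol R g -> pmap phi (f + g) = pmap phi f + pmap phi g.
Proof. by move=> Rf Rg; apply/polyP => i; rewrite coefD !coef_pmap coefD homD. Qed.
Lemma pmapM f g : pol R f -> pol R g -> pmap phi (f * g) = pmap phi f * pmap phi g.
Proof.
move=> Rf Rg; apply/polyP => i; rewrite coefM !coef_pmap coefM hom_sum => [|j]; last exact: srM.
by apply: eq_bigr => j _; rewrite !coef_pmap homM.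
Qed.
Lemma pmapC c : pmap phi c%:P = (phi c)%:P.
Proof.
by apply/polyP => i; rewrite coef_pmap !coefC; case: ifP; rewrite ?hom0.
Qed.
Lemma pmapX : pmap phi 'X = 'X.
Proof. by apply/polyP => i; rewrite coef_pmap !coefX; case: (i == _); rewrite ?hom0 ?hom1. Qed.
Lemma pmap_pol f : pol R f -> pol (hom_img R phi) (pmap phi f).
Proof. by move=> Rf i; rewrite coef_pmap; exists f`_i. Qed.
Lemma pmap_lift g : pol (hom_img R phi) g -> exists2 f, pol R f & g = pmap phi f.
Proof.
move=> Ig; have [n] := ubnP (size g); elim: n g Ig => // n IH g Ig Hn.
have [g0|g0] := eqVneq g 0.
  exists 0; first exact: pol0.
  by apply/polyP => i; rewrite g0 coef_pmap !coef0 hom0.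
have sg : (0 < size g)%N by rewrite size_poly_gt0.
pose k := (size g).-1; have Ek : size g = k.+1 by rewrite /k prednK.
have [c Rc Ec] := Ig k.
have [||f Rf Ef] := IH (\poly_(i < k) g`_i).
- by move=> i; rewrite coef_poly; case: ifP => _; [exact: Ig|exact: (sr0 hom_img_sr)].
- by apply: leq_ltn_trans (size_poly _ _) _; move: Hn; rewrite Ek.
exists (f + c *: 'X^k); first by apply: polD => //; apply: polZ => //; apply: polXn.
apply/polyP => i; rewrite coef_pmap coefD homD //; last first.
  by rewrite coefZ; apply: srM => //; apply: polXn.
rewrite -coef_pmap -Ef coef_poly coefZ coefXn.
case: ltngtP => [ik|ki|->]; rewrite ?mulr0 ?hom0 ?addr0 ?mulr1 ?add0r //.
by rewrite nth_default // Ek.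
Qed.
End OneHom.
End Homs.

Lemma fraction_div (R : idomainType) (y : {fraction R}) :
  exists a b, b != 0 /\ y = FracField.tofrac a / FracField.tofrac b.
Proof.
elim/quotW: y => r; exists r.1, r.2; split; first exact: denom_ratioP.
have d0 : FracField.tofrac r.2 != 0 by rewrite tofrac_eq0 denom_ratioP.
apply: (mulIf d0); rewrite divfK //.
rewrite -[LHS]/(FracField.mul _ _) !piE.
apply/eqmodP => /=.
rewrite FracField.equivfE /FracField.mulf !numden_Ratio ?mulr1 ?mulf_neq0 ?denom_ratioP ?oner_neq0 //.
by rewrite mulrC.
Qed.

Record prime_pair (K : fieldType) := PrimePair {
  pp_ring : pset K; pp_ideal : pset K;
  pp_ringP : is_subring pp_ring; pp_idealP : prime_of pp_ring pp_ideal }.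

Section ResidueField.
Variables (K : fieldType) (S : prime_pair K).

Definition pp_mem : {pred K} := fun x => `[< pp_ring S x >].
Lemma pp_memP x : reflect (pp_ring S x) (x \in pp_mem).
Proof. exact: asboolP. Qed.
Fact pp_subring_closed : subring_closed pp_mem.
Proof.
have Rsr := pp_ringP S; split.
- by apply/pp_memP; exact: sr1.
- by move=> x y /pp_memP Rx /pp_memP Ry; apply/pp_memP; exact: srB.
- by move=> x y /pp_memP Rx /pp_memP Ry; apply/pp_memP; exact: srM.
Qed.
HB.instance Definition _ := GRing.isSubringClosed.Build K pp_mem pp_subring_closed.

Record pp_type := PPType { pp_val : K; _ : pp_val \in pp_mem }.
HB.instance Definition _ := [isSub for pp_val].
HB.instance Definition _ := [Choice of pp_type by <:].
HB.instance Definition _ := [SubChoice_isSubComNzRing of pp_type by <:].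

Definition pp_pred : {pred pp_type} := fun x => `[< pp_ideal S (val x) >].
Lemma pp_predP x : reflect (pp_ideal S (val x)) (x \in pp_pred).
Proof. exact: asboolP. Qed.
Fact pp_idealr_closed : idealr_closed pp_pred.
Proof.
have Pid := pr_id (pp_idealP S); split.
- by apply/pp_predP; rewrite rmorph0; exact: id0 Pid.
- by apply/pp_predP; rewrite rmorph1; exact: pr1 (pp_idealP S).
- move=> a x y /pp_predP Px /pp_predP Py; apply/pp_predP.
  rewrite rmorphD rmorphM; apply: (idD Pid) => //; apply: (idMl Pid) => //.
  by apply/pp_memP; exact: (valP a).
Qed.
HB.instance Definition _ := isIdealr.Build pp_type pp_pred pp_idealr_closed.
Fact pp_prime_closed : prime_idealr_closed pp_pred.
Proof.
move=> x y /pp_predP; rewrite rmorphM => Pxy.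
have Rx : pp_ring S (val x) by apply/pp_memP; exact: valP.
have Ry : pp_ring S (val y) by apply/pp_memP; exact: valP.
by apply/orP; case: (prM (pp_idealP S) Rx Ry Pxy) => ?; [left|right]; apply/pp_predP.
Qed.
HB.instance Definition _ := isPrimeIdealrClosed.Build pp_type pp_pred pp_prime_closed.

Definition pp_quot := {ideal_quot pp_pred}.
HB.instance Definition _ := GRing.ComNzRing.on pp_quot.

Definition pp_unit : {pred pp_quot} := fun x => `[< exists y, y * x = 1 >].
Definition pp_inv (x : pp_quot) : pp_quot :=
  match pselect (exists y, y * x = 1) with
  | left H => projT1 (cid H) | right _ => x end.
Fact pp_mulVx : {in pp_unit, left_inverse 1 pp_inv *%R}.
Proof.
move=> x /asboolP ex; rewrite /pp_inv; case: pselect => [H|/(_ ex) //].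
exact: projT2 (cid H).
Qed.
Fact pp_unitP (x y : pp_quot) : y * x = 1 -> x \in pp_unit.
Proof. by move=> E; apply/asboolP; exists y. Qed.
Fact pp_inv_out : {in [predC pp_unit], pp_inv =1 id}.
Proof.
move=> x; rewrite inE /= => nx; rewrite /pp_inv; case: pselect => // H.
by case/negP: nx; apply/asboolP.
Qed.
HB.instance Definition _ := GRing.ComNzRing_hasMulInverse.Build pp_quot
  pp_mulVx pp_unitP pp_inv_out.
HB.instance Definition _ := GRing.ComUnitRing_isIntegral.Build pp_quot
  (@Quotient.rquot_IdomainAxiom _ pp_pred).

Lemma quotient_field_exists : exists (L : fieldType) (phi : K -> L),
  [/\ hom_on (pp_ring S) phi,
     forall x, pp_ring S x -> (phi x = 0 <-> pp_ideal S x) &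
     forall y, fracs (hom_img (pp_ring S) phi) y].
Proof.
have Rsr := pp_ringP S; have Pid := pr_id (pp_idealP S).
pose pi (x : pp_type) : pp_quot := (\pi_pp_quot x)%qT.
pose phi x : {fraction pp_quot} :=
  FracField.tofrac (pi (insubd (0 : pp_type) x)).
have val_in x : pp_ring S x -> val (insubd (0 : pp_type) x) = x.
  by move=> Rx; apply: insubdK; apply/pp_memP.
have insB x y : pp_ring S x -> pp_ring S y ->
    insubd (0 : pp_type) (x - y) = insubd (0 : pp_type) x - insubd (0 : pp_type) y.
  by move=> Rx Ry; apply: val_inj; rewrite rmorphB /= !val_in //; exact: srB.
have insM x y : pp_ring S x -> pp_ring S y ->
    insubd (0 : pp_type) (x * y) = insubd (0 : pp_type) x * insubd (0 : pp_type) y.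
  by move=> Rx Ry; apply: val_inj; rewrite rmorphM /= !val_in //; exact: srM.
exists {fraction pp_quot}, phi; split.
- split.
  + have E1 : insubd (0 : pp_type) 1 = 1.
      by apply: val_inj; rewrite rmorph1 val_in //; exact: sr1.
    by rewrite /phi E1 /pi rmorph1 tofrac1.
  + by move=> x y Rx Ry; rewrite /phi insB // /pi rmorphB tofracB.
  + by move=> x y Rx Ry; rewrite /phi insM // /pi rmorphM tofracM.
- move=> x Rx; have piE y : (pi y == 0) = (y \in pp_pred).
    by rewrite /pi -[0](rmorph0 (\pi_pp_quot)%qT) -Quotient.idealrBE subr0.
  split=> [/eqP|Px].
    by rewrite tofrac_eq0 piE => /pp_predP; rewrite val_in.
  by apply/eqP; rewrite tofrac_eq0 piE; apply/pp_predP; rewrite val_in.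
- move=> y; have liftq (q : pp_quot) : hom_img (pp_ring S) phi (FracField.tofrac q).
    exists (val (repr q)); first by apply/pp_memP; exact: valP.
    by rewrite /phi valKd /pi reprK.
  have [a [b [b0 ->]]] := fraction_div y.
  by exists (FracField.tofrac a), (FracField.tofrac b); rewrite tofrac_eq0.
Qed.

End ResidueField.

Lemma quotient_field (K : fieldType) (R P : pset K) : is_subring R -> prime_of R P ->
  exists (L : fieldType) (phi : K -> L),
  [/\ hom_on R phi, forall x, R x -> (phi x = 0 <-> P x) &
     forall y, fracs (hom_img R phi) y].
Proof.
by move=> Rsr Ppr; exact: (quotient_field_exists (PrimePair Rsr Ppr)).
Qed.

Definition polyPrime (K : fieldType) (D : pset K) (Q : {poly K} -> Prop) :=
  [/\ forall f, Q f -> pol D f, Q 0, forall f g, Q f -> Q g -> Q (f + g),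
     forall f g, pol D f -> Q g -> Q (f * g) &
     ~ Q 1 /\ forall f g, pol D f -> pol D g -> Q (f * g) -> Q f \/ Q g].

Lemma cancel_product (F : fieldType) (c u f v : F) :
  c != 0 -> c * u * (f / c * v) = u * v * f.
Proof. by move=> c0; field. Qed.

Section PolyExt.
Variables (K : fieldType).
Local Notation T := (@FracField.tofrac {poly K}).
Implicit Types (D P A : pset K) (Q : pset (KX K)).

Lemma tofrac_inj : injective T.
Proof. by move=> f g /eqP; rewrite tofrac_eq => /eqP. Qed.

Lemma cstB (a b : K) : cst (a - b) = cst a - cst b.
Proof. by rewrite /cst polyCB tofracB. Qed.
Lemma cstM (a b : K) : cst (a * b) = cst a * cst b.
Proof. by rewrite /cst polyCM tofracM. Qed.
Lemma cst0 : cst (0 : K) = 0. Proof. by rewrite /cst tofrac0. Qed.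
Lemma cst1 : cst (1 : K) = 1. Proof. by rewrite /cst tofrac1. Qed.
Lemma cst_eq0 (a : K) : (cst a == 0) = (a == 0).
Proof. by rewrite /cst tofrac_eq0 polyC_eq0. Qed.
Lemma cstV (a : K) : cst a^-1 = (cst a)^-1.
Proof.
have [->|a0] := eqVneq a 0; first by rewrite invr0 cst0 invr0.
by apply: (mulfI (x := cst a)); rewrite ?cst_eq0 // -cstM !divff ?cst1 ?cst_eq0.
Qed.
Lemma cst_hom (R : pset K) : hom_on R (@cst K).
Proof. by split; [exact: cst1|move=> x y _ _; exact: cstB|move=> x y _ _; exact: cstM]. Qed.

Lemma polyextE D F : D 0 -> polyext D F <-> exists2 p, pol D p & F = T p.
Proof.
move=> D0; split=> [[p [Hp ->]]|[p Dp ->]]; exists p => //.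
move=> i; have [/Hp //|ip] := ltnP i (size p); by rewrite nth_default.
Qed.
Lemma polyext_T D p : D 0 -> polyext D (T p) <-> pol D p.
Proof.
by move=> D0; rewrite polyextE //; split=> [[q Dq /tofrac_inj ->]|Dp]; last exists p.
Qed.
Lemma polyext_sr D : is_subring D -> is_subring (polyext D).
Proof.
move=> Dsr; have D0 := sr0 Dsr; split.
- by rewrite -tofrac0; apply/polyext_T => //; exact: pol0.
- by rewrite -tofrac1; apply/polyext_T => //; exact: pol1.
- move=> _ _ /(polyextE _ D0) [p Dp ->] /(polyextE _ D0) [q Dq ->].
  by rewrite -tofracB; apply/polyext_T => //; exact: polB.
- move=> _ _ /(polyextE _ D0) [p Dp ->] /(polyextE _ D0) [q Dq ->].
  by rewrite -tofracM; apply/polyext_T => //; exact: polM.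
Qed.
Lemma polyext_cst D a : D 0 -> polyext D (cst a) <-> D a.
Proof.
move=> D0; rewrite polyext_T //; split=> [/(_ 0%N)|Da i]; first by rewrite coefC.
by rewrite coefC; case: ifP.
Qed.

Lemma polyext_ideal D I : is_subring D -> ideal_of D I -> ideal_of (polyext D) (polyext I).
Proof.
move=> Dsr Iid; have D0 := sr0 Dsr; have I0 := id0 Iid; split.
- move=> _ /(polyextE _ I0) [p Ip ->]; apply/polyext_T => // i; exact: (idS Iid).
- by rewrite -tofrac0; apply/polyext_T => //; exact: (ipol0 Iid).
- move=> _ _ /(polyextE _ I0) [p Dp ->] /(polyextE _ I0) [q Dq ->].
  by rewrite -tofracD; apply/polyext_T => //; exact: (ipolD Iid).
- move=> _ _ /(polyextE _ D0) [p Dp ->] /(polyextE _ I0) [q Dq ->].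
  by rewrite -tofracM; apply/polyext_T => //; exact: (ipolM Iid).
Qed.
Lemma polyext_prime D P : is_subring D -> prime_of D P -> prime_of (polyext D) (polyext P).
Proof.
move=> Dsr Ppr; have Pid := pr_id Ppr; have P0 := id0 Pid; have D0 := sr0 Dsr.
apply: primeI.
- exact: polyext_sr.
- exact: polyext_ideal.
- by rewrite -tofrac1 polyext_T // => /(_ 0%N); rewrite coef1 => /(pr1 Ppr).
- move=> _ _ /(polyextE _ D0) [p Dp ->] /(polyextE _ D0) [q Dq ->].
  by rewrite -tofracM !(polyext_T _ P0); exact: (pol_prime Dsr Ppr).
Qed.

Lemma polyPrime_of D Q : is_subring D -> prime_of (polyext D) Q -> polyPrime D (fun f => Q (T f)).
Proof.
move=> Dsr Qpr; have Qid := pr_id Qpr; have D0 := sr0 Dsr; split.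
- by move=> f /(idS Qid); rewrite polyext_T.
- by rewrite tofrac0; exact: id0 Qid.
- by move=> f g Qf Qg; rewrite tofracD; exact: (idD Qid).
- by move=> f g Df Qg; rewrite tofracM; apply: (idMl Qid) => //; apply/polyext_T.
- split; first by rewrite tofrac1; exact: pr1 Qpr.
  by move=> f g Df Dg; rewrite tofracM; apply: (prM Qpr); apply/polyext_T.
Qed.

Lemma prime_of_polyPrime D (Q : {poly K} -> Prop) : is_subring D -> polyPrime D Q ->
  prime_of (polyext D) (fun F => exists2 f, Q f & F = T f).
Proof.
move=> Dsr [QD Q0 QA QM [Q1 Qpr]]; have D0 := sr0 Dsr; apply: primeI.
- exact: polyext_sr.
- split.
  + by move=> _ [f Qf ->]; apply/polyext_T => //; exact: QD.
  + by exists 0; rewrite ?tofrac0.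
  + by move=> _ _ [f Qf ->] [g Qg ->]; exists (f + g); [exact: QA|rewrite tofracD].
  + by move=> _ _ /(polyextE _ D0) [f Df ->] [g Qg ->]; exists (f * g); [exact: QM|rewrite tofracM].
- by move=> [f Qf]; rewrite -tofrac1 => /tofrac_inj E; apply: Q1; rewrite E.
- move=> _ _ /(polyextE _ D0) [f Df ->] /(polyextE _ D0) [g Dg ->] [h Qh].
  rewrite -tofracM => /tofrac_inj E; rewrite -E in Qh.
  by case: (Qpr f g Df Dg Qh) => H; [left; exists f|right; exists g].
Qed.

Lemma horner_cst (f : {poly K}) : (pmap (@cst K) f).[T 'X] = T f.
Proof.
rewrite horner_poly -[in RHS](coefK f) poly_def rmorph_sum /=; apply: eq_bigr => i _.
by rewrite -mul_polyC tofracM tofracXn.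
Qed.

(* The upper is not extended from [D], so the powers of [f / c] generate a proper ideal together
   with [P]; a valuation ring dominating it makes the indeterminate residually algebraic over its
   trace on [K] but not over [D]. *)
Lemma residually_transcendental D P (Q : {poly K} -> Prop) f i :
  is_subring D -> prime_of D P -> polyPrime D Q ->
  (forall g, Q g -> pol P g) -> Q f -> ~ Q (f`_i)%:P ->
  exists V u, [/\ valr V, subs D V, V u,
    forall x, D x -> (vmax V x <-> P x) & ~ resalg V D u].
Proof.
move=> Dsr Ppr [QD Q0 QA QM [Q1 Qpr]] QP Qf nQc.
have D0 := sr0 Dsr; have Pid := pr_id Ppr; have P0 := id0 Pid.
set c := f`_i in nQc; have Df := QD _ Qf; have Dc : D c by apply: Df.
have c0 : c != 0 by apply/eqP => c0; apply: nQc; rewrite c0.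
have cc0 : cst c != 0 by rewrite cst_eq0.
have DXsr := polyext_sr Dsr.
pose y := T f / cst c.
pose R := adj (polyext D) y; have Rsr : is_subring R by apply: adj_sr.
pose I z := exists2 G, pol (polyext D) G /\ polyext P G`_0 & z = G.[y].
pose S z := exists s, [/\ pol D s, ~ pol P s & z = T s].
have PXid := polyext_ideal Dsr Pid.
have clear G : pol (polyext D) G -> exists k g, pol D g /\ cst c ^+ k * G.[y] = T g.
  move=> DG; exists (size G).
  have /(polyextE _ D0) [g Dg ->] : polyext D (cst c ^+ size G * G.[y]); last by exists g.
  apply: clear_powers => //.
  - by apply/polyext_cst.
  - by rewrite /y mulrC divfK //; apply/polyext_T.
have [|||||Q' [Q'pr IQ' SQ']] := @prime_avoiding _ R I S Rsr.
- split.
  + by move=> _ [G [DG _] ->]; exists G.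
  + exists 0; last by rewrite horner0.
    by split; [exact: pol0|rewrite coef0; exact: id0 PXid].
  + move=> _ _ [G [DG PG] ->] [H [DH PH] ->]; exists (G + H); last by rewrite hornerD.
    by split; [exact: polD|rewrite coefD; apply: (idD PXid)].
  + move=> _ _ [G DG ->] [H [DH PH] ->]; exists (G * H); last by rewrite hornerM.
    split; first exact: polM.
    by rewrite -!horner_coef0 hornerM !horner_coef0; apply: (idMl PXid).
- exists 1; split; [exact: pol1|move=> /(_ 0%N); rewrite coef1; exact: pr1 Ppr|by rewrite tofrac1].
- move=> _ _ [s [Ds ns ->]] [t [Dt nt ->]]; exists (s * t); rewrite tofracM; split=> //.
    exact: polM.
  by case/(pol_prime Dsr Ppr Ds Dt).
- move=> _ [s [Ds ns ->]]; apply: adj_sub => //; exact/polyext_T.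
- move=> _ [s [Ds ns ->]] [G [DG PG] Es]; apply: ns.
  have [G1 [HG1 EG1]] := horner_split G.
  have DG1 : pol (polyext D) G1 by apply: HG1 => //; exact: sr0.
  have [k [g [Dg Eg]]] := clear _ DG1.
  case/(polyextE _ P0): PG => g0 Pg0 Eg0.
  have : Q (c%:P ^+ k.+1 * (s - g0)).
    have -> : c%:P ^+ k.+1 * (s - g0) = g * f; last exact: QM.
    apply: tofrac_inj; rewrite !tofracM tofracB tofracXn -Eg -Eg0 Es EG1 addrC addKr /y -/(cst c).
    by rewrite exprS; apply: cancel_product.
  have Dg0 : pol D g0 by move=> j; exact: (idS Pid).
  case/Qpr => //.
  + by apply: pol_exp => //; apply: polC.
  + exact: polB.
  + move=> Qc; exfalso; move: Qc; elim: k.+1 => [|n IH]; first by rewrite expr0.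
    by rewrite exprS; case/Qpr => //; [exact: polC|apply: pol_exp => //; exact: polC].
  + by move/QP => Psg; rewrite -[s](subrK g0); apply: (ipolD Pid).
have [W [Wv RW Wm]] := prime_dominated Rsr Q'pr; have [Wsr _] := Wv.
pose V a := W (cst a).
have Vm a : vmax V a <-> vmax W (cst a).
  by rewrite /vmax /V cstV; split=> -[H|H]; [left; rewrite H cst0|right|left; apply/eqP; rewrite -cst_eq0 H|right].
have Vv : valr V.
  split; last by move=> a a0; rewrite /V cstV; case: Wv => _; apply; rewrite cst_eq0.
  split; rewrite /V ?cst0 ?cst1; [exact: sr0|exact: sr1| |].
    by move=> a b Wa Wb; rewrite cstB; apply: srB.
  by move=> a b Wa Wb; rewrite cstM; apply: srM.
have [Vsr _] := Vv.
have DW p : pol D p -> W (T p) by move=> Dp; apply: RW; apply: adj_sub => //; apply/polyext_T.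
have DV : subs D V by move=> a Da; apply: DW; apply: polC.
have DXR p : pol D p -> R (T p) by move=> Dp; apply: adj_sub => //; apply/polyext_T.
have Xtr p : pol D p -> vmax W (T p) -> pol P p.
  move=> Dp mp; apply: contrapT => np; apply: (SQ' (T p)); first by exists p.
  by apply/Wm => //; apply: DXR.
have PW a : P a -> vmax W (cst a).
  move=> Pa; have Da := idS Pid Pa; apply/Wm; first by apply: DXR; apply: polC.
  apply: IQ'; exists (cst a)%:P; last by rewrite hornerC.
  by rewrite coefC /=; split; [apply: polC => //; exact/polyext_cst|exact/polyext_cst].
have mDV a : D a -> (vmax V a <-> P a).
  move=> Da; rewrite Vm; split=> [/(Xtr a%:P (polC Dsr Da)) /(_ 0%N)|/PW //].
  by rewrite coefC.
have my : vmax W y.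
  apply/Wm; first by apply: adj_gen.
  apply: IQ'; exists 'X; last by rewrite hornerX.
  by split; [exact: polX|rewrite coefX; exact: (id0 PXid)].
apply: contrapT => no.
have all_ra v : V v -> resalg V D v.
  by move=> Vv'; apply: contrapT => nv; apply: no; exists V, v.
have f0 : f != 0 by apply/eqP => f0; move: c0; rewrite /c f0 coef0 eqxx.
have [j [cj0 Hj]] := valr_min Vv f0.
pose g := (f`_j)^-1 *: f.
have Vg : pol V g by move=> k; rewrite coefZ mulrC; apply: Hj.
have mg : vmax W (T g).
  have -> : T g = cst (c / f`_j) * y.
    rewrite /g -mul_polyC tofracM -/(cst _) /y cstM.
    by apply: esym; rewrite -mulrA mulrCA [cst c * _]mulrC divfK.
  by apply: (idMl (vmax_ideal Wv)) => //; apply: Hj.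
pose E := hom_img D (@cst K); pose E' := hom_img V (@cst K).
have WX : W (T 'X) by apply: DW; apply: polX.
have chD := cst_hom D; have chV := cst_hom V.
have raX : resalg W E' (T 'X).
  exists (pmap (@cst K) g); split.
  - exact: (pmap_pol Vsr chV).
  - exists j; rewrite (coef_pmap Vsr chV) coefZ mulVf // cst1; exact: vmax1.
  - by rewrite horner_cst.
have Esr : is_subring E by apply: (hom_img_sr Dsr chD).
have E'sr : is_subring E' by apply: (hom_img_sr Vsr chV).
have [|||p [Ep [k np] mp]] := @resalg_trans _ W Wv E E' (T 'X) Esr E'sr _ _ _ WX raX.
- by move=> _ [a Da ->]; exists a => //; apply: DV.
- by move=> _ [a Va ->].
- move=> _ [a Va ->]; have [p [Dp [k np] mp]] := all_ra a Va.
  exists (pmap (@cst K) p); split; first exact: (pmap_pol Dsr chD).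
    by exists k; rewrite (coef_pmap Dsr chD); apply/Vm.
  move/Vm: mp; rewrite horner_coef horner_poly.
  rewrite (hom_sum Vsr chV) => [|l]; last first.
    by apply: srM => //; [exact: DV|exact: srX].
  have cX n : cst (a ^+ n) = cst a ^+ n.
    by elim: n => [|n IH]; rewrite ?expr0 ?cst1 // !exprS cstM IH.
  by under eq_bigr do rewrite cstM cX.
have [q Dq Eq] := pmap_lift Dsr chD Ep.
apply: np; rewrite Eq (coef_pmap Dsr chD).
by apply: PW; apply: Xtr => //; move: mp; rewrite Eq horner_cst.
Qed.

End PolyExt.

(** * Triviality of w *)

Section Spans.
Variable K : fieldType.
Implicit Types (D A I : pset K) (s : seq K).

Lemma fspan_mem D s i : is_subring D -> (i < size s)%N -> fspan D s s`_i.
Proof.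
move=> Dsr lt; exists (mkseq (fun j => (j == i)%:R) (size s)); rewrite size_mkseq; split=> //.
  by move=> j ltj; rewrite nth_mkseq //; case: (j == i); [exact: sr1|exact: sr0].
rewrite (bigD1 (Ordinal lt)) //= nth_mkseq // eqxx mul1r big1 ?addr0 // => j /eqP nj.
rewrite nth_mkseq // [nat_of_ord j == i]negbTE ?mul0r //.
by apply/eqP => E; apply: nj; apply: val_inj.
Qed.

Lemma fspanP D s x : is_subring D ->
  fspan D s x <-> exists2 c : nat -> K, (forall i, D (c i)) & x = \sum_(i < size s) c i * s`_i.
Proof.
move=> Dsr; split=> [[c [sc Dc ->]]|[c Dc ->]].
  exists (fun i => c`_i) => // i; have [lt|ge] := ltnP i (size c).
    by apply: Dc; move: lt; rewrite sc.
  by rewrite nth_default //; exact: sr0.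
exists (mkseq c (size s)); rewrite size_mkseq; split=> // [i lt|].
  by rewrite nth_mkseq.
by apply: eq_bigr => i _; rewrite nth_mkseq.
Qed.

Lemma fspan_ideal D s : is_subring D -> subs (fspan D s) D -> ideal_of D (fspan D s).
Proof.
move=> Dsr sD; split=> //.
- apply/fspanP => //; exists (fun=> 0) => [_|]; first exact: sr0.
  by rewrite big1 // => i _; rewrite mul0r.
- move=> x y /(fspanP _ _ Dsr) [c Dc ->] /(fspanP _ _ Dsr) [d Dd ->].
  apply/fspanP => //; exists (fun i => c i + d i) => [i|]; first exact: srD.
  by rewrite -big_split; apply: eq_bigr => i _; rewrite mulrDl.
- move=> r x Dr /(fspanP _ _ Dsr) [c Dc ->]; apply/fspanP => //.
  exists (fun i => r * c i) => [i|]; first exact: srM.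
  by rewrite mulr_sumr; apply: eq_bigr => i _; rewrite mulrA.
Qed.

Lemma fspan_sub D I s : is_subring D -> ideal_of D I ->
  (forall i, (i < size s)%N -> I s`_i) -> subs (fspan D s) I.
Proof.
move=> Dsr Iid Hs x /(fspanP _ _ Dsr) [c Dc ->].
by apply: (id_sum Iid) => i _; apply: (idMl Iid) => //; apply: Hs.
Qed.

Lemma v_full_inv D A x : pseteq (v_of D A) D -> D 1 -> (forall a, A a -> D (x * a)) -> D x.
Proof. by move=> [_ /(_ 1)] H D1 Hx; have := H D1 x Hx; rewrite mul1r. Qed.

Definition w_trivial D := forall s, subs (fspan D s) D -> nonzero (fspan D s) ->
  pseteq (v_of D (fspan D s)) D -> fspan D s 1.

Definition star_trivial D (star : pset K -> pset K) :=
  forall I, ideal_of D I -> pseteq (star I) I.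

Lemma w_trivial_star D : is_subring D -> w_trivial D -> star_trivial D (w_of D).
Proof.
move=> Dsr wt I Iid; split=> [x [s [sD nz sv H]]|x Ix].
  by apply: H; exists 1; rewrite mulr1; split=> //; apply: wt.
have D1 y : fspan D [:: 1] y <-> D y.
  rewrite fspanP //; split=> [[c Dc ->]|Dy]; first by rewrite big_ord1 mulr1.
  by exists (fun=> y) => //; rewrite big_ord1 mulr1.
exists [:: 1]; split.
- by move=> y /D1.
- by exists 1; split; [apply/D1; exact: sr1|exact: oner_neq0].
- split=> y.
    move=> H; rewrite -[y]mulr1; apply: H => a /D1 Da.
    by rewrite mul1r.
  move=> Dy b Hb; have /Hb : fspan D [:: 1] 1 by apply/D1; exact: sr1.
  by rewrite mulr1 => Db; apply: srM.
- by move=> _ [j [/D1 Dj ->]]; apply: (idMr Iid).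
Qed.

Lemma star_primeP D star P : star_trivial D star -> star_prime D star P <-> prime_of D P.
Proof. by move=> st; split=> [[]//|Ppr]; split=> //; apply: st; case: Ppr. Qed.

End Spans.

Lemma starX_trivial (K : fieldType) (D : pset K) (star : pset K -> pset K) :
  is_subring D -> star_trivial D star ->
  star_trivial (polyext D) (starX D star).
Proof.
move=> Dsr st E Eid; have DXsr := polyext_sr Dsr; split=> [F [s [Ds Hs HE]]|F EF]; last first.
  exists 1; rewrite size_poly1; split.
  - by move=> i _; rewrite coef1; case: (i == _); [exact: sr1|exact: sr0].
  - by move=> Q [Qpr _]; exists 0%N => //; rewrite coef1; exact: pr1 Qpr.
  - by move=> [|//] _; rewrite coef1 mul1r.
have sD : subs (fspan (polyext D) s) (polyext D).
  move=> y /(fspanP _ _ DXsr) [c Dc ->].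
  by apply: sr_sum => // i _; apply: srM => //; apply: Ds.
case: (pselect (fspan (polyext D) s 1)) => [/(fspanP _ _ DXsr) [c Dc E1]|n1].
  rewrite -[F]mul1r E1 mulr_suml; apply: (id_sum Eid) => i _.
  by rewrite -mulrA; apply: (idMl Eid) => //; apply: HE.
have [Q [Qpr IQ]] := exists_prime_above DXsr (fspan_ideal DXsr sD) n1.
have [|i lt []] := Hs Q; last by apply: IQ; apply: fspan_mem.
split=> //; right; split.
- move=> x [t [tQ tnz]].
  have tD : subs (fspan D t) D by move=> y /tQ [].
  by case: (st _ (fspan_ideal Dsr tD)) => H _ /H /tD.
- move=> /(_ 1 (sr1 Dsr)) [t [tQ tnz]].
  have tD : subs (fspan D t) D by move=> y /tQ [].
  case: (st _ (fspan_ideal Dsr tD)) => H _ /H /tQ [_].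
  by rewrite cst1; exact: pr1 Qpr.
Qed.

Section Uppers.
Variable K : fieldType.
Local Notation T := (@FracField.tofrac {poly K}).
Implicit Types (D M : pset K).

Lemma polyPrime_coefs D (Q : {poly K} -> Prop) (f : {poly K}) : is_subring D -> polyPrime D Q ->
  (forall i, Q (f`_i)%:P) -> Q f.
Proof.
move=> Dsr [QD Q0 QA QM _] H; rewrite -[f]coefK poly_def.
elim/big_ind: _ => // i _; rewrite -mul_polyC mulrC.
by apply: QM => //; apply: polXn.
Qed.

(* If [s] spans an ideal [J] with [J^-1 = D] inside [M], then the generic element [f] of [J[X]] is
   divisible by no [g] outside [M[X]] after multiplication by powers of all the generators. *)
Lemma v_full_upper D s M : is_subring D -> subs (fspan D s) D -> nonzero (fspan D s) ->
  pseteq (v_of D (fspan D s)) D -> prime_of D M -> subs (fspan D s) M ->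
  exists (Q : {poly K} -> Prop) (f : {poly K}) i, [/\ polyPrime D Q, forall g, Q g -> pol M g, Q f,
    pol (fspan D s) f & ~ Q (f`_i)%:P].
Proof.
move=> Dsr sD snz sv Mpr sM; have D0 := sr0 Dsr; have Mid := pr_id Mpr; have M0 := id0 Mid.
have DXsr := polyext_sr Dsr.
pose f := \poly_(i < size s) s`_i.
have cf i : (i < size s)%N -> f`_i = s`_i by move=> lt; rewrite coef_poly lt.
have Jf : pol (fspan D s) f.
  move=> i; rewrite coef_poly; case: ifP => lt; first exact: fspan_mem.
  exact: id0 (fspan_ideal Dsr sD).
have Df : pol D f by apply: pol_mono Jf.
have Ds i : (i < size s)%N -> D s`_i by move=> lt; apply: sD; apply: fspan_mem.
have full z : (forall j, (j < size s)%N -> polyext D (cst s`_j * z)) -> polyext D z.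
  move=> Hz; have [j lt sj0] : exists2 j, (j < size s)%N & s`_j != 0.
    case: snz => x [/(fspanP _ _ Dsr) [c _ Ex] x0].
    apply: contrapT => no; move/eqP: x0; apply; rewrite Ex big1 // => i _.
    have [->|si0] := eqVneq s`_i 0; first by rewrite mulr0.
    by case: no; exists i.
  have [p Dp Ep] := proj1 (polyextE _ D0) (Hz j lt).
  have Ez : z = T ((s`_j)^-1 *: p).
    by rewrite -mul_polyC tofracM -/(cst _) -Ep cstV mulKf // cst_eq0.
  rewrite Ez; apply/polyext_T => // l.
  apply: (v_full_inv sv (sr1 Dsr)) => a /(fspanP _ _ Dsr) [c Dc ->].
  rewrite mulr_sumr; apply: sr_sum => // i _; rewrite mulrCA; apply: srM => //.
  have := Hz i (ltn_ord i); rewrite Ez /cst -tofracM polyext_T // => /(_ l).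
  by rewrite coefCM mulrC.
have [i [lt noi]] : exists i, (i < size s)%N /\
    forall k g, pol D g -> ~ pol M g -> ~ exists2 h, pol D h & g * (s`_i)%:P ^+ k = f * h.
  apply: contrapT => no.
  have H i : (i < size s)%N -> exists k g, [/\ pol D g, ~ pol M g &
      exists2 h, pol D h & g * (s`_i)%:P ^+ k = f * h].
    move=> lt; apply: contrapT => noi; apply: no; exists i; split=> // k g Dg ng Hh.
    by apply: noi; exists k, g.
  have [g [N [Dg ng HN]]] : exists g (N : nat -> nat), [/\ pol D g, ~ pol M g &
      forall i, (i < size s)%N -> exists2 h, pol D h & g * (s`_i)%:P ^+ (N i) = f * h].
    suff: forall n, (n <= size s)%N -> exists g (N : nat -> nat), [/\ pol D g, ~ pol M g &
        forall i, (i < n)%N -> exists2 h, pol D h & g * (s`_i)%:P ^+ (N i) = f * h].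
      by move=> /(_ _ (leqnn _)).
    elim=> [|n IH] ln.
      exists 1, (fun=> 0%N); split=> //; first exact: pol1.
      by move=> /(_ 0%N); rewrite coef1; exact: pr1 Mpr.
    have [g [N [Dg ng HN]]] := IH (ltnW ln).
    have [k [g' [Dg' ng' [h' Dh' Eh']]]] := H n ln.
    exists (g * g'), (fun i => if i == n then k else N i); split.
    - exact: polM.
    - by case/(pol_prime Dsr Mpr Dg Dg').
    - move=> i; rewrite ltnS leq_eqVlt => /orP [/eqP ->|lin].
        by rewrite eqxx; exists (g * h'); [exact: polM|rewrite -mulrA Eh'; ring].
      rewrite ltn_eqF //; have [h Dh Eh] := HN i lin.
      by exists (g' * h); [exact: polM|rewrite mulrAC Eh; ring].
  have f0 : T f != 0.
    rewrite tofrac_eq0; apply/eqP => f0; case: snz => x [/(fspanP _ _ Dsr) [c _ Ex]].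
    by rewrite Ex big1 ?eqxx // => i _; rewrite -cf // f0 coef0 mulr0.
  have key n (N' : nat -> nat) z : (\sum_(i < size s) N' i <= n)%N ->
      (forall i, (i < size s)%N -> polyext D (cst s`_i ^+ N' i * z)) -> polyext D z.
    elim: n N' z => [|n IH] N' z le Hz.
      have [s0|s0] := posnP (size s).
        by apply: full => j; rewrite s0.
      have := Hz 0%N s0; move: le; rewrite (bigD1 (Ordinal s0)) //= leqn0 addn_eq0 => /andP [/eqP -> _].
      by rewrite expr0 mul1r.
    apply: full => j ltj.
    case EN : (N' j) => [|m].
      apply: (srM DXsr); first by apply/polyext_cst => //; apply: Ds.
      by have := Hz j ltj; rewrite EN expr0 mul1r.
    apply: (IH (fun i => if i == j then m else N' i)).
      move: le; rewrite (bigD1 (Ordinal ltj)) //= EN [X in _ -> (X <= n)%N](bigD1 (Ordinal ltj)) //= eqxx.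
      rewrite addSn ltnS; set A := (\sum_(_ < _ | _) _)%N; set B := (\sum_(_ < _ | _) _)%N.
      suff -> : B = A by [].
      apply: eq_bigr => k /eqP nk; rewrite ifF //; apply/eqP => E; apply: nk; exact: val_inj.
    move=> i lti; case: eqP => [->|_].
      by rewrite mulrA -exprSr -EN; apply: Hz.
    rewrite mulrCA; apply: (srM DXsr); first by apply/polyext_cst => //; apply: Ds.
    exact: Hz.
  have : polyext D (T g / T f).
    apply: (key _ N) => // i lti; have [h Dh Eh] := HN i lti.
    have -> : cst s`_i ^+ N i * (T g / T f) = T h.
      apply: (mulIf f0); rewrite mulrA divfK // mulrC -tofracXn -tofracM Eh tofracM mulrC //.
    exact/polyext_T.
  move=> /(polyextE _ D0) [h Dh Eh]; apply: ng.
  have -> : g = h * f by apply: tofrac_inj; rewrite tofracM -Eh divfK.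
  by apply: (ipolM Mid) => //; apply: pol_mono Jf.
pose I z := exists2 h, pol D h & z = T (f * h).
pose S z := exists k g, [/\ pol D g, ~ pol M g & z = T (g * (s`_i)%:P ^+ k)].
have Dsi : pol D (s`_i)%:P by apply: polC => //; apply: Ds.
have n1 : ~ pol M 1 by move=> /(_ 0%N); rewrite coef1; exact: pr1 Mpr.
have [|||||Q [Qpr IQ SQ]] := @prime_avoiding _ (polyext D) I S DXsr.
- split.
  + by move=> _ [h Dh ->]; apply/polyext_T => //; apply: polM.
  + by exists 0; [exact: pol0|rewrite mulr0 tofrac0].
  + by move=> _ _ [h Dh ->] [h' Dh' ->]; exists (h + h'); [exact: polD|rewrite mulrDr tofracD].
  + move=> _ _ /(polyextE _ D0) [r Dr ->] [h Dh ->]; exists (r * h); first exact: polM.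
    by rewrite -tofracM mulrCA.
- by exists 0%N, 1; rewrite expr0 mulr1 tofrac1; split=> //; exact: pol1.
- move=> _ _ [k [g [Dg ng ->]]] [l [h [Dh nh ->]]]; exists (k + l)%N, (g * h); split.
  + exact: polM.
  + by case/(pol_prime Dsr Mpr Dg Dh).
  + by rewrite -tofracM exprD; congr T; move: (_ ^+ k) (_ ^+ l) => u v; ring.
- move=> _ [k [g [Dg ng ->]]]; apply/polyext_T => //; apply: polM => //; exact: pol_exp.
- by move=> _ [k [g [Dg ng ->]]] [h Dh /tofrac_inj E]; apply: (noi k g Dg ng); exists h.
have QP := polyPrime_of Dsr Qpr; have [QD _ _ _ _] := QP.
exists (fun g => Q (T g)), f, i; split=> //.
- move=> g Qg; apply: contrapT => ng; apply: (SQ (T g)) => //.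
  by exists 0%N, g; rewrite expr0 mulr1; split=> //; exact: QD.
- by apply: IQ; exists 1; [exact: pol1|rewrite mulr1].
- rewrite cf // => Qs; apply: (SQ _ _ Qs); exists 1%N, 1; rewrite expr1 mul1r; split=> //.
  exact: pol1.
Qed.

Lemma quasi_PruferP D : is_subring D -> quasi_Prufer D <->
  forall M Q, prime_of D M -> polyPrime D Q -> (forall g, Q g -> pol M g) ->
    forall (f : {poly K}) i, Q f -> Q (f`_i)%:P.
Proof.
move=> Dsr; have D0 := sr0 Dsr; split=> [qp M Q Mpr Qpr QM f i Qf|H P Q Ppr Qpr QP].
  have [QD Q0 _ _ _] := Qpr.
  have [|H _] := qp _ _ Mpr (prime_of_polyPrime Dsr Qpr).
    move=> _ [g Qg ->]; apply/polyext_T; last exact: QM.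
    exact: id0 (pr_id Mpr).
  have cD0 : contract D (fun F => exists2 f, Q f & F = T f) 0.
    by split=> //; exists 0; rewrite // cst0 tofrac0.
  have /(polyext_T _ cD0) /(_ i) [_ [g Qg]] := H _ (ex_intro2 _ _ f Qf erefl).
  by rewrite /cst => /tofrac_inj ->.
have Qpp := polyPrime_of Dsr Qpr; have [QD Q0 _ _ _] := Qpp.
have cD0 : contract D Q 0 by split=> //; rewrite cst0; exact: id0 (pr_id Qpr).
split=> F QF.
  have [f Df Ef] := proj1 (polyextE _ D0) (idS (pr_id Qpr) QF).
  rewrite Ef in QF *; apply/polyext_T => // i; split; first exact: Df.
  apply: (H P (fun g => Q (T g)) Ppr Qpp _ f i QF) => g /QP.
  by rewrite polyext_T //; exact: id0 (pr_id Ppr).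
have [f Df ->] := proj1 (polyextE _ cD0) QF.
by apply: (polyPrime_coefs Dsr Qpp) => i; have [] := Df i.
Qed.

Lemma quasi_Prufer_w_trivial D : is_subring D -> quasi_Prufer D -> w_trivial D.
Proof.
move=> Dsr /(quasi_PruferP Dsr) qp s sD snz sv; apply: contrapT => n1.
have [M [Mpr sM]] := exists_prime_above Dsr (fspan_ideal Dsr sD) n1.
have [Q [f [i [Qpr QM Qf _ nQ]]]] := v_full_upper Dsr sD snz sv Mpr sM.
exact: nQ (qp _ _ Mpr Qpr QM f i Qf).
Qed.

Lemma not_quasi_Prufer D : is_subring D -> ~ quasi_Prufer D ->
  exists V u, [/\ valr V, subs D V, V u, ~ resalg V D u & exists a, [/\ D a, a != 0 & vmax V a]].
Proof.
move=> Dsr nqp; apply: contrapT => no; apply: nqp; apply/quasi_PruferP => //.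
move=> M Q Mpr Qpr QM f i Qf; apply: contrapT => nQ.
have [V [u [Vv DV Vu Vm nr]]] := residually_transcendental Dsr Mpr Qpr QM Qf nQ.
apply: no; exists V, u; split=> //.
have [QD Q0 _ _ _] := Qpr; have Df := QD _ Qf.
exists f`_i; split=> //.
  by apply/eqP => f0; apply: nQ; rewrite f0.
by apply/Vm => //; exact: QM.
Qed.

Lemma quasi_Prufer_resalg_fracs D (L : fieldType) (phi : K -> L) V : is_subring D ->
  quasi_Prufer D -> hom_on D phi -> valr V -> subs (hom_img D phi) V -> resalg_fracs V (hom_img D phi).
Proof.
move=> Dsr /(quasi_PruferP Dsr) qp hphi Vv DV z Vz [_ [_ [[a Da ->] [b Db ->] b0 Ez]]].
have [Vsr _] := Vv.
apply: contrapT => nr.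
pose Q f := pol D f /\ (pmap phi f).[z] = 0.
have Qpr : polyPrime D Q.
  split.
  - by move=> f [].
  - split; first exact: pol0.
    by rewrite (pmapC Dsr hphi) (hom0 Dsr hphi) hornerC.
  - move=> f g [Df fz] [Dg gz]; split; first exact: polD.
    by rewrite (pmapD Dsr hphi) // hornerD fz gz addr0.
  - move=> f g Df [Dg gz]; split; first exact: polM.
    by rewrite (pmapM Dsr hphi) // hornerM gz mulr0.
  - split.
      move=> [_]; rewrite (pmapC Dsr hphi) (hom1 hphi) hornerC => /eqP.
      by rewrite oner_eq0.
    move=> f g Df Dg [_]; rewrite (pmapM Dsr hphi) // hornerM => /eqP.
    by rewrite mulf_eq0 => /orP [/eqP E|/eqP E]; [left|right].
pose M d := D d /\ vmax V (phi d).
have imD d : D d -> V (phi d) by move=> Dd; apply: DV; exists d.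
have mid := vmax_ideal Vv.
have Mpr : prime_of D M.
  apply: primeI => //.
  - split.
    + by move=> d [].
    + by split; [exact: sr0|rewrite (hom0 Dsr hphi); exact: vmax0].
    + move=> d e [Dd md] [De me]; split; first exact: srD.
      by rewrite (homD Dsr hphi) //; apply: (idD mid).
    + move=> d e Dd [De me]; split; first exact: srM.
      by rewrite (homM hphi) //; apply: (idMl mid) => //; apply: imD.
  - by move=> [_]; rewrite (hom1 hphi); exact: vmax1.
  - move=> d e Dd De [_]; rewrite (homM hphi) //.
    by case/(prM (vmax_prime Vv) (imD _ Dd) (imD _ De)) => m; [left|right].
have QM g : Q g -> pol M g.
  move=> [Dg gz] i; split; first exact: Dg.
  apply: contrapT => ni; apply: nr; exists (pmap phi g); split.
  - exact: (pmap_pol Dsr hphi).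
  - by exists i; rewrite (coef_pmap Dsr hphi).
  - by rewrite gz; exact: vmax0.
have Qba : Q (b *: 'X - a%:P).
  have DbX : pol D (b%:P * 'X) by apply: polM => //; [exact: polC|exact: polX].
  rewrite -mul_polyC; split; first by apply: polB => //; exact: polC.
  rewrite (pmapB Dsr hphi) //; last exact: polC.
  rewrite (pmapM Dsr hphi); [|exact: polC|exact: polX].
  by rewrite !(pmapC Dsr hphi) (pmapX Dsr hphi) !hornerE Ez mulrC divfK // subrr.
have [_] := qp M Q Mpr Qpr QM _ 1%N Qba.
rewrite coefB coefZ coefX coefC mulr1 subr0 (pmapC Dsr hphi) hornerC => /eqP.
by rewrite (negbTE b0).
Qed.

Lemma quasi_Prufer_overring D T' : is_subring D -> is_frac_field_of D ->
  quasi_Prufer D -> overring D T' -> quasi_Prufer T'.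
Proof.
move=> Dsr Dfr qp [Tsr DT]; apply: contrapT => nqp.
have [V [u [Vv TV Vu nr _]]] := not_quasi_Prufer Tsr nqp.
have hid : hom_on D id by split.
have imD : subs (hom_img D id) D by move=> _ [x Dx ->].
have [||p [Dp ni mp]] := quasi_Prufer_resalg_fracs Dsr qp hid Vv _ Vu.
- by move=> y /imD /DT /TV.
- have [a [b [Da Db b0 ->]]] := Dfr u; exists a, b; split=> //; [by exists a|by exists b].
- by apply: nr; exists p; split=> //; apply: pol_mono Dp => y /imD /DT.
Qed.

End Uppers.

(** * Quasi-Prüfer domains are stably strong S *)

Section StrongS.
Variables (F : fieldType) (R P1 P2 : pset F).
Local Notation T := (@FracField.tofrac {poly F}).
Hypotheses (Rsr : is_subring R) (P1pr : prime_of R P1) (P2pr : prime_of R P2).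
Hypotheses (P12 : strict_subs P1 P2)
  (adjP : forall Q, prime_of R Q -> strict_subs P1 Q -> ~ strict_subs Q P2).
Hypothesis fgR : forall (L : fieldType) (phi : F -> L), hom_on R phi ->
  exists D xs, [/\ is_subring D, forall V, valr V -> subs D V -> resalg_fracs V D &
    pseteq (hom_img R phi) (adjs D xs)].

Lemma no_prime_between Q : prime_of (polyext R) Q ->
  strict_subs (polyext P1) Q -> ~ strict_subs Q (polyext P2).
Proof.
move=> Qpr [P1Q nQP1] [QP2 nP2Q].
have R0 := sr0 Rsr; have P1id := pr_id P1pr; have P2id := pr_id P2pr.
have P10 := id0 P1id; have P20 := id0 P2id.
have Qpp := polyPrime_of Rsr Qpr; have [QR Q0 QA QM [Q1 Qm]] := Qpp.
have [P1P2 nP2P1] := P12.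
have QP1 r : R r -> Q (cst r) -> P1 r.
  pose C r := R r /\ Q (cst r).
  have Cpr : prime_of R C.
    apply: primeI => //.
    - split.
      + by move=> x [].
      + by split=> //; rewrite /cst polyC0.
      + move=> x y [Rx Qx] [Ry Qy]; split; first exact: srD.
        by rewrite /cst polyCD; apply: QA.
      + move=> x y Rx [Ry Qy]; split; first exact: srM.
        by rewrite /cst polyCM; apply: QM => //; apply: polC.
    - by move=> [_]; rewrite /cst.
    - move=> x y Rx Ry [_]; rewrite /cst polyCM => /(Qm _ _ (polC Rsr Rx) (polC Rsr Ry)).
      by case=> H; [left|right].
  have P1C : subs P1 C.
    move=> x Px; split; first exact: (idS P1id).
    by apply: P1Q; apply/polyext_cst.
  have CP2 : subs C P2 by move=> x [_ /QP2 /(polyext_cst _ P20)].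
  move=> Rr Qr; apply: contrapT => nP; apply: (adjP Cpr).
    by split=> // /(_ r (conj Rr Qr)).
  split=> // P2C; apply: nP2Q => _ /(polyextE _ P20) [f Pf ->].
  by apply: (polyPrime_coefs Rsr Qpp) => i; have [] := P2C _ (Pf i).
have [f [i [Qf nPf]]] : exists (f : {poly F}) i, Q (T f) /\ ~ P1 f`_i.
  apply: contrapT => no; apply: nQP1 => G QG.
  have [f Rf Ef] := proj1 (polyextE _ R0) (idS (pr_id Qpr) QG).
  rewrite Ef in QG *; apply/polyext_T => // i.
  by apply: contrapT => ni; apply: no; exists f, i.
have Rf := QR _ Qf.
have [L [phi [hphi ker fr]]] := quotient_field Rsr P1pr.
have [D [xs [Dsr Dg [BA AB]]]] := fgR hphi.
pose B := hom_img R phi.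
have Bsr : is_subring B by apply: (hom_img_sr Rsr hphi).
pose P y := exists2 r, P2 r & y = phi r.
have kerB r r' : R r -> R r' -> phi r = phi r' -> P1 (r - r').
  move=> Rr Rr' E; apply/ker; first exact: srB.
  by rewrite (homB hphi) // E subrr.
have PP2 r : R r -> P (phi r) -> P2 r.
  move=> Rr [r' P2r' E]; have Rr' := idS P2id P2r'.
  rewrite -[r](subrK r'); apply: (idD P2id) => //; apply: P1P2; exact: kerB.
have Ppr : prime_of B P.
  apply: primeI => //.
  - split.
    + by move=> _ [r Pr ->]; exists r => //; apply: (idS P2id).
    + by exists 0 => //; rewrite (hom0 Rsr hphi).
    + move=> _ _ [r Pr ->] [s Ps ->]; exists (r + s); first exact: (idD P2id).
      by rewrite (homD Rsr hphi) //; apply: (idS P2id).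
    + move=> _ _ [r Rr ->] [s Ps ->]; exists (r * s); first exact: (idMl P2id).
      by rewrite (homM hphi) //; apply: (idS P2id).
  - by rewrite -(hom1 hphi) => /(PP2 _ (sr1 Rsr)); exact: pr1 P2pr.
  - move=> _ _ [r Rr ->] [s Rs ->]; rewrite -(homM hphi) // => /(PP2 _ (srM Rsr Rr Rs)).
    by case/(prM P2pr Rr Rs) => H; [left; exists r|right; exists s].
pose Q' g := exists f, [/\ pol R f, Q (T f) & g = pmap phi f].
have Q'Q h : pol R h -> Q' (pmap phi h) -> Q (T h).
  move=> Rh [h' [Rh' Qh' E]]; rewrite -[h](subrK h') ; apply: QA => //.
  apply: P1Q; apply/polyext_T => // k; rewrite coefB; apply: kerB => //.
  by rewrite -!(coef_pmap Rsr hphi) E.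
have Q'pr : polyPrime B Q'.
  split.
  - by move=> _ [h [Rh _ ->]]; apply: (pmap_pol Rsr hphi).
  - by exists 0; rewrite (pmapC Rsr hphi) (hom0 Rsr hphi); split=> //; exact: pol0.
  - move=> _ _ [g [Rg Qg ->]] [h [Rh Qh ->]]; exists (g + h).
    by rewrite (pmapD Rsr hphi) //; split=> //; [exact: polD|exact: QA].
  - move=> g' _ /(pmap_lift Rsr hphi) [g Rg ->] [h [Rh Qh ->]]; exists (g * h).
    by rewrite (pmapM Rsr hphi) //; split=> //; [exact: polM|exact: QM].
  - split.
      rewrite -[1]/(1%:P) -(hom1 hphi) -(pmapC Rsr hphi) => /(Q'Q _ (pol1 Rsr)).
      exact: Q1.
    move=> g' h' /(pmap_lift Rsr hphi) [g Rg ->] /(pmap_lift Rsr hphi) [h Rh ->].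
    rewrite -(pmapM Rsr hphi) // => /(Q'Q _ (polM Rsr Rg Rh)) /(Qm _ _ Rg Rh).
    by case=> H; [left; exists g|right; exists h].
have Q'P g : Q' g -> pol P g.
  move=> [h [Rh Qh ->]] k; rewrite (coef_pmap Rsr hphi); exists h`_k => //.
  by have /(polyext_T _ P20) := QP2 _ Qh; apply.
have Q'f : Q' (pmap phi f) by exists f.
have nQ'f : ~ Q' ((pmap phi f)`_i)%:P.
  rewrite (coef_pmap Rsr hphi) -(pmapC Rsr hphi) => /(Q'Q _ (polC Rsr (Rf i))) H.
  by apply: nPf; apply: QP1.
have [V [u [Vv BV Vu Vm nr]]] := residually_transcendental Bsr Ppr Q'pr Q'P Q'f nQ'f.
apply: nr; have BA' : subs B (adjs D xs) := BA.
apply: (resalg_mono AB).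
have DB : subs D B by move=> y Dy; apply: AB; apply: adjs_sub.
apply: (height1_residually_algebraic Vv) => //.
- by apply: Dg => // y /DB /BV.
- by move=> y /AB /BV.
- move=> q qpr [z [qz z0]] qV y Ay my; have qid := pr_id qpr.
  have Aphi r : R r -> adjs D xs (phi r) by move=> Rr; apply: BA; exists r.
  pose C r := R r /\ q (phi r).
  have Cpr : prime_of R C.
    apply: primeI => //.
    - split.
      + by move=> r [].
      + by split=> //; rewrite (hom0 Rsr hphi); exact: (id0 qid).
      + move=> r s [Rr qr] [Rs qs]; split; first exact: srD.
        by rewrite (homD Rsr hphi) //; apply: (idD qid).
      + move=> r s Rr [Rs qs]; split; first exact: srM.
        by rewrite (homM hphi) //; apply: (idMl qid) => //; apply: Aphi.
    - by move=> [_]; rewrite (hom1 hphi); exact: pr1 qpr.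
    - move=> r s Rr Rs [_]; rewrite (homM hphi) // => /(prM qpr (Aphi _ Rr) (Aphi _ Rs)).
      by case=> H; [left|right].
  have [r Rr Er] := AB _ Ay.
  have Pr : P2 r.
    by apply: PP2 => //; rewrite -Er; apply/Vm => //; exact: AB.
  apply: contrapT => nq; apply: (adjP Cpr).
    split.
      move=> t P1t; have Rt := idS P1id P1t; split=> //.
      by rewrite (proj2 (ker _ Rt) P1t); exact: (id0 qid).
    move=> CP1; have [t Rt Et] := AB _ (idS qid qz).
    move/eqP: z0; apply; rewrite Et; apply/ker => //; apply: CP1; split=> //.
    by rewrite -Et.
  split; last by move=> /(_ r Pr) [_]; rewrite -Er.
  move=> t [Rt qt]; apply: PP2 => //; apply/Vm; first by exists t.
  exact: qV.
- have [r [P2r nP1r]] : exists r, P2 r /\ ~ P1 r.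
    apply: contrapT => no; apply: nP2P1 => r P2r; apply: contrapT => nr.
    by apply: no; exists r.
  have Rr := idS P2id P2r; exists (phi r); split.
  + by apply: BA; exists r.
  + by apply/eqP => /(ker _ Rr).
  + by apply/Vm; [exists r|exists r].
- by apply: fracs_mono (fr u).
Qed.
End StrongS.

Lemma iter_domain (d : sdom) n : is_subring (@sdomain d) -> star_trivial (@sdomain d) (@sop d) ->
  is_subring (@sdomain (iter n sstep d)) /\
  star_trivial (@sdomain (iter n sstep d)) (@sop (iter n sstep d)).
Proof.
move=> dsr dst; elim: n => [//|n [IHsr IHst]] /=.
by split; [exact: polyext_sr|exact: starX_trivial].
Qed.

Lemma iter_hom_img (d : sdom) n (L : fieldType) (phi : sfld (iter n sstep d) -> L) :
  is_subring (@sdomain d) -> star_trivial (@sdomain d) (@sop d) ->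
  hom_on (@sdomain (iter n sstep d)) phi ->
  exists (psi : sfld d -> L) xs, hom_on (@sdomain d) psi /\
    pseteq (hom_img (@sdomain (iter n sstep d)) phi) (adjs (hom_img (@sdomain d) psi) xs).
Proof.
move=> dsr dst; elim: n phi => [|n IH] phi hphi; first by exists phi, [::]; split=> //; split=> x.
have [Asr _] := iter_domain n dsr dst.
move: phi hphi IH; rewrite /=; move: Asr; set e := iter n sstep d.
set A := @sdomain e => Asr phi hphi IH; have A0 := sr0 Asr.
have Acst a : A a -> polyext A (cst a) by move=> Aa; apply/polyext_cst.
have hpsi : hom_on A (phi \o @cst (sfld e)).
  split=> [|x y Ax Ay|x y Ax Ay] /=.
  - by rewrite cst1 (hom1 hphi).
  - by rewrite cstB (homB hphi) //; apply: Acst.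
  - by rewrite cstM (homM hphi) //; apply: Acst.
have [psi [xs [hps [E1 E2]]]] := IH _ hpsi.
pose X : KX (sfld e) := FracField.tofrac 'X.
have AX : polyext A X by apply/polyext_T => //; exact: polX.
have DXsr := polyext_sr Asr.
have phiX k : phi (X ^+ k) = phi X ^+ k.
  elim: k => [|k IHk]; first by rewrite !expr0 (hom1 hphi).
  by rewrite !exprS (homM hphi) ?IHk //; apply: srX.
have phiT (p : {poly sfld e}) : pol A p ->
    phi (FracField.tofrac p) = (pmap (phi \o @cst (sfld e)) p).[phi X].
  move=> Ap; rewrite horner_poly -[in LHS](coefK p) poly_def rmorph_sum /=.
  rewrite (hom_sum DXsr hphi) => [|i].
    apply: eq_bigr => i _; rewrite -mul_polyC tofracM tofracXn (homM hphi) ?phiX //.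
      exact: Acst.
    exact: srX.
  by apply/polyext_T => //; apply: polZ => //; exact: polXn.
exists psi, (phi X :: xs); split=> //; split=> y /=.
  move=> [_ /(polyextE _ A0) [p Ap ->] ->]; rewrite (phiT _ Ap).
  exists (pmap (phi \o @cst (sfld e)) p) => // i; apply: E1.
  exact: (pmap_pol Asr hpsi).
move=> [p Bp ->].
have /(pmap_lift Asr hpsi) [f Af ->] : pol (hom_img A (phi \o @cst (sfld e))) p.
  by move=> i; apply: E2.
by exists (FracField.tofrac f); [apply/polyext_T|rewrite (phiT _ Af)].
Qed.

Lemma quasi_Prufer_stably_strongS (K : fieldType) (D : pset K) :
  is_subring D -> quasi_Prufer D -> w_stably_strongS D.
Proof.
move=> Dsr qp n.
have wt := w_trivial_star Dsr (quasi_Prufer_w_trivial Dsr qp).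
set d := SDom D (w_of D).
have [Rsr Rst] := @iter_domain d n Dsr wt.
have fg := fun L phi => @iter_hom_img d n L phi Dsr wt.
move: Rsr Rst fg; move: (iter n sstep d) => e Rsr Rst fg P1 P2.
move=> [/(star_primeP _ Rst) P1pr /(star_primeP _ Rst) P2pr P12 adjP].
have st' := starX_trivial Rsr Rst.
have P10 := id0 (pr_id P1pr); have P20 := id0 (pr_id P2pr).
split.
- by apply/star_primeP => //; apply: polyext_prime.
- by apply/star_primeP => //; apply: polyext_prime.
- have [P1P2 nP] := P12; split.
    by move=> _ /(polyextE _ P10) [p Pp ->]; apply/polyext_T => // i; apply: P1P2.
  move=> H; apply: nP => x /(polyext_cst _ P20) /H.
  by move/(polyext_cst _ P10).
- move=> Q /(star_primeP _ st') Qpr; apply: (@no_prime_between _ (@sdomain e)) => //.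
    by move=> C Cpr; apply: adjP; apply/star_primeP.
  move=> L phi hphi; have [psi [xs [hpsi E]]] := fg L phi hphi.
  exists (hom_img D psi), xs; split=> //; first exact: (hom_img_sr Dsr hpsi).
  by move=> V Vv DV; apply: quasi_Prufer_resalg_fracs.
Qed.

(** * Quasi-Prüfer domains are UMt *)

Section UMtFromQuasiPrufer.
Variable K : fieldType.
Local Notation T := (@FracField.tofrac {poly K}).
Implicit Types (D M J : pset K) (f g x p : {poly K}).

Lemma lead_power_integral D f x : is_subring D -> pol D f -> pol D (f * x) ->
  exists n, pol D (lead_coef f ^+ n *: x).
Proof.
move=> Dsr Df; have [n] := ubnP (size x); elim: n x => // n IH x Hn Dfx.
have [->|x0] := eqVneq x 0; first by exists 0%N; rewrite scaler0; exact: pol0.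
set a := lead_coef f; have Da : D a by apply: Df.
pose k := (size x).-1.
have sx : size x = k.+1 by rewrite /k prednK // size_poly_gt0.
pose c := lead_coef x.
have Dac : D (a * c).
  by rewrite /a /c -lead_coefM lead_coefE; apply: Dfx.
pose x' := \poly_(i < k) x`_i.
have Ex : x = x' + c *: 'X^k := poly_lead_split sx.
have Eax : a *: x' = a *: x - (a * c) *: 'X^k.
  by rewrite [in RHS]Ex scalerDr scalerA addrK.
have [||m Dm] := IH (a *: x').
- apply: leq_ltn_trans (size_scale_leq _ _) _; apply: leq_ltn_trans (size_poly _ _) _.
  by move: Hn; rewrite sx.
- rewrite Eax mulrBr -scalerAr; apply: polB => //; first exact: polZ.
  by apply: polM => //; apply: polZ => //; exact: polXn.
exists m.+1.
have -> : a ^+ m.+1 *: x = a ^+ m *: (a *: x') + (a ^+ m * (a * c)) *: 'X^k.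
  by rewrite {1}Ex scalerDr !scalerA exprSr mulrA.
apply: polD => //; apply: polZ => //; last exact: polXn.
by apply: srM => //; apply: srX.
Qed.

Lemma local_content D M f x : is_subring D -> prime_of D M -> pol D f ->
  ~ pol M f -> pol D (f * x) -> exists s, [/\ D s, ~ M s & pol D (s *: x)].
Proof.
move=> Dsr Mpr; have Mid := pr_id Mpr.
have [n] := ubnP (size f); elim: n f x => // n IH f x Hn Df nf Dfx.
set a := lead_coef f; have Da : D a by apply: Df.
case: (pselect (M a)) => [Ma|na]; last first.
  have [m Dm] := lead_power_integral Dsr Df Dfx.
  by exists (a ^+ m); split=> //; [exact: srX|exact: (prXn Dsr Mpr)].
have f0 : f != 0 by apply/eqP => f0; apply: nf; rewrite f0; exact: (ipol0 Mid).
pose k := (size f).-1.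
have sf : size f = k.+1 by rewrite /k prednK // size_poly_gt0.
pose f' := \poly_(i < k) f`_i.
have Ef : f = f' + a *: 'X^k := poly_lead_split sf.
have Df' : pol D f' by move=> j; rewrite coef_poly; case: ifP => // _; exact: sr0.
have nf' : ~ pol M f'.
  move=> Mf'; apply: nf; rewrite Ef; apply: (ipolD Mid) => //.
  by apply: (ipolZl Mid) => //; exact: polXn.
have [m Dm] := lead_power_integral Dsr Df Dfx.
elim: m x Dfx Dm => [|m IHm] x Dfx Dm.
  by exists 1; rewrite scale1r; split=> //; [exact: sr1|exact: pr1 Mpr|rewrite -[x]scale1r].
have Dfax : pol D (f * (a ^+ m *: x)) by rewrite -scalerAr; apply: polZ => //; exact: srX.
have [|//|//||s [Ds ns Dsx]] := IH f' (a ^+ m *: x).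
- by apply: leq_ltn_trans (size_poly _ _) _; move: Hn; rewrite sf.
- have -> : f' * (a ^+ m *: x) = f * (a ^+ m *: x) - 'X^k * (a ^+ m.+1 *: x).
    rewrite {1}Ef mulrDl -!mul_polyC exprS polyCM.
    by move: (a ^+ m)%:P a%:P 'X^k => u v w; ring.
  by apply: polB => //; apply: polM => //; exact: polXn.
have [||t [Dt nt Dtx]] := IHm (s *: x).
- by rewrite -scalerAr; apply: polZ.
- by rewrite scalerA mulrC -scalerA.
exists (t * s); split; [exact: srM|exact: (prMn Mpr)|by rewrite -scalerA].
Qed.

Lemma content_one D f x i : is_subring D -> pol D f -> f`_i = 1 ->
  pol D (f * x) -> pol D x.
Proof.
move=> Dsr Df fi Dfx.
pose I t := D t /\ pol D (t *: x).
suff [_ ] : I 1 by rewrite scale1r.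
apply: contrapT => n1.
have [|M [Mpr IM]] := exists_prime_above Dsr _ n1.
  split.
  - by move=> t [].
  - by split; [exact: sr0|rewrite scale0r; exact: pol0].
  - by move=> s t [Ds Hs] [Dt Ht]; split; [exact: srD|rewrite scalerDl; exact: polD].
  - by move=> s t Ds [Dt Ht]; split; [exact: srM|rewrite -scalerA; exact: polZ].
have nf : ~ pol M f by move=> /(_ i); rewrite fi; exact: pr1 Mpr.
have [s [Ds ns Dsx]] := local_content Dsr Mpr Df nf Dfx.
by apply: ns; apply: IM.
Qed.

Lemma clear_poly D p : is_subring D -> is_frac_field_of D ->
  exists d, [/\ D d, d != 0 & pol D (d *: p)].
Proof. by move=> Dsr Dfr; apply: clear_denoms => // i; apply: Dfr. Qed.

Lemma quasi_Prufer_UMt D : is_subring D -> is_frac_field_of D ->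
  quasi_Prufer D -> UMt D.
Proof.
move=> Dsr Dfr /(quasi_PruferP Dsr) qp Q [Qpr [F0 [QF0 F00]] Q0].
have D0 := sr0 Dsr; have Qid := pr_id Qpr; have DXsr := polyext_sr Dsr.
have Qpp := polyPrime_of Dsr Qpr; have [QD Qz QA QM [Q1 Qm]] := Qpp.
have nQc d : D d -> d != 0 -> ~ Q (T d%:P).
  by move=> Dd d0 Qd; move/eqP: d0; apply; apply: Q0; split.
have [|mu [[Qmu mu0] mumin]] := @exists_min_size K (fun f => Q (T f) /\ f != 0).
  have [f Df Ef] := proj1 (polyextE _ D0) (idS Qid QF0).
  by exists f; rewrite -Ef; split=> //; rewrite -tofrac_eq0 -Ef.
have Dmu := QD _ Qmu.
have dvd1 g : Q (T g) -> mu %| g.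
  move=> Qg; rewrite /dvdp; apply/eqP.
  have [d [Dd d0 Dq]] := clear_poly (g %/ mu) Dsr Dfr.
  apply/eqP; apply: contrapT => /negP r0.
  have lt := ltn_modpN0 g mu0.
  have : (size mu <= size (d *: (g %% mu)))%N.
    apply: mumin; split; last by rewrite scaler_eq0 negb_or d0.
    have -> : d *: (g %% mu) = d%:P * g - (d *: (g %/ mu)) * mu.
      rewrite {2}(divp_eq g mu) mulrDr -!mul_polyC; ring.
    rewrite tofracB; apply: (idB DXsr Qid); first by apply: QM => //; exact: polC.
    exact: QM.
  by rewrite size_scale // leqNgt lt.
have dvd2 g : pol D g -> mu %| g -> Q (T g).
  move=> Dg /dvdpP [q Eg]; have [d [Dd d0 Dq]] := clear_poly q Dsr Dfr.
  have : Q (T (d%:P * g)).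
    have -> : d%:P * g = (d *: q) * mu by rewrite Eg -mul_polyC mulrA.
    exact: QM.
  by case/(Qm _ _ (polC Dsr Dd) Dg) => // /(nQc _ Dd d0).
have tmu0 : T mu != 0 by rewrite tofrac_eq0.
have QX : subs Q (polyext D) := idS Qid.
split.
  split=> //.
  - by move=> /(_ 1 (sr1 DXsr)); exact: pr1 Qpr.
  - split=> x.
      move=> [s [sQ _ xv]].
      have [d [Dd d0 Hd]] : exists d, [/\ D d, d != 0 &
          forall y, y \in s -> polyext D (cst d * y / T mu)].
        have : forall y, y \in s -> Q y.
          by move=> y ys; apply: sQ; rewrite -(nth_index 0 ys); apply: fspan_mem => //; rewrite index_mem.
        elim: (s) => [|y l IH] Hl; first by exists 1; rewrite oner_neq0; split=> //; exact: sr1.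
        have [|d [Dd d0 Hd]] := IH; first by move=> z zl; apply: Hl; rewrite inE zl orbT.
        have Qy := Hl y (mem_head _ _).
        have [g Dg Eg] := proj1 (polyextE _ D0) (QX _ Qy).
        rewrite Eg in Qy; have /dvdpP [q Eq] := dvd1 _ Qy.
        have [e [De e0 Dq]] := clear_poly q Dsr Dfr.
        exists (d * e); rewrite mulf_neq0 //; split=> //; first exact: srM.
        move=> z; rewrite inE => /orP [/eqP ->|/Hd Hz].
          have -> : cst (d * e) * y / T mu = T (d%:P * (e *: q)).
            rewrite Eg Eq cstM !tofracM -mul_polyC tofracM /cst.
            by rewrite !mulrA mulfK.
          by apply/polyext_T => //; apply: polM => //; exact: polC.
        rewrite cstM [cst d * _]mulrC -!mulrA; apply: (srM DXsr); first exact/polyext_cst.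
        by rewrite mulrA.
      have inv1 : inv_of (polyext D) (fspan (polyext D) s) (cst d / T mu).
        move=> y /(fspanP _ _ DXsr) [c Dc ->]; rewrite mulr_sumr.
        apply: (sr_sum DXsr) => i _; rewrite mulrCA; apply: (srM DXsr) => //.
        by rewrite mulrAC; apply: Hd; apply: mem_nth.
      have inv2 : inv_of (polyext D) (fspan (polyext D) s) 1.
        by move=> y /sQ /QX; rewrite mul1r.
      have := xv _ inv2; rewrite mulr1 => /(polyextE _ D0) [g Dg Eg].
      have /(polyextE _ D0) [h Dh Eh] := xv _ inv1.
      rewrite Eg; apply: dvd2 => //.
      rewrite -(dvdpZr _ _ d0); apply/dvdpP; exists h.
      apply: tofrac_inj; rewrite -mul_polyC !tofracM -Eh Eg /cst.
      by rewrite -mulrA divfK // mulrC.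
    move=> Qx; exists [:: x; T mu].
    have sQ : subs (fspan (polyext D) [:: x; T mu]) Q.
      by apply: fspan_sub => // -[|[|//]].
    split=> //.
      by exists (T mu); split=> //; exact: (@fspan_mem _ _ [:: x; T mu] 1%N).
    by move=> y Hy; rewrite mulrC; apply: Hy; exact: (@fspan_mem _ _ [:: x; T mu] 0%N).
move=> J [Jid nJ [Jt _]] QJ G JG; apply: contrapT => nQG.
have JX : subs J (polyext D) := idS Jid.
have [g Dg Eg] := proj1 (polyextE _ D0) (JX _ JG); rewrite Eg in JG nQG.
have cop : coprimep mu g.
  rewrite coprimep_def; set e := gcdp mu g.
  have e0 : e != 0 by rewrite /e gcdp_eq0 negb_and mu0.
  have /dvdpP [e' Ee] : e %| mu by apply: dvdp_gcdl.
  have e'0 : e' != 0 by apply/eqP => e'0; move: mu0; rewrite Ee e'0 mul0r eqxx.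
  have [d [Dd d0 De]] := clear_poly e Dsr Dfr.
  have [d' [Dd' d'0 De']] := clear_poly e' Dsr Dfr.
  have : Q (T ((d *: e) * (d' *: e'))).
    apply: dvd2; first exact: polM.
    rewrite -scalerAl -scalerAr dvdpZr // dvdpZr // Ee mulrC; exact: dvdpp.
  case/Qm => // /dvd1.
    rewrite dvdpZr // => mue; case: nQG; apply: dvd2 => //.
    by apply: dvdp_trans mue _; exact: dvdp_gcdr.
  rewrite dvdpZr // => /(dvdp_leq e'0); rewrite Ee size_mul //.
  have : (0 < size e)%N by rewrite size_poly_gt0.
  have : (0 < size e')%N by rewrite size_poly_gt0.
  case: (size e) => // -[|m] //; case: (size e') => // l _ _.
  by rewrite addSn /= !addnS ltnS ltnNge leq_addr.
have [[u v] /= Euv] := Bezout_coprimepP _ _ cop.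
have {Euv} [c c0 Euv] : exists2 c, c != 0 & u * mu + v * g = c%:P.
  move: Euv; rewrite -size_poly_eq1 => /size_poly1P [c c0 E].
  by exists c.
have [d [Dd d0 Du]] := clear_poly u Dsr Dfr.
have [d' [Dd' d'0 Dv]] := clear_poly v Dsr Dfr.
pose a := d * d' * c.
have a0 : a != 0 by rewrite !mulf_neq0.
have Ea : a%:P = (d' *: (d *: u)) * mu + (d *: (d' *: v)) * g.
  rewrite /a polyCM -Euv -!mul_polyC polyCM; ring.
have ca0 : cst a != 0 by rewrite cst_eq0.
clearbody a.
have Du' : pol D (d' *: (d *: u)) by apply: polZ.
have Dv' : pol D (d *: (d' *: v)) by apply: polZ.
have Ja : J (cst a).
  rewrite /cst Ea tofracD !tofracM; apply: (idD Jid).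
    by apply: (idMl Jid); [exact/polyext_T|exact: QJ].
  by apply: (idMl Jid) => //; exact/polyext_T.
have [f [i [Qf fi]]] : exists (f : {poly K}) i, Q (T f) /\ f`_i = 1.
  pose I b := exists (f : {poly K}) i, Q (T f) /\ b = f`_i.
  have [[f [i [Qf E]]]|n1] := pselect (I 1); first by exists f, i.
  have [|M [Mpr IM]] := exists_prime_above Dsr _ n1.
    split.
    - by move=> _ [f [i [Qf ->]]]; apply: (QD _ Qf).
    - by exists 0, 0%N; rewrite coef0.
    - move=> _ _ [f [i [Qf ->]]] [h [j [Qh ->]]].
      exists ('X^j * f + 'X^i * h), (i + j)%N; split.
        by apply: QA; apply: QM => //; exact: polXn.
      by rewrite coefD !coefXnM !ltnNge leq_addl leq_addr /= addnK addKn.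
    - move=> r _ Dr [f [i [Qf ->]]]; exists (r%:P * f), i; rewrite coefCM; split=> //.
      by apply: QM => //; exact: polC.
  have [] := eqVneq mu 0; first by move=> E; rewrite E eqxx in mu0.
  case/negP; apply/eqP/polyP => i; rewrite coef0; apply: Q0; split; first exact: Dmu.
  apply: (qp M (fun g => Q (T g))) Qmu => // h Qh j.
  by apply: IM; exists h, j.
apply: nJ => y Xy; rewrite -[y]mulr1; apply: (idMl Jid) => //; apply: Jt.
exists [:: cst a; T f]; split.
- by apply: fspan_sub => // -[|[|//]] _ //=; exact: QJ.
- exists (cst a); split=> //.
  exact: (@fspan_mem _ _ [:: cst a; T f] 0%N).
- move=> z Hz; rewrite mul1r.
  have := Hz _ (@fspan_mem _ _ [:: cst a; T f] 0%N DXsr isT).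
  have := Hz _ (@fspan_mem _ _ [:: cst a; T f] 1%N DXsr isT) => /=.
  move=> Xzf /(polyextE _ D0) [p Dp Ep].
  have Ez : z = T (a^-1 *: p).
    by rewrite -mul_polyC tofracM -/(cst _) cstV -Ep mulrC (mulfK ca0).
  rewrite Ez; apply/polyext_T => //; apply: (content_one Dsr (QD _ Qf) fi).
  by apply/polyext_T => //; rewrite tofracM -Ez mulrC.
Qed.
End UMtFromQuasiPrufer.

(** * The pullback overring *)

Section PullbackRing.
Variables (K : fieldType) (D V : pset K) (u : K).
Local Notation T := (@FracField.tofrac {poly K}).
Hypotheses (Dsr : is_subring D) (Vv : valr V) (DV : subs D V) (Vu : V u) (nr : ~ resalg V D u).
Let Vsr : is_subring V := proj1 Vv.
Let mid := vmax_ideal Vv.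
Let mpr := vmax_prime Vv.
Let B := pullback V D.
Let Bsr : is_subring B := pullback_sr Vv Dsr DV.
Let BV : subs B V := @pullback_subV _ V D.
Let mB : subs (vmax V) B := pullback_vmax Vv Dsr.

Lemma pullback_unit y : B y -> ~ vmax V y -> B y^-1.
Proof.
move=> [Vy [t [e [Dt De nt mte]]]] ny; have [y0 Vy'] := nvmax Vy ny.
split=> //; exists e, t; split=> //.
- move=> me; have : vmax V (t * y) by rewrite -[t * y](subrK e); apply: (idD mid).
  by case/(prM mpr (DV Dt) Vy).
- have -> : e * y^-1 - t = - ((t * y - e) * y^-1) by field.
  by apply: (idN Vsr mid); apply: (idMr mid).
Qed.

Lemma pullback_transcendental f : pol B f -> vmax V f.[u] -> pol (vmax V) f.
Proof.
move=> Bf mf i; apply: contrapT => ni; apply: nr.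
apply: (@resalg_trans _ V Vv D B) => //; first exact: pullback_sub.
  move=> y [Vy [t [e [Dt De nt mte]]]]; exists (t *: 'X - e%:P); split.
  - by apply: polB => //; [apply: polZ => //; exact: polX|exact: polC].
  - by exists 1%N; rewrite coefB coefZ coefX coefC mulr1 subr0.
  - by rewrite !hornerE.
by exists f; split=> //; exists i.
Qed.

Lemma pullback_not_in : ~ B u.
Proof.
move=> Bu; have : pol (vmax V) ('X - u%:P).
  apply: pullback_transcendental.
    by apply: polB => //; [exact: polX|exact: polC].
  by rewrite !hornerE subrr; exact: vmax0.
by move=> /(_ 1%N); rewrite coefB coefX coefC subr0; exact: vmax1.
Qed.

Lemma pullback_w_trivial : w_trivial B.
Proof.
move=> s sB snz sv.
have [[y [sy ny]]|no] := pselect (exists y, fspan B s y /\ ~ vmax V y).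
  have [y0 _] := nvmax (BV (sB _ sy)) ny.
  rewrite -(mulVf y0); apply: (idMl (fspan_ideal Bsr sB)) => //.
  by apply: pullback_unit => //; apply: sB.
case: pullback_not_in; apply: (v_full_inv sv (sr1 Bsr)) => a sa; apply: mB.
apply: (idMl mid) => //; apply: contrapT => na; apply: no; by exists a.
Qed.

Lemma valuation_prime_pullback q : prime_of V q -> subs q (vmax V) -> prime_of B q.
Proof.
move=> qpr qV; have qid := pr_id qpr; apply: primeI => //.
- split.
  + by move=> x /qV /mB.
  + exact: (id0 qid).
  + by move=> x y; exact: (idD qid).
  + by move=> r x /BV; exact: (idMl qid).
- by move/qV; exact: vmax1.
- by move=> x y Bx By; apply: (prM qpr); exact: BV.
Qed.

Lemma pullback_prime_valuation q : prime_of B q -> subs q (vmax V) -> prime_of V q.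
Proof.
move=> qpr qV; have qid := pr_id qpr.
have qM v x : V v -> q x -> q (v * x).
  move=> Vv' qx; have mx := qV _ qx.
  have Bvx : B (v * x) by apply: mB; apply: (idMl mid).
  have : q ((v * x) * (v * x)).
    have -> : (v * x) * (v * x) = (v * v * x) * x by ring.
    apply: (idMl qid) => //; apply: mB; apply: (idMl mid) => //; exact: srM.
  by case/(prM qpr Bvx Bvx).
apply: primeI => //.
- split.
  + by move=> x /qV /(vmaxS Vv).
  + exact: (id0 qid).
  + by move=> x y; exact: (idD qid).
  + by move=> r x; exact: qM.
- by move/qV; exact: vmax1.
- move=> x y Vx Vy qxy.
  have [mx|nx] := pselect (vmax V x); last first.
    have [x0 Vx'] := nvmax Vx nx; right; rewrite -[y](mulKf x0); exact: qM.
  have [my|ny] := pselect (vmax V y); last first.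
    by have [y0 Vy'] := nvmax Vy ny; left; rewrite -[x](mulKf y0) [y * x]mulrC; exact: qM.
  by apply: (prM qpr) => //; exact: mB.
Qed.

Definition upper_through (n0 : pset K) f := pol B f /\ n0 f.[u].

Lemma upper_through_prime n0 : prime_of V n0 -> polyPrime B (upper_through n0).
Proof.
move=> npr; have nid := pr_id npr.
have hV f : pol B f -> V f.[u] by move=> Bf; apply: pol_horner => //; apply: pol_mono Bf.
split.
- by move=> f [].
- by split; [exact: pol0|rewrite horner0; exact: (id0 nid)].
- by move=> f g [Bf nf] [Bg ng]; split; [exact: polD|rewrite hornerD; exact: (idD nid)].
- by move=> f g Bf [Bg ng]; split; [exact: polM|rewrite hornerM; apply: (idMl nid) => //; exact: hV].
- split; first by move=> [_]; rewrite hornerC; exact: pr1 npr.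
  move=> f g Bf Bg [_]; rewrite hornerM => /(prM npr (hV _ Bf) (hV _ Bg)).
  by case=> H; [left|right].
Qed.

Lemma pullback_not_UMt a : vmax V a -> a != 0 -> ~ UMt B.
Proof.
move=> ma a0 um; have B0 := sr0 Bsr; have BXsr := polyext_sr Bsr.
have m0 : vmax V 0 by left.
have Qpp := upper_through_prime (prime_zero Vsr).
have Qpr := prime_of_polyPrime Bsr Qpp.
set Q := fun _ => _ in Qpr.
have [|_ Qmax] := um Q.
  split=> //.
  - exists (T (a *: 'X - (a * u)%:P)); split.
      exists (a *: 'X - (a * u)%:P) => //; split.
        apply: polB => //; first by apply: polZ => //; [exact: mB|exact: polX].
        by apply: polC => //; apply: mB; apply: (idMr mid).
      by rewrite !hornerE subrr.
    rewrite tofrac_eq0; apply/eqP => /(congr1 (fun p : {poly K} => p`_1)).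
    by rewrite coefB coefZ coefX coefC mulr1 subr0 coef0; apply/eqP.
  - move=> c [Bc [f [_ fu]]] /tofrac_inj E.
    by move: fu; rewrite -E hornerC.
have mBid : ideal_of B (vmax V) by exact: pr_id (valuation_prime_pullback mpr (fun _ => id)).
have mXid := polyext_ideal Bsr mBid.
have tid : t_ideal (polyext B) (polyext (vmax V)).
  split=> //.
  + by move=> /(_ 1 (sr1 BXsr)); rewrite -tofrac1 polyext_T // => /(_ 0%N); rewrite coef1; exact: vmax1.
  + split=> x.
      move=> [s [sm _ xv]].
      have inv1 : inv_of (polyext B) (fspan (polyext B) s) 1.
        by move=> y /sm /(idS mXid); rewrite mul1r.
      have invu : inv_of (polyext B) (fspan (polyext B) s) (cst u).
        move=> y /sm /(polyextE _ m0) [f mf ->]; rewrite /cst -tofracM; apply/polyext_T => // i.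
        by rewrite coefCM; apply: mB; apply: (idMl mid).
      have := xv _ inv1; rewrite mulr1 => /(polyextE _ B0) [g Bg Eg].
      have := xv _ invu; rewrite Eg /cst -tofracM polyext_T // => Bgu.
      apply/polyext_T => // i; apply: contrapT => ni.
      have [g0 _] := nvmax (BV (Bg i)) ni.
      apply: pullback_not_in; rewrite -[u](mulKf g0); apply: (srM Bsr).
        exact: pullback_unit.
      by have := Bgu i; rewrite coefMC.
    move=> mx; have ma' : polyext (vmax V) (cst a) by apply/polyext_cst.
    have sm : subs (fspan (polyext B) [:: x; cst a]) (polyext (vmax V)).
      by apply: fspan_sub => // -[|[|//]].
    exists [:: x; cst a]; split=> //.
      exists (cst a); split; last by rewrite cst_eq0.
      exact: (@fspan_mem _ _ [:: x; cst a] 1%N).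
    by move=> y Hy; rewrite mulrC; apply: Hy; exact: (@fspan_mem _ _ [:: x; cst a] 0%N).
have QV : subs Q (polyext (vmax V)).
  move=> _ [f [Bf fu] ->]; apply/polyext_T => //.
  by apply: pullback_transcendental => //; rewrite fu.
have [|f [Bf fu] /tofrac_inj E] := Qmax _ tid QV (cst a); first exact/polyext_cst.
by move: fu; rewrite -E hornerC; apply/eqP.
Qed.

Lemma pullback_not_strongS n0 : prime_of V n0 -> strict_subs n0 (vmax V) ->
  (forall q, prime_of V q -> strict_subs n0 q -> ~ strict_subs q (vmax V)) ->
  ~ w_strongS B.
Proof.
move=> npr [nm nmn] nadj ss; have nid := pr_id npr.
have st := w_trivial_star Bsr pullback_w_trivial.
have st' := starX_trivial Bsr st.
have B0 := sr0 Bsr; have n00 := id0 nid; have m0 : vmax V 0 by left.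
have [|_ _ _ /(_ (fun F => exists2 f, upper_through n0 f & F = T f))] := ss n0 (vmax V).
  split.
  - by apply/(star_primeP _ st); exact: valuation_prime_pullback.
  - by apply/(star_primeP _ st); exact: valuation_prime_pullback.
  - by [].
  - move=> q /(star_primeP _ st) qpr nq [qm mq].
    exact: (nadj q (pullback_prime_valuation qpr qm)).
have [b [mb nb]] : exists b, vmax V b /\ ~ n0 b.
  apply: contrapT => no; apply: nmn => x mx; apply: contrapT => nx; apply: no; by exists x.
case.
- by apply/(star_primeP _ st'); apply: prime_of_polyPrime => //; exact: upper_through_prime.
- split.
    move=> _ /(polyextE _ n00) [p np ->]; exists p => //; split.
      by move=> i; apply: mB; exact: nm.
    exact: (ipol_horner Vsr nid).
  move=> H; have : polyext n0 (T (b *: 'X - (b * u)%:P)).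
    apply: H; exists (b *: 'X - (b * u)%:P) => //; split.
      apply: polB => //; first by apply: polZ => //; [exact: mB|exact: polX].
      by apply: polC => //; apply: mB; apply: (idMr mid).
    by rewrite !hornerE subrr.
  rewrite polyext_T // => /(_ 1%N).
  by rewrite coefB coefZ coefX coefC mulr1 subr0.
- split.
    move=> _ [f [Bf fu] ->]; apply/polyext_T => //.
    by apply: pullback_transcendental => //; exact: nm.
  move=> H; have [|f [Bf fu] /tofrac_inj E] := H (cst b); first exact/polyext_cst.
  by move: fu; rewrite -E hornerC.
Qed.
End PullbackRing.

Section StrongSOverrings.
Variable K : fieldType.
Implicit Types (D M V q : pset K) (x y : K).

Lemma prime_in_vmax V q : valr V -> prime_of V q -> subs q (vmax V).
Proof.
move=> Vv qpr x qx; have qid := pr_id qpr; apply: contrapT => nx.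
have [x0 Vx] := nvmax (idS qid qx) nx.
by apply: (pr1 qpr); rewrite -(mulVf x0); apply: (idMl qid).
Qed.

Lemma valr_localization V q : valr V -> prime_of V q ->
  exists V', [/\ valr V', subs V V' & forall x, vmax V' x <-> q x].
Proof.
move=> Vv qpr; have [Vsr Vtot] := Vv; have qid := pr_id qpr.
pose V' x := exists s, [/\ V s, ~ q s & V (s * x)].
have V'P x : x != 0 -> V' x <-> ~ q x^-1.
  move=> x0; split=> [[s [Vs ns Vsx]] qx|nq].
    by apply: ns; rewrite -[s](mulfK x0); apply: (idMl qid).
  have [Vx|Vx] := Vtot _ x0; last by exists x^-1; rewrite mulVf //; split=> //; exact: sr1.
  by exists 1; rewrite mul1r; split=> //; [exact: sr1|exact: pr1 qpr].
have VV' : subs V V'.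
  by move=> x Vx; exists 1; rewrite mul1r; split=> //; [exact: sr1|exact: pr1 qpr].
exists V'; split=> //.
  split.
    split.
    - exact: VV' (sr0 Vsr).
    - exact: VV' (sr1 Vsr).
    - move=> x y [s [Vs ns Vsx]] [t [Vt nt Vty]]; exists (s * t); split.
      + exact: srM.
      + exact: (prMn qpr).
      + have -> : s * t * (x - y) = t * (s * x) - s * (t * y) by ring.
        by apply: srB => //; apply: srM.
    - move=> x y [s [Vs ns Vsx]] [t [Vt nt Vty]]; exists (s * t); split.
      + exact: srM.
      + exact: (prMn qpr).
      + have -> : s * t * (x * y) = (s * x) * (t * y) by ring.
        exact: srM.
  by move=> x x0; have [/VV' Vx|/VV' Vx] := Vtot _ x0; [left|right].
move=> x; have [->|x0] := eqVneq x 0.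
  by split=> _; [exact: (id0 qid)|exact: vmax0].
have xV0 : x^-1 != 0 by rewrite invr_eq0.
split=> [[/eqP|]|qx]; first by rewrite (negbTE x0).
  by move=> nV; apply: contrapT => nq; apply: nV; apply/V'P => //; rewrite invrK.
by right=> /(V'P _ xV0); rewrite invrK.
Qed.

Lemma minimal_prime D I : is_subring D -> ideal_of D I -> ~ I 1 ->
  exists M, [/\ prime_of D M, subs I M &
    forall q, prime_of D q -> subs I q -> subs q M -> subs M q].
Proof.
move=> Dsr Iid I1; have [M0 [M0pr IM0]] := exists_prime_above Dsr Iid I1.
pose G (A : pset K) := prime_of D (fun x => ~ A x) /\ subs I (fun x => ~ A x).
have [||A [[Apr IA] Amax]] := @zorn_union _ G.
- exists (fun x => ~ M0 x); rewrite /G.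
  have -> : (fun x => ~ ~ M0 x) = M0.
    by apply/funext => x; apply/propext; split=> [/contrapT|Mx /(_ Mx)].
  by split.
- move=> F [A0 FA0] FG Ftot; have [A0pr IA0] := FG _ FA0.
  have pid A : F A -> ideal_of D (fun x => ~ A x) by move=> /FG [/pr_id].
  have all x : ~ (exists2 A, F A & A x) <-> forall A, F A -> ~ A x.
    by split=> [no A FA Ax|H [A FA]]; [apply: no; exists A|exact: H].
  split; last by move=> x Ix; apply/all => A FA; have [_ H] := FG _ FA; exact: H.
  apply: primeI => //.
  + split.
    * by move=> x /all H; apply: (idS (pid _ FA0)); exact: H.
    * by apply/all => A FA; exact: (id0 (pid _ FA)).
    * by move=> x y /all Hx /all Hy; apply/all => A FA; apply: (idD (pid _ FA)); [exact: Hx|exact: Hy].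
    * by move=> r x Dr /all Hx; apply/all => A FA; apply: (idMl (pid _ FA)) => //; exact: Hx.
  + by move=> /all /(_ _ FA0); exact: (pr1 A0pr).
  + move=> x y Dx Dy /all Hxy; apply: contrapT => /not_orP [/contrapT [A FA Ax] /contrapT [B FB By]].
    have [C [FC Cx Cy]] : exists C : pset K, [/\ F C, C x & C y].
      have [AB|BA] := Ftot _ _ FA FB; first by exists B; split=> //; exact: AB.
      by exists A; split=> //; exact: BA.
    by have [Cpr _] := FG _ FC; have [] := prM Cpr Dx Dy (Hxy _ FC).
exists (fun x => ~ A x); split=> // q qpr Iq qA x nAx; apply: contrapT => nq.
apply: nAx; apply: (Amax (fun x => ~ q x)) => //; last by move=> y Ay /qA.
have Eq : (fun x => ~ ~ q x) = q.
  by apply/funext => y; apply/propext; split=> [/contrapT|Mx /(_ Mx)].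
by split; rewrite Eq.
Qed.

(* [n0] is here the intersection of the ideals [c^n V], just below the prime [sqrt (c V)]. *)
Lemma strongS_w_trivial D : is_subring D ->
  (forall B, overring D B -> w_strongS B) -> w_trivial D.
Proof.
move=> Dsr ss s sD snz sv; apply: contrapT => n1.
have Jid := fspan_ideal Dsr sD.
have [M [Mpr JM Mmin]] := minimal_prime Dsr Jid n1.
have [Q [f [i [Qpr QM Qf Jf nQ]]]] := v_full_upper Dsr sD snz sv Mpr JM.
have [V [u [Vv DV Vu Vm nr]]] := residually_transcendental Dsr Mpr Qpr QM Qf nQ.
have [Vsr Vtot] := Vv; have mid := vmax_ideal Vv.
have [c [cs c0 Hc]] : exists c, [/\ c \in s, c != 0 & forall x, x \in s -> V (x / c)].
  apply: valr_min_seq => //; case: snz => x [/(fspanP _ _ Dsr) [d _ Ex] x0].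
  apply: contrapT => no; move/eqP: x0; apply; rewrite Ex big1 // => j _.
  have [->|sj0] := eqVneq s`_j 0; first by rewrite mulr0.
  by case: no; exists s`_j => //; apply: mem_nth.
have Jmem x : x \in s -> fspan D s x.
  by move=> xs; rewrite -(nth_index 0 xs); apply: fspan_mem => //; rewrite index_mem.
have Vc : V c by apply: DV; apply: sD; apply: Jmem.
have mc : vmax V c by apply/Vm; [apply: sD; exact: Jmem|apply: JM; exact: Jmem].
pose q x := V x /\ exists n, V (x ^+ n / c).
have qup x n m : V x -> V (x ^+ n / c) -> (n <= m)%N -> V (x ^+ m / c).
  move=> Vx Vxn le; rewrite -(subnK le) exprD -mulrA; apply: srM => //; exact: srX.
have Vcinv : ~ V c^-1 by case: mc => // /eqP; rewrite (negbTE c0).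
have qpr : prime_of V q.
  apply: primeI => //.
  - split.
    + by move=> x [].
    + by split; [exact: sr0|exists 1%N; rewrite expr1 mul0r; exact: sr0].
    + move=> x y [Vx [n Hx]] [Vy [m Hy]]; split; first exact: srD.
      exists (n + m)%N; rewrite exprDn mulr_suml; apply: sr_sum => // k _.
      rewrite mulrnAl -mulr_natl; apply: srM => //.
        by elim: 'C(_, _) => [|j IH]; rewrite ?mulrS; [exact: sr0|apply: srD => //; exact: sr1].
      have [le|lt] := leqP m k.
        rewrite -mulrA; apply: srM => //; first exact: srX.
        exact: (qup y m k).
      rewrite mulrAC; apply: srM => //; last exact: srX.
      by apply: (qup x n) => //; move: lt; clear; lia.
    + move=> r x Vr [Vx [n Hx]]; split; first exact: srM.
      by exists n; rewrite exprMn -mulrA; apply: srM => //; exact: srX.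
  - by move=> [_ [n]]; rewrite expr1n mul1r.
  - have half x y n : V x -> V y -> x != 0 -> V (y / x) -> V ((x * y) ^+ n / c) -> q y.
      move=> Vx Vy x0 Vyx Hn; split=> //; exists (n + n)%N.
      have -> : y ^+ (n + n) / c = (y / x) ^+ n * ((x * y) ^+ n / c).
        rewrite exprD (exprMn n x y) expr_div_n.
        have x0' : x ^+ n != 0 by rewrite expf_neq0.
        by move: (x ^+ n) (y ^+ n) x0' => X Y X0; field; rewrite X0 c0.
      by apply: srM => //; exact: srX.
    have q0 : q 0 by split; [exact: sr0|exists 1%N; rewrite expr1 mul0r; exact: sr0].
    move=> x y Vx Vy [_ [n Hn]].
    have [->|x0] := eqVneq x 0; first by left.
    have [->|y0] := eqVneq y 0; first by right.
    have [|Vxy|Vyx] := Vtot (x / y); first by rewrite mulf_neq0 ?invr_eq0.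
      by left; apply: (half y x n) => //; rewrite [y * x]mulrC.
    by right; apply: (half x y n) => //; move: Vyx; rewrite invf_div.
have [V' [V'v VV' V'm]] := valr_localization Vv qpr.
have [V'sr _] := V'v.
have DV' : subs D V' by move=> x /DV /VV'.
have qV : subs q (vmax V) by exact: prime_in_vmax.
have Mq : subs M q.
  have qDpr : prime_of D (fun x => D x /\ q x).
    have qid := pr_id qpr; apply: primeI => //.
    - split.
      + by move=> x [].
      + by split; [exact: sr0|exact: (id0 qid)].
      + by move=> x y [Dx qx] [Dy qy]; split; [exact: srD|exact: (idD qid)].
      + by move=> r x Dr [Dx qx]; split; [exact: srM|apply: (idMl qid) => //; exact: DV].
    - by move=> [_]; exact: pr1 qpr.
    - by move=> x y Dx Dy [_ /(prM qpr (DV _ Dx) (DV _ Dy))] [H|H]; [left|right].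
  have JqD : subs (fspan D s) (fun x => D x /\ q x).
    apply: (fspan_sub Dsr (pr_id qDpr)) => i' lt; have si := mem_nth 0 lt.
    have Ds : D s`_i' by apply: sD; exact: Jmem.
    split=> //; split; first exact: DV.
    by exists 1%N; rewrite expr1; exact: Hc.
  have qDM : subs (fun x => D x /\ q x) M by move=> x [Dx /qV /(Vm _ Dx)].
  by move=> x /(Mmin _ qDpr JqD qDM) [].
have nr' : ~ resalg V' D u.
  move=> [p [Dp [j nj] mp]]; apply: nr; exists p; split=> //.
    by exists j => /(Vm _ (Dp j)) /Mq /V'm.
  by apply: qV; apply/V'm.
pose n0 x := forall n, V (x / c ^+ n).
have inv n x : x != 0 -> ~ V (x / c ^+ n) -> V (c ^+ n / x).
  move=> x0 nV; have [|//|] := Vtot (x / c ^+ n); last by rewrite invf_div.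
  by rewrite mulf_neq0 // invr_eq0 expf_neq0.
have n0V x : n0 x -> V x by move=> /(_ 0%N); rewrite expr0 divr1.
have n00 : n0 0 by move=> n; rewrite mul0r; exact: sr0.
have cX n : c ^+ n != 0 by rewrite expf_neq0.
have n0pr : prime_of V' n0.
  apply: primeI => //.
  - split=> //.
    + by move=> x /n0V /VV'.
    + by move=> x y Hx Hy n; rewrite mulrDl; apply: srD.
    + move=> r x V'r Hx; have [->|r0] := eqVneq r 0; first by rewrite mul0r.
      have [Vr|nVr] := pselect (V r); first by move=> n; rewrite -mulrA; apply: srM.
      have Vri : V r^-1 by case: (Vtot _ r0).
      have Vcr : V (c * r).
        have nq : ~ V (r^-1 / c).
          move=> H; have /V'm : q r^-1 by split=> //; exists 1%N; rewrite expr1.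
          by apply: vmax_unit; rewrite ?invrK // invr_eq0.
        have := inv 1%N r^-1 _ _; rewrite expr1 invrK; apply=> //.
        by rewrite invr_eq0.
      move=> n; have -> : r * x / c ^+ n = (c * r) * (x / c ^+ n.+1).
        by rewrite exprS; move: (c ^+ n) (cX n) => C C0; field; rewrite C0 c0.
      by apply: srM.
  - by move=> /(_ 1%N); rewrite expr1 mul1r.
  - move=> x y _ _ Hxy; apply: contrapT => /not_orP [nx ny].
    have [n nVx] : exists n, ~ V (x / c ^+ n).
      by apply: contrapT => no; apply: nx => n; apply: contrapT => nn; apply: no; exists n.
    have [m nVy] : exists m, ~ V (y / c ^+ m).
      by apply: contrapT => no; apply: ny => k; apply: contrapT => nn; apply: no; exists k.
    have x0 : x != 0 by apply/eqP => x0; apply: nx; rewrite x0.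
    have y0 : y != 0 by apply/eqP => y0; apply: ny; rewrite y0.
    apply: Vcinv.
    have -> : c^-1 = (c ^+ n / x) * (c ^+ m / y) * ((x * y) / c ^+ (n + m).+1).
      rewrite exprS exprD; move: (c ^+ n) (c ^+ m) (cX n) (cX m) => C E C0 E0.
      by field; rewrite x0 y0 C0 E0 c0.
    by apply: srM => //; apply: srM => //; exact: inv.
have qc : q c by split=> //; exists 1%N; rewrite expr1 divff //; exact: sr1.
apply: (pullback_not_strongS Dsr V'v DV' (VV' _ Vu) nr' n0pr _ _ (ss _ _)).
- split.
    move=> x n0x; apply/V'm; split; first exact: n0V.
    by exists 1%N; have := n0x 1%N; rewrite !expr1.
  move=> H; have /H /(_ 2%N) : vmax V' c by apply/V'm.
  have -> : c / c ^+ 2 = c^-1 by field; rewrite c0.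
  exact: Vcinv.
- move=> q0 q0pr [_ nq0] [_ nq]; have q0id := pr_id q0pr.
  have [q0c|nq0c] := pselect (q0 c).
    apply: nq => x /V'm [Vx [n Hn]].
    apply: (prX V'sr q0pr (n := n)); first exact: VV'.
    rewrite -(divfK c0 (x ^+ n)); apply: (idMl q0id) => //; exact: VV'.
  apply: nq0 => x q0x n; apply: contrapT => nVn; apply: nq0c.
  have x0 : x != 0 by apply/eqP => x0; apply: nVn; rewrite x0 mul0r; exact: sr0.
  apply: (prX V'sr q0pr (n := n)); first exact: VV'.
  rewrite -(divfK x0 (c ^+ n)); apply: (idMl q0id) => //.
  by apply: VV'; exact: inv.
- split; first exact: (pullback_sr V'v Dsr DV').
  exact: pullback_sub.
Qed.

Lemma finite_dim_predecessor V N a : valr V -> dim_le V N -> vmax V a -> a != 0 ->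
  exists n0, [/\ prime_of V n0, strict_subs n0 (vmax V) &
    forall q, prime_of V q -> strict_subs n0 q -> ~ strict_subs q (vmax V)].
Proof.
move=> Vv dV ma a0; have [Vsr _] := Vv; apply: contrapT => no.
have step q : prime_of V q -> strict_subs q (vmax V) ->
    exists q', [/\ prime_of V q', strict_subs q q' & strict_subs q' (vmax V)].
  move=> qpr qm; apply: contrapT => noq; apply: no; exists q; split=> // q' q'pr qq' q'm.
  by apply: noq; exists q'.
have [P [Ppr Ps _]] : exists P : nat -> pset K, [/\
    forall i, (i <= N.+1)%N -> prime_of V (P i),
    forall i, (i < N.+1)%N -> strict_subs (P i) (P i.+1) &
    strict_subs (P N.+1) (vmax V)].
  elim: N.+1 => [|n [P [Ppr Ps Pm]]].
    exists (fun _ x => x = 0); split=> //.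
    - by move=> _ _; exact: prime_zero.
    - split; first by move=> x ->; exact: vmax0.
      by move=> /(_ a ma) /eqP; apply/negP.
  have [q' [q'pr Pq' q'm]] := step _ (Ppr n (leqnn n)) Pm.
  exists (fun i => if (i <= n)%N then P i else q'); split.
  - by move=> i _; case: leqP => // le; exact: Ppr.
  - move=> i; rewrite ltnS leq_eqVlt => /orP [/eqP ->|lt].
      by rewrite eqxx ltnn.
    by rewrite lt orbT; exact: Ps.
  - by rewrite ltnn.
by have := dV N.+1 P Ppr Ps; rewrite ltnn.
Qed.

Lemma strongS_quasi_Prufer D : is_subring D -> w_dimv_finite D ->
  (forall B, overring D B -> w_strongS B) -> quasi_Prufer D.
Proof.
move=> Dsr [N HN] ss; apply: contrapT => nqp.
have wt := strongS_w_trivial Dsr ss.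
have [V [u [Vv DV Vu nr [a [Da a0 ma]]]]] := not_quasi_Prufer Dsr nqp.
have dV : dim_le V N.
  apply: HN; split.
    by case: Vv => Vsr Vtot; split.
  move=> s snz x [t [tD tnz tv H]].
  have [c [sc Dc ->]] : fspan D s x by apply: H; exists 1; rewrite mulr1; split=> //; exact: wt.
  by exists c; split=> // i lt; apply: DV; exact: Dc.
have [n0 [n0pr n0m nadj]] := finite_dim_predecessor Vv dV ma a0.
apply: (pullback_not_strongS Dsr Vv DV Vu nr n0pr n0m nadj).
apply: ss; split; first exact: (pullback_sr Vv Dsr DV).
exact: pullback_sub.
Qed.

Lemma UMt_quasi_Prufer D : is_subring D ->
  (forall B, overring D B -> UMt B) -> quasi_Prufer D.
Proof.
move=> Dsr um; apply: contrapT => nqp.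
have [V [u [Vv DV Vu nr [a [Da a0 ma]]]]] := not_quasi_Prufer Dsr nqp.
apply: (pullback_not_UMt Dsr Vv DV Vu nr ma a0).
apply: um; split; first exact: (pullback_sr Vv Dsr DV).
exact: pullback_sub.
Qed.

End StrongSOverrings.

Theorem theorem3p1 (R : idomainType) :
  w_dimv_finite (@base_dom R) ->
  ((forall T, overring (@base_dom R) T -> w_stably_strongS T) <->
   (forall T, overring (@base_dom R) T -> w_strongS T)) /\
  ((forall T, overring (@base_dom R) T -> w_strongS T) <->
   (forall T, overring (@base_dom R) T -> UMt T)) /\
  ((forall T, overring (@base_dom R) T -> UMt T) <->
   quasi_Prufer (@base_dom R)).
Proof.
move=> dimD; set D := @base_dom R.
have Dsr : is_subring D.
  split.
  - by exists 0; rewrite tofrac0.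
  - by exists 1; rewrite tofrac1.
  - by move=> _ _ [a ->] [b ->]; exists (a - b); rewrite tofracB.
  - by move=> _ _ [a ->] [b ->]; exists (a * b); rewrite tofracM.
have Dfr : is_frac_field_of D.
  move=> x; have [a [b [b0 ->]]] := fraction_div x.
  exists (FracField.tofrac a), (FracField.tofrac b); rewrite tofrac_eq0.
  by split=> //; [exists a|exists b].
have fr T : overring D T -> is_frac_field_of T.
  move=> [_ DT] x; have [a [b [Da Db b0 ->]]] := Dfr x.
  by exists a, b; split=> //; exact: DT.
have qpT T : quasi_Prufer D -> overring D T -> quasi_Prufer T.
  exact: quasi_Prufer_overring.
have stable_strong :
    (forall T, overring D T -> w_stably_strongS T) -> forall T, overring D T -> w_strongS T.
  by move=> H T DT; exact: (H T DT 0%N).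
have strong_qp := strongS_quasi_Prufer Dsr dimD.
have qp_stable : quasi_Prufer D -> forall T, overring D T -> w_stably_strongS T.
  by move=> qp T DT; apply: quasi_Prufer_stably_strongS; [case: DT|exact: qpT].
have qp_umt : quasi_Prufer D -> forall T, overring D T -> UMt T.
  by move=> qp T DT; apply: quasi_Prufer_UMt; [case: DT|exact: fr|exact: qpT].
have umt_qp := UMt_quasi_Prufer Dsr.
by split; [|split]; split=> H; auto.
Qed.
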